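(* Let $X$ be a simplicial set, let $p\ge 2$ be a prime number, and let $(f,g,\phi)$ be the Eilenberg-Zilber contraction from $C_*^{N}(X\times\cdots\times X)$ ($p$ factors) to $C_*^{N}(X)\otimes\cdots\otimes C_*^{N}(X)$ ($p$ factors). For every non-negative integer $i$ define $$D_i=f\,\gamma_i\,\phi\,\gamma_{i-1}\,\phi\cdots\phi\,\gamma_1\,\phi\,\Delta : C_*^{N}(X)\to C_*^{N}(X)^{\otimes p}$$ (so $D_0=f\Delta$, and put $D_{-1}=0$). Then the sequence of morphisms $\{D_i\}$ satisfies $$d\,D_i+(-1)^{i+1}D_i\,d=\alpha_i\,D_{i-1},$$ where $\alpha_{2j-1}=T-1$ and $\alpha_{2j}=1+T+T^2+\cdots+T^{p-1}$.
   Context: Coefficients are in a commutative ring $R$ with unit. $C_*^{N}(X)$ is the normalized chain complex of the simplicial set $X$ (free $R$-module on simplices modulo degenerate simplices, $d=\sum_i(-1)^i\partial_i$); $d$ also denotes the differential of the tensor product. $\Delta:C_*^{N}(X)\to C_*^{N}(X^{\times p})$ is the linear map with $\Delta(x)=(x,\dots,x)$ on simplices. $t:C_*^{N}(X^{\times p})\to C_*^{N}(X^{\times p})$ is $t(x_1,\dots,x_p)=(x_2,\dots,x_p,x_1)$. $T:C_*^{N}(X)^{\otimes p}\to C_*^{N}(X)^{\otimes p}$ is $T(x_1\otimes\cdots\otimes x_p)=(-1)^{|x_1|(|x_2|+\cdots+|x_p|)}x_2\otimes\cdots\otimes x_p\otimes x_1$. Define $\gamma_{2j-1}=t$ and $\gamma_{2j}=t+t^2+\cdots+t^{p-1}$.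 A contraction from a chain complex $N$ to a chain complex $M$ is a triple $(f,g,\phi)$ with chain maps $f:N\to M$, $g:M\to N$ and a degree $+1$ map $\phi:N\to N$ with $fg=1$, $\phi d+d\phi=gf-1$, $\phi g=0$, $f\phi=0$, $\phi\phi=0$. Given contractions $(f_i,g_i,\phi_i)$ from $N_i$ to $M_i$, $i=1,2$: the tensor product contraction from $N_1\otimes N_2$ to $M_1\otimes M_2$ is $(f_1\otimes f_2,g_1\otimes g_2,\phi_1\otimes g_2f_2+1\otimes\phi_2)$ (Koszul sign convention), and if $N_2=M_1$ the composition contraction from $N_1$ to $M_2$ is $(f_2f_1,g_1g_2,\phi_1+g_1\phi_2f_1)$. The Eilenberg-Zilber contraction $(AW,EML,SHI)$ from $C_*^{N}(X\times Y)$ to $C_*^{N}(X)\otimes C_*^{N}(Y)$ is given as follows. A $(p,q)$-shuffle $(\alpha,\beta)$ is a partition of $\{0,\dots,p+q-1\}$ into $\alpha_1<\dots<\alpha_p$, $\beta_1<\dots<\beta_q$, with $sig(\alpha,\beta)=\sum_{i=1}^p(\alpha_i-(i-1))$. $$AW(a_m\times b_m)=\sum_{i=0}^m\partial_{i+1}\cdots\partial_m a_m\otimes\partial_0\cdots\partial_{i-1}b_m,$$ $$EML(a_p\otimes b_q)=\sum_{(p,q)\text{-shuffles}}(-1)^{sig(\alpha,\beta)}s_{\beta_q}\cdots s_{\beta_1}a_p\times s_{\alpha_p}\cdots s_{\alpha_1}b_q,$$ $SHI(a_0\times b_0)=0$ and, for $m\ge 1$, $$SHI(a_m\times b_m)=\sum(-1)^{\bar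 m+sig(\alpha,\beta)+1}s_{\beta_q+\bar m}\cdots s_{\beta_1+\bar m}s_{\bar m-1}\partial_{m-q+1}\cdots\partial_m a_m\times s_{\alpha_{p+1}+\bar m}\cdots s_{\alpha_1+\bar m}\partial_{\bar m}\cdots\partial_{m-q-1}b_m,$$ with $\bar m=m-p-q$, the sum over $0\le q\le m-1$, $0\le p\le m-q-1$ and $(p+1,q)$-shuffles $(\alpha,\beta)$. For $p=2$ the contraction $(f,g,\phi)$ is $(AW,EML,SHI)$ with $Y=X$. For $p>2$ it is defined recursively as the composition of the contraction $(AW,EML,SHI)$ from $C_*^{N}(X\times X^{\times(p-1)})$ to $C_*^{N}(X)\otimes C_*^{N}(X^{\times(p-1)})$ with the tensor product of the identity contraction $(1,1,0)$ of $C_*^{N}(X)$ and the Eilenberg-Zilber contraction from $C_*^{N}(X^{\times(p-1)})$ to $C_*^{N}(X)^{\otimes(p-1)}$. *)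

(* Defs.v *)
From HB Require Import structures.
From mathcomp Require Import all_boot all_order all_algebra finmap.
From mathcomp Require Import boolp classical_sets functions cardinality fsbigop.
From mathcomp Require Import monalg.
Set Implicit Arguments.
Unset Strict Implicit.
Unset Printing Implicit Defensive.
Import GRing.Theory.
Local Open Scope ring_scope.
Local Open Scope quotient_scope.

(* Submodule generated by S, and the quotient lquot S = V / span S. *)
Inductive span (R : comNzRingType) (V : lmodType R) (S : V -> Prop) : V -> Prop :=
| span0 : span S 0
| spanS a s v : S s -> span S v -> span S (a *: s + v).

Section SpanTheory.
Variables (R : comNzRingType) (V : lmodType R) (S : V -> Prop).

Lemma span_gen s : S s -> span S s.
Proof. by move=> Ss; rewrite -[s]addr0 -[s]scale1r; apply: spanS (span0 S). Qed.

Lemma spanD u v : span S u -> span S v -> span S (u + v).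
Proof.
by move=> + Sv; elim=> [|a s w Ss _ IH]; rewrite ?add0r // -addrA; apply: spanS.
Qed.

Lemma spanZ a v : span S v -> span S (a *: v).
Proof.
elim=> [|b s w Ss _ IH]; first by rewrite scaler0; apply: span0.
by rewrite scalerDr scalerA; apply: spanS.
Qed.

Definition span_pred : {pred V} := fun v => `[< span S v >].

Lemma span_predP v : reflect (span S v) (v \in span_pred).
Proof. exact: asboolP. Qed.

Fact span_zmod_closed : zmod_closed span_pred.
Proof.
split=> [|u v /span_predP Su /span_predP Sv]; apply/span_predP; first exact: span0.
by rewrite -scaleN1r; apply/spanD/spanZ.
Qed.
HB.instance Definition _ := GRing.isZmodClosed.Build V span_pred span_zmod_closed.

Definition lquot := Quotient.quot (span_pred : zmodClosed V).
HB.instance Definition _ := GRing.Zmodule.on lquot.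
HB.instance Definition _ := Quotient.on lquot.

Definition lcls (v : V) : lquot := \pi_lquot v.

Lemma lcls_eq u v : span S (u - v) <-> lcls u = lcls v.
Proof.
split=> [/span_predP|/eqP].
  by rewrite Quotient.idealrBE => /eqP.
by rewrite -Quotient.idealrBE => /span_predP.
Qed.

Lemma lcls_repr (x : lquot) : lcls (repr x) = x. Proof. exact: reprK. Qed.

Lemma repr_lcls v : span S (repr (lcls v) - v).
Proof. by apply/lcls_eq; rewrite lcls_repr. Qed.

Lemma lclsD u v : lcls (u + v) = lcls u + lcls v.
Proof. by rewrite /lcls !piE. Qed.

Definition lquot_scale a (x : lquot) : lquot := lcls (a *: repr x).

Lemma lquot_scaleE a v : lquot_scale a (lcls v) = lcls (a *: v).
Proof. by apply/lcls_eq; rewrite -scalerBr; apply/spanZ/repr_lcls. Qed.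

Fact lquot_scaleA a b x : lquot_scale a (lquot_scale b x) = lquot_scale (a * b) x.
Proof. by rewrite -[x]lcls_repr !lquot_scaleE scalerA. Qed.
Fact lquot_scale1 : left_id 1 lquot_scale.
Proof. by move=> x; rewrite -[x]lcls_repr lquot_scaleE scale1r. Qed.
Fact lquot_scaleDr : right_distributive lquot_scale +%R.
Proof.
move=> a x y; rewrite -[x]lcls_repr -[y]lcls_repr -lclsD.
by rewrite !lquot_scaleE -lclsD scalerDr.
Qed.
Fact lquot_scaleDl x : {morph lquot_scale^~ x : a b / a + b}.
Proof. by move=> a b; rewrite -[x]lcls_repr !lquot_scaleE -lclsD scalerDl. Qed.
HB.instance Definition _ := GRing.Zmodule_isLmodule.Build R lquot
  lquot_scaleA lquot_scale1 lquot_scaleDr lquot_scaleDl.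

Fact lcls_is_linear : linear lcls.
Proof. by move=> a u v; rewrite lclsD -lquot_scaleE. Qed.
HB.instance Definition _ := GRing.isLinear.Build R V lquot *:%R lcls lcls_is_linear.

End SpanTheory.

Section Free.
Variables (R : comNzRingType) (K : choiceType) (W : lmodType R) (F : K -> W).

Definition flift (g : {malg R[K]}) : W := \sum_(k <- msupp g) g@_k *: F k.

Lemma flift_wide (g : {malg R[K]}) (D : {fset K}) : (msupp g `<=` D)%fset ->
  flift g = \sum_(k <- D) g@_k *: F k.
Proof.
move=> le; rewrite /flift (big_fset_incl _ le) // => k _ /mcoeff_outdom ->.
by rewrite scale0r.
Qed.

Fact flift_is_linear : linear flift.
Proof.
move=> a g h; pose D := (msupp g `|` msupp h `|` msupp (a *: g + h))%fset.
rewrite !(@flift_wide _ D) /D; try by apply/fsubsetP=> x; rewrite !inE => ->; rewrite ?orbT.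
rewrite scaler_sumr -big_split; apply: eq_bigr => k _ /=.
by rewrite mcoeffD mcoeffZ scalerDl scalerA.
Qed.
HB.instance Definition _ := GRing.isLinear.Build R {malg R[K]} W *:%R flift flift_is_linear.

Lemma fliftU k : flift << k >> = F k.
Proof. by rewrite (flift_wide msuppU_le) big_seq_fset1 mcoeffUU scale1r. Qed.
End Free.

(* qlift F, clift F and tlift B are the maps induced on a quotient, on normalized
   chains and on a tensor product: they are evaluated on a representative, hence
   are defined for every F, and are the induced linear maps as soon as F kills the
   relations (resp. the degenerate simplices), resp. B is bilinear: see qlift_lcls,
   clift_cbas, tlift_tens and the corresponding _linear lemmas. *)
Section Lifts.
Variables (R : comNzRingType) (V W : lmodType R) (S : V -> Prop).
Variable F : V -> W.

Definition qlift (x : lquot S) : W := F (repr x).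

Hypothesis F_lin : linear F.
Hypothesis F0 : forall s, S s -> F s = 0.

Let F_span v : span S v -> F v = 0.
Proof.
elim=> [|a s w Ss _ IH]; last by rewrite F_lin F0 // IH scaler0 addr0.
by have := F_lin (-1) 0 0; rewrite scaler0 addr0 scaleN1r addNr.
Qed.

Lemma qlift_lcls v : qlift (lcls S v) = F v.
Proof.
apply/eqP; rewrite /qlift -subr_eq0 -scaleN1r addrC -F_lin scaleN1r addrC.
by apply/eqP/F_span/repr_lcls.
Qed.

Lemma qlift_linear : linear qlift.
Proof.
move=> a x y; rewrite -[x]lcls_repr -[y]lcls_repr -linearP !qlift_lcls.
exact: F_lin.
Qed.
End Lifts.

Definition bilin (R : comNzRingType) (M N W : lmodType R) (B : M -> N -> W) :=
  (forall y, linear (B^~ y)) /\ (forall x, linear (B x)).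

Section Tensor.
Variables (R : comNzRingType) (M N : lmodType R).

Inductive bilin_rel : {malg R[(M * N)%type]} -> Prop :=
| BilinL a x x' y : bilin_rel (<< (a *: x + x', y) >> - (a *: << (x, y) >> + << (x', y) >>))
| BilinR a x y y' : bilin_rel (<< (x, a *: y + y') >> - (a *: << (x, y) >> + << (x, y') >>)).

Definition tensor := lquot bilin_rel.
HB.instance Definition _ := GRing.Lmodule.on tensor.

Definition tens (x : M) (y : N) : tensor := lcls bilin_rel << (x, y) >>.

Lemma tens_bilin : bilin tens.
Proof.
split=> [y a x x'|x a y y']; rewrite /tens -linearP; apply/lcls_eq/span_gen.
  exact: BilinL.
exact: BilinR.
Qed.

Section Lift.
Variables (W : lmodType R) (B : M -> N -> W).

Definition tlift : tensor -> W := qlift (flift (fun xy => B xy.1 xy.2)).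

Hypothesis B_bilin : bilin B.

Let tlift0 s : bilin_rel s -> flift (fun xy => B xy.1 xy.2) s = 0.
Proof.
case: B_bilin => Bl Br.
by case=> [a x x' y|a x y y']; rewrite linearB linearP /= !fliftU /= (Bl, Br) subrr.
Qed.

Lemma tlift_tens x y : tlift (tens x y) = B x y.
Proof. by rewrite /tlift qlift_lcls ?fliftU //; apply: linearP. Qed.

Lemma tlift_linear : linear tlift.
Proof. by apply: qlift_linear tlift0 => //; apply: linearP. Qed.
End Lift.

Lemma tensor_ind (P : tensor -> Prop) :
  P 0 -> (forall a x y z, P z -> P (a *: tens x y + z)) -> forall z, P z.
Proof.
move=> P0 PS z; rewrite -[z]lcls_repr [repr z]monalgE.
elim: (finmap.enum_fset _) => [|k s IH]; first by rewrite big_nil linear0.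
rewrite big_cons linearD.
suff -> : << (repr z)@_k *g k >> = (repr z)@_k *: << k >>.
  by rewrite linearZ; case: k => x y; apply: PS.
by apply/malgP=> k'; rewrite mcoeffZ !mcoeffU mulr_natr.
Qed.

Lemma tensor_linext (W : lmodType R) (F G : tensor -> W) : linear F -> linear G ->
  (forall x y, F (tens x y) = G (tens x y)) -> F =1 G.
Proof.
move=> Fl Gl FG; elim/tensor_ind => [|a x y z IH]; last by rewrite Fl Gl FG IH.
have lin0 H : linear H -> H 0 = 0 :> W.
  by move=> Hl; have := Hl (-1) 0 0; rewrite scaler0 addr0 scaleN1r addNr.
by rewrite !lin0.
Qed.
End Tensor.

(* A chain complex concentrated in degrees >= 0 is represented by the direct sum
   of its components: hcomp n is the projection onto the component of degree n,
   and hcompK, hcomp_sum say that the module is the direct sum of the images of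
   the hcomp n. A graded map of any degree is then a map of the total modules. *)
Record chain_complex (R : comNzRingType) := ChainComplex {
  ch_mod :> lmodType R;
  hcomp : nat -> ch_mod -> ch_mod;
  diff : ch_mod -> ch_mod;
  hcomp_linear n : linear (hcomp n);
  diff_linear : linear diff;
  hcompK m n x : hcomp m (hcomp n x) = if m == n then hcomp n x else 0;
  hcomp_sum x : exists N, x = \sum_(n < N) hcomp n x;
  diff_hcomp n x : diff (hcomp n x) = if n is m.+1 then hcomp m (diff x) else 0;
  diffK x : diff (diff x) = 0
}.
HB.instance Definition _ (R : comNzRingType) (C : chain_complex R) n :=
  GRing.isLinear.Build R (ch_mod C) (ch_mod C) *:%R (hcomp n) (@hcomp_linear R C n).
HB.instance Definition _ (R : comNzRingType) (C : chain_complex R) :=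
  GRing.isLinear.Build R (ch_mod C) (ch_mod C) *:%R (@diff R C) (@diff_linear R C).

Section HomogeneousSum.
Variables (R : comNzRingType) (V : lmodType R) (h : nat -> V -> V).
Hypothesis h_lin : forall n, linear (h n).
Definition has_hsum x := exists N, forall M, (N <= M)%N -> x = \sum_(n < M) h n x.

Let h0 n : h n 0 = 0.
Proof. by have := h_lin n (-1) 0 0; rewrite scaler0 addr0 scaleN1r addNr. Qed.

Lemma has_hsum0 : has_hsum 0.
Proof. by exists 0%N => M _; rewrite big1. Qed.

Lemma has_hsumP a x y : has_hsum x -> has_hsum y -> has_hsum (a *: x + y).
Proof.
move=> [N xN] [N' yN']; exists (maxn N N') => M; rewrite geq_max => /andP[le le'].
under eq_bigr do rewrite h_lin.
by rewrite big_split -scaler_sumr /= -xN // -yN'.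
Qed.

Lemma has_hsum_sum (I : Type) (r : seq I) (F : I -> V) :
  (forall i, has_hsum (F i)) -> has_hsum (\sum_(i <- r) F i).
Proof.
move=> gF; elim: r => [|i r IH]; first by rewrite big_nil; apply: has_hsum0.
by rewrite big_cons -[F i]scale1r; apply: has_hsumP.
Qed.

Lemma has_hsum_homog k x : (forall n, h n x = if n == k then x else 0) -> has_hsum x.
Proof.
move=> hx; exists k.+1 => M ltkM; rewrite (bigD1 (Ordinal ltkM)) //= hx eqxx.
by rewrite big1 ?addr0 // => i /negbTE; rewrite -val_eqE /= hx => ->.
Qed.
End HomogeneousSum.

Section ComplexTheory.
Variables (R : comNzRingType) (C : chain_complex R).
Implicit Types x : C.

Lemma hcomp_bound x : exists N, (forall n, (N <= n)%N -> hcomp n x = 0) /\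
  forall M, (N <= M)%N -> x = \sum_(n < M) hcomp n x.
Proof.
have [N xN] := hcomp_sum x; have x0 n : (N <= n)%N -> hcomp n x = 0.
  move=> leNn; rewrite xN linear_sum big1 // => i _; rewrite /= hcompK.
  by case: eqP => // eni; have := ltn_ord i; rewrite -eni ltnNge leNn.
exists N; split=> // M leNM; rewrite -(big_mkord xpredT (fun n => hcomp n x)).
rewrite (big_cat_nat _ leNM) //= big_mkord -xN big_nat_cond big1 ?addr0 //.
by move=> i /andP[/andP[/x0]].
Qed.

Lemma hcomp_has_hsum x : has_hsum (@hcomp R C) x.
Proof. by have [N [_]] := hcomp_bound x; exists N. Qed.

End ComplexTheory.

Lemma fsum_bound (V : zmodType) (F : nat -> V) N :
  (forall n, (N <= n)%N -> F n = 0) ->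
  \sum_(n \in [set: nat]) F n = \sum_(n < N) F n.
Proof.
move=> F0; rewrite fsbig_ord; apply/esym/fsbig_widen => // n [_ /= /negP].
by rewrite -leqNgt => /F0.
Qed.

Section Sign.
Variables (R : comNzRingType) (C : chain_complex R).
Implicit Types x y : C.

(* x |-> (-1)^|x| x *)
Definition ksign x : C := \sum_(n \in [set: nat]) (-1) ^+ n *: hcomp n x.

Lemma ksign_bound x N : (forall n, (N <= n)%N -> hcomp n x = 0) ->
  ksign x = \sum_(n < N) (-1) ^+ n *: hcomp n x.
Proof. by move=> xN; apply: fsum_bound => n /xN->; rewrite scaler0. Qed.

Fact ksign_linear : linear ksign.
Proof.
move=> a x y; have [N [xN _]] := hcomp_bound x; have [N' [yN' _]] := hcomp_bound y.
pose M := maxn N N'; have le n : (M <= n)%N -> (N <= n)%N && (N' <= n)%N.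
  by rewrite geq_max.
have zx n : (M <= n)%N -> hcomp n x = 0 by move=> /le /andP[/xN].
have zy n : (M <= n)%N -> hcomp n y = 0 by move=> /le /andP[_ /yN'].
rewrite (ksign_bound zx) (ksign_bound zy) (@ksign_bound _ M); last first.
  by move=> n leMn; rewrite linearP /= zx // zy // scaler0 addr0.
rewrite scaler_sumr -big_split; apply: eq_bigr => n _ /=.
by rewrite linearP scalerDr !scalerA mulrC.
Qed.
HB.instance Definition _ := GRing.isLinear.Build R C C *:%R ksign ksign_linear.

Lemma ksign_hcomp n x : ksign (hcomp n x) = (-1) ^+ n *: hcomp n x.
Proof.
rewrite (@ksign_bound _ n.+1) => [|m lt]; last by rewrite hcompK gtn_eqF.
rewrite big_ord_recr /= hcompK eqxx big1 ?add0r // => i _.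
by rewrite hcompK ltn_eqF ?scaler0.
Qed.

Lemma hcomp_ind (W : lmodType R) (F G : {linear C -> W}) :
  (forall n x, F (hcomp n x) = G (hcomp n x)) -> F =1 G.
Proof.
move=> FG x; have [N ->] := hcomp_sum x.
by rewrite !linear_sum; apply: eq_bigr.
Qed.

Lemma hcomp_ksign n x : hcomp n (ksign x) = ksign (hcomp n x).
Proof.
apply: (hcomp_ind (F := hcomp n \o ksign) (G := ksign \o hcomp n)) => m {}x /=.
rewrite ksign_hcomp linearZ /= hcompK; case: eqP => _.
  by rewrite ksign_hcomp.
by rewrite [ksign 0]linear0 scaler0.
Qed.

Lemma ksignK x : ksign (ksign x) = x.
Proof.
apply: (hcomp_ind (F := ksign \o ksign) (G := idfun)) => m {}x /=.
by rewrite ksign_hcomp linearZ /= ksign_hcomp scalerA -expr2 sqrr_sign scale1r.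
Qed.

Lemma diff_ksign x : diff (ksign x) = - ksign (diff x).
Proof.
apply: (hcomp_ind (F := @diff R C \o ksign) (G := -%R \o (ksign \o @diff R C))).
move=> m {}x /=; rewrite ksign_hcomp linearZ /= diff_hcomp.
case: m => [|m]; first by rewrite scaler0 linear0 oppr0.
by rewrite ksign_hcomp exprS mulN1r scaleNr.
Qed.
End Sign.

Section TensorComplex.
Variables (R : comNzRingType) (C D : chain_complex R).

(* (C (x) D)_n = (+)_(i + j = n) C_i (x) D_j, and
   d (x (x) y) = d x (x) y + (-1)^|x| x (x) d y. *)
Definition thcomp n : tensor C D -> tensor C D :=
  tlift (fun x y => \sum_(i < n.+1) tens (hcomp i x) (hcomp (n - i) y)).
Definition tdiff : tensor C D -> tensor C D :=
  tlift (fun x y => tens (diff x) y + tens (ksign x) (diff y)).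

Let tl (a : R) (x x' : C) (y : D) : tens (a *: x + x') y = a *: tens x y + tens x' y.
Proof. exact: (tens_bilin C D).1. Qed.
Let tr (a : R) (x : C) (y y' : D) : tens x (a *: y + y') = a *: tens x y + tens x y'.
Proof. exact: (tens_bilin C D).2. Qed.
Let t0l (y : D) : tens (0 : C) y = 0.
Proof. by have := tl (-1) 0 0 y; rewrite scaler0 addr0 scaleN1r addNr. Qed.
Let t0r (x : C) : tens x (0 : D) = 0.
Proof. by have := tr (-1) x 0 0; rewrite scaler0 addr0 scaleN1r addNr. Qed.
Let tZl (a : R) (x : C) (y : D) : tens (a *: x) y = a *: tens x y.
Proof. by rewrite -[a *: x]addr0 tl t0l addr0. Qed.
Let tZr (a : R) (x : C) (y : D) : tens x (a *: y) = a *: tens x y.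
Proof. by rewrite -[a *: y]addr0 tr t0r addr0. Qed.

Let thcompB n : bilin (fun (x : C) (y : D) =>
  \sum_(i < n.+1) tens (hcomp i x) (hcomp (n - i) y)).
Proof.
split=> [y a x x'|x a y y'] /=; rewrite scaler_sumr -big_split;
  by apply: eq_bigr => i _; rewrite linearP (tl, tr).
Qed.

Let tdiffB : bilin (fun (x : C) (y : D) => tens (diff x) y + tens (ksign x) (diff y)).
Proof.
split=> [y a x x'|x a y y'] /=.
  by rewrite !linearP !tl scalerDr addrACA.
by rewrite !linearP !tr scalerDr addrACA.
Qed.

Fact thcomp_linear n : linear (thcomp n).
Proof. exact: tlift_linear. Qed.
Fact tdiff_linear : linear tdiff.
Proof. exact: tlift_linear. Qed.
HB.instance Definition _ n :=
  GRing.isLinear.Build R (tensor C D) (tensor C D) *:%R (thcomp n) (thcomp_linear n).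
HB.instance Definition _ :=
  GRing.isLinear.Build R (tensor C D) (tensor C D) *:%R tdiff tdiff_linear.

Lemma thcomp_tens n (x : C) (y : D) :
  thcomp n (tens x y) = \sum_(i < n.+1) tens (hcomp i x) (hcomp (n - i) y).
Proof. exact: tlift_tens. Qed.
Lemma tdiff_tens (x : C) (y : D) :
  tdiff (tens x y) = tens (diff x) y + tens (ksign x) (diff y).
Proof. exact: tlift_tens. Qed.

Let thcomp_homog n i j (x : C) (y : D) : thcomp n (tens (hcomp i x) (hcomp j y)) =
  if n == (i + j)%N then tens (hcomp i x) (hcomp j y) else 0.
Proof.
rewrite thcomp_tens; case: eqP => [->|neq].
  have ltin : (i < (i + j).+1)%N by rewrite ltnS leq_addr.
  rewrite (bigD1 (Ordinal ltin)) //= addKn !hcompK !eqxx big1 ?addr0 // => k.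
  by rewrite -val_eqE /= hcompK => /negbTE->; rewrite t0l.
rewrite big1 // => k _; rewrite !hcompK.
case: eqP => [eki|_]; last by rewrite t0l.
case: eqP => [ekj|_]; last by rewrite t0r.
by case: neq; rewrite -ekj -eki subnKC // -ltnS.
Qed.

Let tens_suml I (r : seq I) (F : I -> C) (y : D) :
  tens (\sum_(i <- r) F i) y = \sum_(i <- r) tens (F i) y.
Proof.
elim: r => [|i r IH]; first by rewrite !big_nil t0l.
by rewrite !big_cons -[F i]scale1r tl IH !scale1r.
Qed.
Let tens_sumr I (r : seq I) (x : C) (F : I -> D) :
  tens x (\sum_(i <- r) F i) = \sum_(i <- r) tens x (F i).
Proof.
elim: r => [|i r IH]; first by rewrite !big_nil t0r.
by rewrite !big_cons -[F i]scale1r tr IH !scale1r.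
Qed.

Let homog_ind (W : lmodType R) (F G : {linear tensor C D -> W}) :
  (forall i j x y, F (tens (hcomp i x) (hcomp j y)) = G (tens (hcomp i x) (hcomp j y))) ->
  F =1 G.
Proof.
move=> FG; apply: tensor_linext => [||x y]; try exact: linearP.
have [N ->] := hcomp_sum x; have [N' ->] := hcomp_sum y.
rewrite tens_suml !linear_sum; apply: eq_bigr => i _ /=.
by rewrite tens_sumr !linear_sum; apply: eq_bigr => j _ /=.
Qed.

Fact thcompK m n z : thcomp m (thcomp n z) = if m == n then thcomp n z else 0.
Proof.
have /= -> := homog_ind (F := thcomp m \o thcomp n)
  (G := (if m == n then 1 else 0) \*: thcomp n) _ z.
  by case: eqP; rewrite ?scale1r ?scale0r.
move=> i j x y /=; rewrite (thcomp_homog n); case: (eqVneq n _) => [->|_].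
  by rewrite thcomp_homog; case: eqP; rewrite ?scale1r ?scale0r.
by rewrite linear0 scaler0.
Qed.

Fact thcomp_sum z : exists N, z = \sum_(n < N) thcomp n z.
Proof.
suff [N zN] : has_hsum thcomp z by exists N; apply: zN.
elim/tensor_ind: z => [|a x y z IH]; first exact: has_hsum0 thcomp_linear.
suff gxy : has_hsum thcomp (tens x y) by exact: (@has_hsumP R (tensor C D) thcomp thcomp_linear a _ _ gxy IH).
have [N ->] := hcomp_sum x; have [N' ->] := hcomp_sum y.
rewrite tens_suml; apply: (has_hsum_sum thcomp_linear) => i.
rewrite tens_sumr; apply: (has_hsum_sum thcomp_linear) => j.
by apply: (@has_hsum_homog _ _ _ (i + j)%N) => n; rewrite thcomp_homog.
Qed.

Fact tdiff_hcomp n z :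
  tdiff (thcomp n z) = if n is m.+1 then thcomp m (tdiff z) else 0.
Proof.
case: n => [|n].
  apply: (tensor_linext (F := tdiff \o thcomp 0) (G := \0)) => [||x y].
  - exact: linearP.
  - exact: linearP.
  - rewrite /= thcomp_tens big_ord1 tdiff_tens !diff_hcomp.
    by rewrite t0l t0r addr0.
apply: (tensor_linext (F := tdiff \o thcomp n.+1) (G := thcomp n \o tdiff)) => [||x y].
- exact: linearP.
- exact: linearP.
rewrite /= thcomp_tens linear_sum tdiff_tens linearD /= !thcomp_tens.
under eq_bigr do rewrite tdiff_tens.
rewrite big_split /=; congr (_ + _).
  rewrite big_ord_recl /= diff_hcomp t0l add0r; apply: eq_bigr => i _.
  by rewrite diff_hcomp subSS.
rewrite big_ord_recr /= subnn diff_hcomp t0r addr0; apply: eq_bigr => i _.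
by rewrite subSn -1?ltnS // diff_hcomp hcomp_ksign.
Qed.

Fact tdiffK z : tdiff (tdiff z) = 0.
Proof.
apply: (tensor_linext (F := tdiff \o tdiff) (G := \0)) => [||x y].
- exact: linearP.
- exact: linearP.
rewrite /= tdiff_tens linearD /= !tdiff_tens !diffK t0l t0r add0r addr0.
by rewrite diff_ksign -scaleN1r tZl scaleN1r addrN.
Qed.

Definition tensor_complex : chain_complex R :=
  ChainComplex thcomp_linear tdiff_linear thcompK thcomp_sum tdiff_hcomp tdiffK.
End TensorComplex.

(* Faces and degeneracies are indexed by ordinals; the simplicial identities
   quantify over nat indices in range, on which inord is faithful. *)
Record sset := SSet {
  sk :> nat -> Type;
  face : forall n, 'I_n.+2 -> sk n.+1 -> sk n;
  degen : forall n, 'I_n.+1 -> sk n -> sk n.+1;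
  face_face n (i j : nat) (x : sk n.+2) : (i < j <= n.+2)%N ->
    face (inord i) (face (inord j) x) = face (inord j.-1) (face (inord i) x);
  degen_degen n (i j : nat) (x : sk n) : (i <= j <= n)%N ->
    degen (inord i) (degen (inord j) x) = degen (inord j.+1) (degen (inord i) x);
  face_degen_lt n (i j : nat) (x : sk n.+1) : (i < j <= n.+1)%N ->
    face (inord i) (degen (inord j) x) = degen (inord j.-1) (face (inord i) x);
  face_degen_eq n (i : nat) (x : sk n) : (i <= n)%N ->
    face (inord i) (degen (inord i) x) = x;
  face_degen_succ n (i : nat) (x : sk n) : (i <= n)%N ->
    face (inord i.+1) (degen (inord i) x) = x;
  face_degen_gt n (i j : nat) (x : sk n.+1) : (j.+1 < i <= n.+2)%N ->
    face (inord i) (degen (inord j) x) = degen (inord j) (face (inord i.-1) x)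
}.

Section Product.
Variables X Y : sset.
Definition psk n := (X n * Y n)%type.
Definition pface n (i : 'I_n.+2) (x : psk n.+1) : psk n := (face i x.1, face i x.2).
Definition pdegen n (i : 'I_n.+1) (x : psk n) : psk n.+1 := (degen i x.1, degen i x.2).

Fact psk_face_face n (i j : nat) (x : psk n.+2) : (i < j <= n.+2)%N ->
  pface (inord i) (pface (inord j) x) = pface (inord j.-1) (pface (inord i) x).
Proof. by move=> lt; rewrite /pface /= !(face_face _ lt). Qed.
Fact psk_degen_degen n (i j : nat) (x : psk n) : (i <= j <= n)%N ->
  pdegen (inord i) (pdegen (inord j) x) = pdegen (inord j.+1) (pdegen (inord i) x).
Proof. by move=> lt; rewrite /pdegen /= !(degen_degen _ lt). Qed.
Fact psk_face_degen_lt n (i j : nat) (x : psk n.+1) : (i < j <= n.+1)%N ->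
  pface (inord i) (pdegen (inord j) x) = pdegen (inord j.-1) (pface (inord i) x).
Proof. by move=> lt; rewrite /pface /pdegen /= !(face_degen_lt _ lt). Qed.
Fact psk_face_degen_eq n (i : nat) (x : psk n) : (i <= n)%N ->
  pface (inord i) (pdegen (inord i) x) = x.
Proof. by case: x => x y lt; rewrite /pface /= !(face_degen_eq _ lt). Qed.
Fact psk_face_degen_succ n (i : nat) (x : psk n) : (i <= n)%N ->
  pface (inord i.+1) (pdegen (inord i) x) = x.
Proof. by case: x => x y lt; rewrite /pface /= !(face_degen_succ _ lt). Qed.
Fact psk_face_degen_gt n (i j : nat) (x : psk n.+1) : (j.+1 < i <= n.+2)%N ->
  pface (inord i) (pdegen (inord j) x) = pdegen (inord j) (pface (inord i.-1) x).
Proof. by move=> lt; rewrite /pface /pdegen /= !(face_degen_gt _ lt). Qed.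

Definition sprod : sset :=
  SSet psk_face_face psk_degen_degen psk_face_degen_lt psk_face_degen_eq
    psk_face_degen_succ psk_face_degen_gt.
End Product.

Definition simp (X : sset) := {n : nat & X n}.
HB.instance Definition _ X := gen_eqMixin (simp X).
HB.instance Definition _ X := gen_choiceMixin (simp X).

Definition Simp (X : sset) n (x : X n) : simp X := existT _ n x.

Definition sdim X (x : simp X) : nat := projT1 x.

(* Total versions of the face and degeneracy operators: the value of sface on a
   0-simplex, or at an index out of range, is irrelevant and never used. *)
Definition sface X (i : nat) (x : simp X) : simp X :=
  match x with
  | existT 0 _ => x
  | existT n.+1 y => existT _ n (face (inord i) y)
  end.

Definition sdegen X (i : nat) (x : simp X) : simp X :=
  let: existT n y := x in existT _ n.+1 (degen (inord i) y).

Definition degenerate X (x : simp X) : Prop :=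
  exists n (i : 'I_n.+1) (y : X n), x = existT _ n.+1 (degen i y).

Section Chains.
Variables (R : comNzRingType) (X : sset).

Inductive degen_chain : {malg R[simp X]} -> Prop :=
| DegenChain x : degenerate x -> degen_chain << x >>.

Definition nchains := lquot degen_chain.
HB.instance Definition _ := GRing.Lmodule.on nchains.

Definition cbas (x : simp X) : nchains := lcls degen_chain << x >>.

Lemma cbas_degen x : degenerate x -> cbas x = 0.
Proof.
move=> dx; rewrite -[RHS](linear0 (lcls degen_chain)); apply/lcls_eq.
by rewrite subr0; apply/span_gen/DegenChain.
Qed.

Section Lift.
Variables (W : lmodType R) (F : simp X -> W).
Definition clift : nchains -> W := qlift (flift F).

Hypothesis F0 : forall x, degenerate x -> F x = 0.
Let F0' s : degen_chain s -> flift F s = 0.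
Proof. by case=> x /F0 <-; rewrite fliftU. Qed.

Lemma clift_cbas x : clift (cbas x) = F x.
Proof. by rewrite /clift qlift_lcls ?fliftU //; apply: linearP. Qed.

Lemma clift_linear : linear clift.
Proof. by apply: qlift_linear F0' => //; apply: linearP. Qed.
End Lift.

Lemma nchains_ind (P : nchains -> Prop) :
  P 0 -> (forall a x z, P z -> P (a *: cbas x + z)) -> forall z, P z.
Proof.
move=> P0 PS z; rewrite -[z]lcls_repr [repr z]monalgE.
elim: (finmap.enum_fset _) => [|k s IH]; first by rewrite big_nil linear0.
rewrite big_cons linearD.
suff -> : << (repr z)@_k *g k >> = (repr z)@_k *: << k >>.
  by rewrite linearZ; apply: PS.
by apply/malgP=> k'; rewrite mcoeffZ !mcoeffU mulr_natr.
Qed.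

Lemma nchains_linext (W : lmodType R) (F G : nchains -> W) : linear F -> linear G ->
  (forall x, F (cbas x) = G (cbas x)) -> F =1 G.
Proof.
move=> Fl Gl FG; elim/nchains_ind => [|a x z IH]; last by rewrite Fl Gl FG IH.
have lin0 H : linear H -> H 0 = 0 :> W.
  by move=> Hl; have := Hl (-1) 0 0; rewrite scaler0 addr0 scaleN1r addNr.
by rewrite !lin0.
Qed.

Definition dim_part (n : nat) (x : simp X) : nchains := if sdim x == n then cbas x else 0.
Definition bound (x : simp X) : nchains :=
  match x with
  | existT 0 _ => 0
  | existT n.+1 y => \sum_(i < n.+2) (-1) ^+ i *: cbas (existT _ n (face i y))
  end.

Definition nhcomp n : nchains -> nchains := clift (dim_part n).
Definition ndiff : nchains -> nchains := clift bound.

Let dim_part0 n x : degenerate x -> dim_part n x = 0.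
Proof. by rewrite /dim_part => /cbas_degen->; rewrite if_same. Qed.

Let cbasD n (i : 'I_n.+1) (y : X n) : cbas (existT _ n.+1 (degen i y)) = 0.
Proof. by apply: cbas_degen; exists n, i, y. Qed.

Let bound0 x : degenerate x -> bound x = 0.
Proof.
move=> [n [j [y ->]]] /=.
pose a : 'I_n.+2 := widen_ord (leqnSn _) j; pose b : 'I_n.+2 := lift ord0 j.
have ab : b != a by rewrite -val_eqE /= /bump /= add1n eqn_leq ltnn.
have jn : (j <= n)%N by rewrite -ltnS.
rewrite (bigD1 a) //= (bigD1 b) //= [X in _ + (_ + X)]big1 ?addr0.
  have ea : face a (degen j y) = y.
    by have := face_degen_eq y jn; rewrite inord_val; congr (face _ _ = _);
       apply/val_inj; rewrite /= inordK // ltnS ltnW.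
  have eb : face b (degen j y) = y.
    by have := face_degen_succ y jn; rewrite inord_val; congr (face _ _ = _);
       apply/val_inj; rewrite /= inordK.
  by rewrite ea eb /= /bump /= add1n exprS mulN1r scaleNr addrN.
move=> i /andP[]; rewrite -!val_eqE /= /bump /= add1n => ija ijb.
have ltin := ltn_ord i.
rewrite -[i]inord_val -[j]inord_val; case: n => [|n] in i j y a b ab jn ija ijb ltin *.
  by case: i j ija ijb {a b ab jn} ltin => -[|[|?]] ? [[|?] ?].
case: (ltngtP i j) ija => // ij _.
  by rewrite face_degen_lt ?ij // cbasD scaler0.
rewrite face_degen_gt ?cbasD ?scaler0 //.
by apply/andP; split; [rewrite ltn_neqAle eq_sym ijb | rewrite -ltnS].
Qed.

Fact nhcomp_linear n : linear (nhcomp n).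
Proof. exact/clift_linear/dim_part0. Qed.
Fact ndiff_linear : linear ndiff.
Proof. exact/clift_linear/bound0. Qed.
HB.instance Definition _ n :=
  GRing.isLinear.Build R nchains nchains *:%R (nhcomp n) (nhcomp_linear n).
HB.instance Definition _ := GRing.isLinear.Build R nchains nchains *:%R ndiff ndiff_linear.

Lemma nhcomp_cbas n x : nhcomp n (cbas x) = if sdim x == n then cbas x else 0.
Proof. exact/clift_cbas/dim_part0. Qed.
Lemma ndiff_cbas0 (y : X 0) : ndiff (cbas (existT _ 0 y)) = 0.
Proof. exact/clift_cbas/bound0. Qed.
Lemma ndiff_cbas n (y : X n.+1) : ndiff (cbas (existT _ n.+1 y)) =
  \sum_(i < n.+2) (-1) ^+ i *: cbas (existT _ n (face i y)).
Proof. exact/clift_cbas/bound0. Qed.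

Fact nhcompK m n z : nhcomp m (nhcomp n z) = if m == n then nhcomp n z else 0.
Proof.
have /= -> := nchains_linext (F := nhcomp m \o nhcomp n)
  (G := (if m == n then 1 else 0) \*: nhcomp n) (linearP _) (linearP _) _ z.
  by case: eqP; rewrite ?scale1r ?scale0r.
move=> x; rewrite /= nhcomp_cbas; case: (eqVneq (sdim x) n) => [<-|_].
  by rewrite nhcomp_cbas eq_sym; case: eqP; rewrite ?scale1r ?scale0r.
by rewrite [nhcomp m 0]linear0 scaler0.
Qed.

Fact nhcomp_sum z : exists N, z = \sum_(n < N) nhcomp n z.
Proof.
suff [N zN] : has_hsum nhcomp z by exists N; apply: zN.
elim/nchains_ind: z => [|a x z IH]; first exact: has_hsum0 nhcomp_linear.
suff gx : has_hsum nhcomp (cbas x) by exact: (@has_hsumP R nchains nhcomp nhcomp_linear a _ _ gx IH).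
by apply: (@has_hsum_homog _ _ _ (sdim x)) => n; rewrite nhcomp_cbas eq_sym.
Qed.

Fact ndiff_hcomp n z : ndiff (nhcomp n z) = if n is m.+1 then nhcomp m (ndiff z) else 0.
Proof.
have zz (W : lmodType R) (F : {linear nchains -> W}) : F 0 = 0 by rewrite linear0.
case: n => [|n].
  apply: (nchains_linext (F := ndiff \o nhcomp 0) (G := \0) (linearP _) (linearP _)).
  move=> [[|k] y] /=; first by rewrite nhcomp_cbas /= ndiff_cbas0.
  by rewrite nhcomp_cbas /= zz.
apply: (nchains_linext (F := ndiff \o nhcomp n.+1) (G := nhcomp n \o ndiff)
  (linearP _) (linearP _)).
move=> [[|k] y] /=; first by rewrite nhcomp_cbas /= ndiff_cbas0 !zz.
rewrite nhcomp_cbas /= eqSS ndiff_cbas linear_sum; case: eqP => [<-|/eqP/negPf nk].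
  rewrite ndiff_cbas; apply: eq_bigr => i _.
  by rewrite linearZ /= nhcomp_cbas eqxx.
rewrite zz big1 // => i _.
by rewrite linearZ /= nhcomp_cbas /= nk scaler0.
Qed.

Let alt_sum0 (N : nat) (G : nat -> nat -> nchains) :
  (forall i j, (j < i <= N)%N -> G i j = G j i.-1) ->
  \sum_(i < N.+1) \sum_(j < N) (-1) ^+ (i + j) *: G i j = 0.
Proof.
move=> GE.
under eq_bigr => i _ do rewrite (bigID (fun j : 'I_N => (j < i)%N)) /=.
rewrite big_split /= [X in _ + X]big_ord_recr /= [X in _ + (_ + X)]big1 ?addr0; last first.
  by move=> j; rewrite ltn_ord.
under eq_bigr do rewrite big_mkcond /=.
rewrite exchange_big /= -big_split big1 //= => j _.
rewrite big_ord_recl /= add0r.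
rewrite [X in _ + X]big_mkcond -big_split big1 //= => k _.
rewrite /bump /= add1n ltnS -leqNgt; case: leqP => // jk; last by rewrite addr0.
rewrite GE /=; last by rewrite ltnS jk /=.
by rewrite addSn exprS mulN1r scaleNr addnC addNr.
Qed.

Fact ndiffK z : ndiff (ndiff z) = 0.
Proof.
apply: (nchains_linext (F := ndiff \o ndiff) (G := \0) (linearP _) (linearP _)).
move=> [[|n] y] /=; first by rewrite ndiff_cbas0 [LHS]linear0.
rewrite ndiff_cbas linear_sum /=; case: n y => [|n] y.
  by rewrite big1 // => i _; rewrite linearZ /= ndiff_cbas0 scaler0.
rewrite -[RHS](@alt_sum0 n.+2
  (fun i j => cbas (existT _ n (face (inord j) (face (inord i) y))))).
  apply: eq_bigr => i _; rewrite linearZ /= ndiff_cbas scaler_sumr.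
  by apply: eq_bigr => j _; rewrite scalerA -exprD !inord_val.
by move=> i j lt; rewrite face_face.
Qed.

Definition CN : chain_complex R :=
  ChainComplex nhcomp_linear ndiff_linear nhcompK nhcomp_sum ndiff_hcomp ndiffK.
End Chains.

(* Only the three maps (f, g, phi): that the contraction identities hold for the
   maps below is the Eilenberg-Zilber theorem, and is not built in. *)
Record contraction_data (R : comNzRingType) (N M : chain_complex R) := ContractionData {
  ctr_f : N -> M;
  ctr_g : M -> N;
  ctr_phi : N -> N
}.

Section Contractions.
Variable R : comNzRingType.

Definition id_contraction (N : chain_complex R) : contraction_data N N :=
  ContractionData id id (fun=> 0).

Definition comp_contraction (N1 N2 M2 : chain_complex R)
    (c1 : contraction_data N1 N2) (c2 : contraction_data N2 M2) : contraction_data N1 M2 :=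
  ContractionData (ctr_f c2 \o ctr_f c1) (ctr_g c1 \o ctr_g c2)
    (fun x => ctr_phi c1 x + ctr_g c1 (ctr_phi c2 (ctr_f c1 x))).

(* phi = phi1 (x) g2 f2 + 1 (x) phi2; since phi2 has degree 1, the Koszul rule gives
   (1 (x) phi2) (x (x) y) = (-1)^|x| x (x) phi2 y. *)
Definition tensor_contraction (N1 M1 N2 M2 : chain_complex R)
    (c1 : contraction_data N1 M1) (c2 : contraction_data N2 M2) :
    contraction_data (tensor_complex N1 N2) (tensor_complex M1 M2) :=
  @ContractionData R (tensor_complex N1 N2) (tensor_complex M1 M2)
    (tlift (fun x y => tens (ctr_f c1 x) (ctr_f c2 y)))
    (tlift (fun x y => tens (ctr_g c1 x) (ctr_g c2 y)))
    (tlift (fun x y => tens (ctr_phi c1 x) (ctr_g c2 (ctr_f c2 y))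
                       + tens (ksign x) (ctr_phi c2 y))).
End Contractions.

(* The operator words d_(s_1) ... d_(s_k) and s_(s_1) ... s_(s_k); the last letter
   acts first. *)
Definition faces X (s : seq nat) (x : simp X) : simp X := foldr (@sface X) x s.
Definition degens X (s : seq nat) (x : simp X) : simp X := foldr (@sdegen X) x s.

(* A (p, q)-shuffle (alpha, beta) is encoded by the set A = {alpha_1, ..., alpha_p}
   in 'I_(p + q); then beta is the increasing enumeration of ~: A. *)
Definition shuffle_seq n (A : {set 'I_n}) : seq nat := [seq val i | i <- enum A].
Definition shuffle_sig n (A : {set 'I_n}) : nat :=
  (\sum_(i < size (shuffle_seq A)) (nth 0 (shuffle_seq A) i - i))%N.

Section EilenbergZilber.
Variables (R : comNzRingType) (X Y : sset).

Definition simp_fst (c : simp (sprod X Y)) : simp X :=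
  Simp (projT2 c).1.
Definition simp_snd (c : simp (sprod X Y)) : simp Y :=
  Simp (projT2 c).2.

(* The simplex a x b of X x Y; it is only used for a, b of equal dimension. *)
Definition cross (a : simp X) (b : simp Y) : CN R (sprod X Y) :=
  let: existT m x := a in let: existT n y := b in
  match @eqP _ m n with
  | ReflectT e => cbas R (Simp (X := sprod X Y) (eq_rect m X x n e, y))
  | ReflectF _ => 0
  end.

Definition AW_basis (c : simp (sprod X Y)) : tensor_complex (CN R X) (CN R Y) :=
  let m := sdim c in let a := simp_fst c in let b := simp_snd c in
  \sum_(i < m.+1)
    tens (cbas R (faces (iota i.+1 (m - i)) a) : CN R X)
         (cbas R (faces (iota 0 i) b) : CN R Y).

Definition EML_basis (a : simp X) (b : simp Y) : CN R (sprod X Y) :=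
  let p := sdim a in let q := sdim b in
  \sum_(A : {set 'I_(p + q)} | #|A| == p)
    (-1) ^+ shuffle_sig A *:
    cross (degens (rev (shuffle_seq (~: A))) a) (degens (rev (shuffle_seq A)) b).

Definition SHI_basis (c : simp (sprod X Y)) : CN R (sprod X Y) :=
  let m := sdim c in let a := simp_fst c in let b := simp_snd c in
  \sum_(q < m) \sum_(p < m - q) \sum_(A : {set 'I_(p.+1 + q)} | #|A| == p.+1)
    let mb := (m - p - q)%N in
    (-1) ^+ (mb + shuffle_sig A + 1) *:
    cross (degens (rev [seq (j + mb)%N | j <- shuffle_seq (~: A)])
             (sdegen mb.-1 (faces (iota (m - q).+1 q) a)))
          (degens (rev [seq (j + mb)%N | j <- shuffle_seq A])
             (faces (iota mb (m - q - mb)) b)).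

Definition EZ : contraction_data (CN R (sprod X Y)) (tensor_complex (CN R X) (CN R Y)) :=
  @ContractionData R (CN R (sprod X Y)) (tensor_complex (CN R X) (CN R Y))
    (clift AW_basis)
    (tlift (fun x y => clift (fun a => clift (EML_basis a) y) x))
    (clift SHI_basis).
End EilenbergZilber.

(* In this section the parameter k stands for k + 1 factors:
   spow X k = X x (X x (... x X)) and tpow C k = C (x) (C (x) (... (x) C)). *)
Section Powers.
Variables (R : comNzRingType) (X : sset).

Fixpoint spow (k : nat) : sset := if k is k'.+1 then sprod X (spow k') else X.

Fixpoint tpow (C : chain_complex R) (k : nat) : chain_complex R :=
  if k is k'.+1 then tensor_complex C (tpow C k') else C.

Fixpoint EZpow (k : nat) : contraction_data (CN R (spow k)) (tpow (CN R X) k) :=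
  match k return contraction_data (CN R (spow k)) (tpow (CN R X) k) with
  | 0 => id_contraction (CN R X)
  | k'.+1 =>
    match k' return contraction_data (CN R (spow k')) (tpow (CN R X) k') ->
                    contraction_data (CN R (spow k'.+1)) (tpow (CN R X) k'.+1) with
    | 0 => fun _ => EZ R X X
    | k''.+1 => fun c =>
        comp_contraction (EZ R X (spow k''.+1))
          (tensor_contraction (id_contraction (CN R X)) c)
    end (EZpow k')
  end.

Fixpoint diag_simp k n (x : X n) : spow k n :=
  match k return spow k n with
  | 0 => x
  | k'.+1 => (x, diag_simp k' x)
  end.

(* ((y_1, ..., y_(k+1)), x) |-> (y_1, ..., y_(k+1), x) *)
Fixpoint rcons_simp k n : spow k n -> X n -> spow k.+1 n :=
  match k return spow k n -> X n -> spow k.+1 n with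
  | 0 => fun y x => (y, x)
  | k'.+1 => fun y x => (y.1, rcons_simp y.2 x)
  end.

Definition rot_simp k n : spow k n -> spow k n :=
  match k return spow k n -> spow k n with
  | 0 => id
  | k'.+1 => fun x => rcons_simp x.2 x.1
  end.

Definition Delta k : CN R X -> CN R (spow k) :=
  clift (fun x => cbas R (Simp (diag_simp k (projT2 x)))).

(* t and T, the cyclic rotation of simplices, and of tensors with its sign. *)
Definition rot_chain k : CN R (spow k) -> CN R (spow k) :=
  clift (fun x => cbas R (Simp (rot_simp (projT2 x)))).

Fixpoint tens_rcons (C : chain_complex R) k : tpow C k -> C -> tpow C k.+1 :=
  match k return tpow C k -> C -> tpow C k.+1 with
  | 0 => fun y x => tens y x
  | k'.+1 => fun w x =>
      tlift (fun (y : C) (w' : tpow C k') => tens y (tens_rcons w' x)) w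
  end.

(* On homogeneous x and w, x (x) w |-> (-1)^(|x||w|) w (x) x. *)
Definition rot_tens (C : chain_complex R) k : tpow C k -> tpow C k :=
  match k return tpow C k -> tpow C k with
  | 0 => id
  | k'.+1 => tlift (fun (x : C) (w : tpow C k') =>
      \sum_(m \in [set: nat]) \sum_(n \in [set: nat])
        (-1) ^+ (m * n) *: tens_rcons (hcomp n w) (hcomp m x))
  end.

Definition gamma k (i : nat) (c : CN R (spow k)) : CN R (spow k) :=
  if odd i then rot_chain c else \sum_(1 <= j < k.+1) iter j (@rot_chain k) c.

Definition alpha k (i : nat) (w : tpow (CN R X) k) : tpow (CN R X) k :=
  if odd i then rot_tens w - w else \sum_(0 <= j < k.+1) iter j (@rot_tens (CN R X) k) w.

(* gamma_i phi gamma_(i-1) phi ... gamma_1 phi Delta *)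
Fixpoint gamma_phi_Delta k (i : nat) (x : CN R X) : CN R (spow k) :=
  if i is i'.+1 then gamma i (ctr_phi (EZpow k) (gamma_phi_Delta k i' x))
  else Delta k x.

Definition Dmap k (i : nat) (x : CN R X) : tpow (CN R X) k :=
  ctr_f (EZpow k) (gamma_phi_Delta k i x).

(* D_(i-1), with D_(-1) = 0 *)
Definition Dmap_pred k (i : nat) (x : CN R X) : tpow (CN R X) k :=
  if i is i'.+1 then Dmap k i' x else 0.
End Powers.

(* Main.v *)
Require Import Defs.
From mathcomp Require Import all_boot all_algebra zify.
From mathcomp Require Import boolp.
From mathcomp Require classical_sets fsbigop.
Set Implicit Arguments.
Unset Strict Implicit.
Unset Printing Implicit Defensive.
Import GRing.Theory.
Local Open Scope ring_scope.

(** The theorem is formal once four facts are known: (f, g, phi) is a contraction;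
the rotation t is a chain map whose (k+1)-st power is the identity, for k+1 factors;
t g = g T; and t Delta = Delta.

Write E_i for gamma_i phi gamma_(i-1) phi ... gamma_1 phi Delta, so that D_i = f E_i.
From d phi = g f - 1 - phi d one gets by induction
  d E_i = gamma_i g f E_(i-1) + (-1)^i E_i d + B_i
with an error term B_i that has a closed form: B_1 = - Delta, and with the norm
N = 1 + t + ... + t^k, B_i is (t - 1) phi E_(i-2) for i even and - N phi E_(i-2) for
odd i > 1.  The induction uses phi g = 0, phi phi = 0, t N = N t = N and the fact that
gamma_i = N - 1 for i even.  After composition with f, the first term becomes
T D_(i-1) or (T + ... + T^k) D_(i-1), because f t^j g = f g T^j = T^j, and B_i becomes
- D_(i-1) or D_(i-1), because f phi = 0.  This is [cyc_D_diff].

That (AW, EML, SHI) is a contraction ([EZ_contraction]) is proved on vertices.  The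
simplices obtained from x by faces and degeneracies are the act s x, for s a weakly
increasing list of vertices of x, and faces and degeneracies of act s x delete and
repeat entries of s ([sface_act], [sdegen_act]); a simplex of a product is a list of
pairs of vertices.  In these terms AW cuts a list in two, EML is the signed sum over
the lattice paths in a rectangle, and with P = EML AW
  SHI (v_0 ... v_m) = sum_j (-1)^j v_0 ... v_j P(v_j ... v_m),
that is, SHI (v L) = v P(v L) - v SHI (L), where prefixing the vertex v is a cone
operator: d (v c) = c - v d c.  With the recursions for paths and for cuts,
each identity of a contraction is a short induction on lists.

Finally t g = g T ([rot_EZpow_g]) because EML is natural ([EML_natural]), associative
([EML_assoc]) and symmetric up to the Koszul sign ([EML_swap]): the rotation first
exchanges the first factor with all the others and then reassociates. *)

(** * Chains of vertex lists *)

Ltac cancel_sum := lazymatch goal with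
  | |- 0 = 0 => reflexivity
  | |- ?x + (- ?x + _) = 0 => rewrite (addNKr x)
  | |- - ?x + (?x + _) = 0 => rewrite (addKr x)
  | |- - ?x + ?r = 0 => rewrite (addrCA _ x)
  | |- ?x + ?r = 0 => rewrite (addrCA _ (- x))
  end.
(** Abelian group equalities, up to the order of the terms and cancellation of
opposite terms. *)
Ltac abelian := apply/subr0_eq;
  rewrite ?(scaler0, opprD, opprK, oppr0, add0r, addr0) -?addrA ?add0r;
  rewrite -[LHS]addr0 -?addrA; do ?cancel_sum.

(** Equalities between powers of -1, by comparing parities. *)
Ltac sign_parity := rewrite -?exprD -[LHS]signr_odd -[RHS]signr_odd;
  congr (_ ^+ nat_of_bool _); rewrite /= ?(oddD, oddM, oddS) /=;
  repeat match goal with |- context [odd ?n] => case: (odd n) => //= end.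

Section ListChains.
Variables (R : comNzRingType) (W : lmodType R).

Section Boundary.
Variable V : Type.
Implicit Types (e : seq V -> W) (L : seq V).

(** A formal combination c of lists of vertices is represented by its values
e |-> e(c) on all functions e from lists to a module, the linear extension of e being
understood.  Prefixing every list of c with v turns e into e \o cons v, so recursive
formulas for c become recursive definitions that need no module of formal sums.
A function is normalized when it vanishes on lists with two equal neighbours, which
stand for degenerate simplices. *)
Definition normalized e := forall s1 x s2, e (s1 ++ x :: x :: s2) = 0.

Lemma normal_cons e v : normalized e -> normalized (e \o cons v).
Proof. by move=> ne s1 x s2; apply: (ne (v :: s1)). Qed.

Lemma normal2 e v L : normalized e -> e (v :: v :: L) = 0.
Proof. by move=> ne; apply: (ne [::]). Qed.

(** e |-> e(d L); the recursion is d (v L) = L - v (d L).  The boundary of a one-vertex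
list is the empty list, as in the augmented complex.  Like the operators below, bd is
locked, so that rewriting rules for sums do not unfold it. *)
Fixpoint bd_rec L e : W :=
  if L is v :: L' then e L' - bd_rec L' (e \o cons v) else 0.
Definition bd L e : W := locked (bd_rec L e).

Lemma bd_nil e : bd [::] e = 0. Proof. by rewrite /bd -lock. Qed.
Lemma bd_cons v L e : bd (v :: L) e = e L - bd L (e \o cons v).
Proof. by rewrite /bd -!lock. Qed.

Lemma bdP L (a : R) e e' : bd L (fun K => a *: e K + e' K) = a *: bd L e + bd L e'.
Proof.
elim: L e e' => [|v L IH] e e'; first by rewrite !bd_nil scaler0 addr0.
rewrite !bd_cons.
have -> : (fun K => a *: e K + e' K) \o cons v =
  fun K => a *: (e \o cons v) K + (e' \o cons v) K by [].
by rewrite IH scalerBr opprD addrACA.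
Qed.

Lemma bd0 L : bd L (fun=> 0) = 0.
Proof. by elim: L => [|v L IH]; rewrite ?bd_nil // bd_cons sub0r IH oppr0. Qed.

Lemma bdD L e e' : bd L (fun K => e K + e' K) = bd L e + bd L e'.
Proof.
have := bdP L 1 e e'; rewrite scale1r => <-.
by congr bd; apply/funext=> K; rewrite scale1r.
Qed.

Lemma bdZ L a e : bd L (fun K => a *: e K) = a *: bd L e.
Proof.
have := bdP L a e (fun=> 0); rewrite bd0 addr0 => <-.
by congr bd; apply/funext=> K; rewrite addr0.
Qed.

Lemma bdN L e : bd L (fun K => - e K) = - bd L e.
Proof. by rewrite -scaleN1r -bdZ; congr bd; apply/funext=> K; rewrite scaleN1r. Qed.

Lemma bdB L e e' : bd L (fun K => e K - e' K) = bd L e - bd L e'.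
Proof. by rewrite (bdD L e (fun K => - e' K)) bdN. Qed.

Lemma eq_bd L e e' : (forall K, size K = (size L).-1 -> e K = e' K) -> bd L e = bd L e'.
Proof.
elim: L e e' => [|v [|w L] IH] e e' ee; first by rewrite !bd_nil.
  by rewrite !bd_cons !bd_nil (ee [::]).
rewrite [LHS]bd_cons [RHS]bd_cons ee //; congr (_ - _); apply: IH => K sK.
by apply: ee; rewrite /= sK.
Qed.
End Boundary.

Lemma bd_map (V V' : Type) (f : V -> V') L (e : seq V' -> W) :
  bd (map f L) e = bd L (e \o map f).
Proof. by elim: L e => [|v L IH] e; rewrite ?bd_nil // !bd_cons IH. Qed.

Section Shuffle.
Variables A B : Type.
Implicit Types (s : seq A) (t : seq B) (e : seq (A * B) -> W) (L : seq (A * B)).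

(** e |-> e(EML (s, t)): the signed sum over the lattice paths through the rectangle
s x t.  A path that leaves the corner (a, b) in the direction of t passes before all
the remaining steps along s, whence the sign.  A path exists only if both s and t are
nonempty; the first summand is the path that stops at its starting point. *)
Fixpoint shuffle_rec s : seq B -> (seq (A * B) -> W) -> W :=
  if s is a :: s' then
    fix shuffle_a t e := if t is b :: t' then
      (if nilp s' && nilp t' then e [:: (a, b)] else 0) +
      (shuffle_rec s' t (e \o cons (a, b)) +
       (-1) ^+ size s' *: shuffle_a t' (e \o cons (a, b)))
    else 0
  else fun _ _ => 0.
Definition shuffle s t e : W := locked (shuffle_rec s t e).

Lemma shuffle_cons a s b t e : shuffle (a :: s) (b :: t) e =
  (if nilp s && nilp t then e [:: (a, b)] else 0) +
  (shuffle s (b :: t) (e \o cons (a, b)) +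
   (-1) ^+ size s *: shuffle (a :: s) t (e \o cons (a, b))).
Proof. by rewrite /shuffle -!lock. Qed.

Lemma shuffle0s t e : shuffle [::] t e = 0. Proof. by rewrite /shuffle -lock. Qed.
Lemma shuffles0 s e : shuffle s [::] e = 0.
Proof. by rewrite /shuffle -lock; case: s. Qed.

Lemma bd_shuffle0s e t : bd t (fun t' => shuffle [::] t' e) = 0.
Proof. by rewrite -[RHS](bd0 t); congr bd; apply/funext=> t'; rewrite shuffle0s. Qed.
Lemma bd_shuffles0 e s : bd s (fun s' => shuffle s' [::] e) = 0.
Proof. by rewrite -[RHS](bd0 s); congr bd; apply/funext=> s'; rewrite shuffles0. Qed.

Lemma shuffle_ind (P : seq A -> seq B -> Prop) :
  (forall t, P [::] t) -> (forall s, P s [::]) ->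
  (forall a s b t, P s (b :: t) -> P (a :: s) t -> P (a :: s) (b :: t)) ->
  forall s t, P s t.
Proof. by move=> P0 P1 PS; elim=> // a s IH; elim=> // b t IHt; apply: PS. Qed.

Lemma shuffleP s t (a : R) e e' :
  shuffle s t (fun K => a *: e K + e' K) = a *: shuffle s t e + shuffle s t e'.
Proof.
move: s t e e'; apply: shuffle_ind => [t|s|x s y t IH1 IH2] e e'.
- by rewrite !shuffle0s scaler0 addr0.
- by rewrite !shuffles0 scaler0 addr0.
rewrite !shuffle_cons !scalerDr.
rewrite [X in _ + (X + _)](IH1 (e \o _) (e' \o _)) [X in _ + (_ + _ *: X)](IH2 (e \o _) (e' \o _)).
rewrite scalerDr !scalerA (mulrC _ a) [RHS]addrACA; congr (_ + _).
  by case: ifP; rewrite ?scaler0 ?addr0.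
by rewrite addrACA.
Qed.

Lemma shuffle_zero s t : shuffle s t (fun=> 0) = 0.
Proof.
move: s t; apply: shuffle_ind => [t|s|x s y t IH1 IH2]; rewrite ?shuffle0s ?shuffles0 //.
by rewrite shuffle_cons if_same add0r [X in X + _]IH1 [X in _ *: X]IH2 scaler0 addr0.
Qed.

Lemma shuffleD s t e e' :
  shuffle s t (fun K => e K + e' K) = shuffle s t e + shuffle s t e'.
Proof.
have := shuffleP s t 1 e e'; rewrite scale1r => <-.
by congr shuffle; apply/funext=> K; rewrite scale1r.
Qed.

Lemma shuffleZ s t a e : shuffle s t (fun K => a *: e K) = a *: shuffle s t e.
Proof.
have := shuffleP s t a e (fun=> 0); rewrite shuffle_zero addr0 => <-.
by congr shuffle; apply/funext=> K; rewrite addr0.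
Qed.

Lemma shuffleN s t e : shuffle s t (fun K => - e K) = - shuffle s t e.
Proof. by rewrite -scaleN1r -shuffleZ; congr shuffle; apply/funext=> K; rewrite scaleN1r. Qed.

Lemma shuffleB s t e e' :
  shuffle s t (fun K => e K - e' K) = shuffle s t e - shuffle s t e'.
Proof. by rewrite (shuffleD s t e (fun K => - e' K)) shuffleN. Qed.

(** EML is a chain map.  In a rectangle with a single path, of one point, the left-hand
side is the empty list and the right-hand side is 0, so this case is excluded; both
sides are 0 when s or t is empty, which lets the induction run without side conditions.
When the
point after the corner is deleted, a step along s followed by one along t and a step
along t followed by one along s leave the same list, with opposite signs. *)
Lemma shuffle_bd s t e : ~~ ((size s == 1%N) && (size t == 1%N)) ->
  shuffle s t (fun L => bd L e) =
  bd s (fun s' => shuffle s' t e) + (-1) ^+ (size s).-1 *: bd t (fun t' => shuffle s t' e).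
Proof.
move: s t e; apply: shuffle_ind => [t|s|a s b t IH1 IH2] e.
- by move=> _; rewrite shuffle0s bd_nil bd_shuffle0s scaler0 addr0.
- by move=> _; rewrite shuffles0 bd_nil scaler0 addr0 bd_shuffles0.
move=> st1; set c := (a, b); set e_c := e \o cons c.
have [/andP[/eqP s1 /eqP t0]|st2] := boolP ((size s == 1%N) && (size t == 0%N)).
  case: s s1 {IH1 IH2 st1} => [//|a' [_|//]]. move: t0; case: t => [_|//].
  rewrite !(bd_nil, bd_cons, shuffle_cons, shuffle0s, shuffles0) /= /e_c /c.
  rewrite !(bd_nil, bd_cons, shuffle_cons, shuffle0s, shuffles0) /=.
  by rewrite !(oppr0, scaler0, scale1r, addr0, add0r, subr0).
have [/andP[/eqP s0 /eqP t1]|st3] := boolP ((size s == 0%N) && (size t == 1%N)).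
  case: s s0 {IH1 IH2 st1 st2} => [_|//]; case: t t1 => [//|b' [_|//]].
  rewrite !(bd_nil, bd_cons, shuffle_cons, shuffle0s, shuffles0) /= /e_c /c.
  rewrite !(bd_nil, bd_cons, shuffle_cons, shuffle0s, shuffles0) /=.
  by rewrite !(scaler0, scale1r, addr0, add0r, subr0, oppr0).
have st0 : nilp s && nilp t = false by move: st1; rewrite /= /nilp !eqSS => /negbTE.
rewrite shuffle_cons st0 add0r -/c.
have -> : (fun L => bd L e) \o cons c = fun L => e L - bd L e_c.
  by apply/funext=> L; rewrite /= bd_cons.
rewrite !shuffleB IH1; last by rewrite /= eqSS.
rewrite IH2; last by rewrite /= eqSS.
rewrite [size (a :: s)]/= [_.-1]/=.
have -> : bd (a :: s) (fun s' => shuffle s' (b :: t) e) = shuffle s (b :: t) e -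
   (bd s (fun s' => shuffle s' (b :: t) e_c) +
    (-1) ^+ (size s).-1 *: bd s (fun s' => shuffle (a :: s') t e_c)).
  rewrite bd_cons; congr (_ - _); rewrite -bdZ -bdD.
  case: s {IH1 IH2} st0 st1 st2 st3 => // a' s ? ? st2 ?.
  apply: eq_bd => s' ss'; rewrite /= shuffle_cons ss' /nilp ss' ifN ?add0r //.
have -> : bd (b :: t) (fun t' => shuffle (a :: s) t' e) = shuffle (a :: s) t e -
   (bd t (fun t' => shuffle s (b :: t') e_c) +
    (-1) ^+ (size s) *: bd t (fun t' => shuffle (a :: s) t' e_c)).
  rewrite bd_cons; congr (_ - _); rewrite -bdZ -bdD.
  case: t {IH1 IH2} st0 st1 st2 st3 => // b' t ? ? ? st3.
  by apply: eq_bd => t' st'; rewrite /= shuffle_cons /nilp st' ifN ?add0r.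
rewrite [bd (b :: t) _]bd_cons [bd (a :: s) _]bd_cons.
rewrite -[(size s).+1.-1]/(size s).
rewrite !(scalerDr, scalerN, opprD, opprK).
have [->|[p ps]] : s = [::] \/ exists p, size s = p.+1 by case: (s); [left|right; eexists].
  have z0 : bd t (fun t' => shuffle [::] (b :: t') e_c) = 0.
    by rewrite -[RHS](bd0 t); congr bd; apply/funext=> t'; rewrite shuffle0s.
  rewrite !shuffle0s expr0 !scale1r !bd_nil /comp !z0.
  abelian.
rewrite ps exprS mulN1r !(scaleNr, scalerN, opprK) /comp /=; abelian.
Qed.

(** After x x the paths begin either with a repeated point, or with a step along t, to
which induction applies. *)
Lemma shuffle_stutterl s1 x s2 t e : normalized e -> shuffle (s1 ++ x :: x :: s2) t e = 0.
Proof.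
move=> ne; elim: s1 t e ne => [|a s1 IH]; elim=> [|b t IHt] e ne; rewrite ?shuffles0 //; last first.
  rewrite /= shuffle_cons IH; last exact: normal_cons.
  rewrite IHt; last exact: normal_cons.
  by case: (s1) => *; rewrite scaler0 !addr0.
rewrite /= shuffle_cons IHt; last exact: normal_cons.
rewrite scaler0 addr0 add0r /= shuffle_cons /= normal2 // if_same add0r.
have -> : (e \o cons (x, b)) \o cons (x, b) = fun=> 0.
  by apply/funext=> K /=; rewrite normal2.
by rewrite !shuffle_zero scaler0 addr0.
Qed.

End Shuffle.

Definition swap {A B : Type} (v : A * B) := (v.2, v.1).
Definition reassoc {A B C : Type} (v : A * B * C) := (v.1.1, (v.1.2, v.2)).

Lemma shuffle_swap A B (s : seq A) (t : seq B) (e : seq (A * B) -> W) :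
  shuffle s t e = (-1) ^+ ((size s).-1 * (size t).-1) *: shuffle t s (e \o map swap).
Proof.
move: s t e; apply: shuffle_ind => [t|s|a s b t IH1 IH2] e.
- by rewrite shuffle0s shuffles0 scaler0.
- by rewrite shuffle0s shuffles0 scaler0.
rewrite !shuffle_cons IH1 IH2 /=.
set e1 := (e \o cons (a, b)) \o map swap.
rewrite -[(e \o map swap) \o cons (b, a)]/e1 [nilp t && _]andbC !scalerDr !scalerA.
rewrite [X in _ = _ + X]addrC; congr (_ + (_ + _)).
- by case: s {IH1 IH2} => [|? ?]; case: t => [|? ?] //=; rewrite ?muln0 ?expr0 ?scale1r // ?scaler0.
- case: s {IH1 IH2} => [|a' s]; first by rewrite !shuffles0 !scaler0.
  by congr (_ *: _); sign_parity.
- case: t {IH1 IH2} => [|b' t]; first by rewrite !shuffle0s !scaler0.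
  by congr (_ *: _); sign_parity.
Qed.

Lemma shuffle_map A B A' B' (f : A -> A') (g : B -> B') s t (e : seq (A' * B') -> W) :
  shuffle (map f s) (map g t) e = shuffle s t (e \o map (fun v => (f v.1, g v.2))).
Proof.
move: s t e; apply: shuffle_ind => [t|s|a s b t IH1 IH2] e; rewrite ?shuffle0s ?shuffles0 //.
by rewrite /= !shuffle_cons -!/(map _ (_ :: _)) IH1 IH2 size_map /nilp !size_map.
Qed.

(** All paths through a rectangle have the same number of points. *)
Lemma eq_shuffle A B (s : seq A) (t : seq B) (e e' : seq (A * B) -> W) :
  (forall L, size L = (size s + size t).-1 -> L <> [::] -> e L = e' L) ->
  shuffle s t e = shuffle s t e'.
Proof.
move: s t e e'; apply: shuffle_ind => [t|s|a s b t IH1 IH2] e e' ee; rewrite ?shuffle0s ?shuffles0 //.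
rewrite !shuffle_cons; congr (_ + (_ + _ *: _)).
- by case: ifP => // /andP[/nilP s0 /nilP t0]; apply: ee; rewrite //= s0 t0.
- apply: IH1 => L sL _; apply: ee => //=; rewrite sL /= addnS //.
- by apply: IH2 => L sL _; apply: ee => //=; rewrite sL /= addnS.
Qed.

(** Both bracketings satisfy the recursion of signed paths through a box: the first step
is along s, t or u. *)
Section Assoc.
Variables A B C : Type.
Implicit Types (s : seq A) (t : seq B) (u : seq C) (e : seq (A * (B * C)) -> W).

Let left_assoc s t u e := shuffle s t (fun L => shuffle L u (e \o map reassoc)).
Let right_assoc s t u e := shuffle t u (fun L => shuffle s L e).

Let left_assoc_cons a s b t c u e (e' := e \o cons (a, (b, c))) :
  left_assoc (a :: s) (b :: t) (c :: u) e =
  (if [&& nilp s, nilp t & nilp u] then e [:: (a, (b, c))] else 0) +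
  (left_assoc s (b :: t) (c :: u) e' + ((-1) ^+ size s *: left_assoc (a :: s) t (c :: u) e' +
   (-1) ^+ (size s + size t) *: left_assoc (a :: s) (b :: t) u e')).
Proof.
rewrite /left_assoc shuffle_cons.
pose Y L := shuffle L (c :: u) (e' \o map reassoc).
pose Z L := shuffle ((a, b) :: L) u (e' \o map reassoc).
have XE L : L <> [::] -> size L = (size s + size t)%N ->
    shuffle ((a, b) :: L) (c :: u) (e \o map reassoc) = Y L + (-1) ^+ (size s + size t) *: Z L.
  by move=> L0 sL; rewrite shuffle_cons sL; case: L L0 {sL}=> //= *; rewrite add0r.
rewrite (@eq_shuffle _ _ s (b :: t) _ (fun L => Y L + (-1) ^+ (size s + size t) *: Z L)); last first.
  by move=> L sL L0; rewrite /= XE // sL /= addnS.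
rewrite (@eq_shuffle _ _ (a :: s) t _ (fun L => Y L + (-1) ^+ (size s + size t) *: Z L)); last first.
  by move=> L sL L0; rewrite /= XE // sL /= addnS.
rewrite !shuffleD !shuffleZ [X in _ = _ + (_ + (_ + _ *: X))]shuffle_cons.
have [/andP[/nilP-> /nilP->]|/negbTE st] := boolP (nilp s && nilp t); last first.
  rewrite andbA st !add0r !(scalerDr, scalerA) [(_ ^+ size s) * _]mulrC; abelian.
rewrite !shuffle0s !shuffles0 !expr0 !scale1r shuffle_cons shuffle0s expr0 scale1r /=; abelian.
Qed.

Let right_assoc_cons a s b t c u e (e' := e \o cons (a, (b, c))) :
  right_assoc (a :: s) (b :: t) (c :: u) e =
  (if [&& nilp s, nilp t & nilp u] then e [:: (a, (b, c))] else 0) +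
  (right_assoc s (b :: t) (c :: u) e' + ((-1) ^+ size s *: right_assoc (a :: s) t (c :: u) e' +
   (-1) ^+ (size s + size t) *: right_assoc (a :: s) (b :: t) u e')).
Proof.
rewrite /right_assoc shuffle_cons.
pose Y L := shuffle (a :: s) L e'.
pose Z L := shuffle s ((b, c) :: L) e'.
have XE L : L <> [::] -> shuffle (a :: s) ((b, c) :: L) e = Z L + (-1) ^+ size s *: Y L.
  by rewrite shuffle_cons; case: L => //= *; rewrite andbF add0r.
rewrite (@eq_shuffle _ _ t (c :: u) _ (fun L => Z L + (-1) ^+ size s *: Y L)); last first.
  by move=> L sL L0; rewrite /= XE.
rewrite (@eq_shuffle _ _ (b :: t) u _ (fun L => Z L + (-1) ^+ size s *: Y L)); last first.
  by move=> L sL L0; rewrite /= XE.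
rewrite !shuffleD !shuffleZ [X in _ = _ + (X + _)]shuffle_cons.
have [/andP[/nilP-> /nilP->]|/negbTE tu] := boolP (nilp t && nilp u); last first.
  rewrite ?andbF !add0r !(scalerDr, scalerA) exprD (mulrC (_ ^+ size t)); abelian.
rewrite !shuffle0s !shuffles0 !scaler0 shuffle_cons shuffles0 scaler0 /= !andbT; abelian.
Qed.

Lemma shuffle_assoc s t u e :
  shuffle s t (fun L => shuffle L u (e \o map reassoc)) =
  shuffle t u (fun L => shuffle s L e).
Proof.
rewrite -/(left_assoc s t u e) -/(right_assoc s t u e).
elim: s t u e => [|a s IHs] t u e.
  rewrite /left_assoc /right_assoc shuffle0s -[LHS](shuffle_zero t u).
  by congr shuffle; apply/funext => L; rewrite shuffle0s.
elim: t u e => [|b t IHt] u e; first by rewrite /left_assoc /right_assoc shuffles0 shuffle0s.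
elim: u e => [|c u IHu] e.
  rewrite /left_assoc /right_assoc shuffles0 -[RHS](shuffle_zero (a :: s) (b :: t)).
  by congr shuffle; apply/funext => L; rewrite shuffles0.
by rewrite left_assoc_cons right_assoc_cons IHs IHt IHu.
Qed.
End Assoc.

Section AlexanderWhitney.
Variables A B : Type.
Implicit Types (L : seq (A * B)) (E : seq A -> seq B -> W).

(** E |-> E(AW L), for a function E of two lists: the list of pairs L is cut at one of
its vertices, which belongs to both parts. *)
Fixpoint aw_rec L E : W :=
  if L is v :: L' then E [:: v.1] (unzip2 L) + aw_rec L' (fun s => E (v.1 :: s)) else 0.
Definition aw L E : W := locked (aw_rec L E).

Lemma aw_nil E : aw [::] E = 0. Proof. by rewrite /aw -lock. Qed.
Lemma aw_cons v L E :
  aw (v :: L) E = E [:: v.1] (v.2 :: unzip2 L) + aw L (fun s => E (v.1 :: s)).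
Proof. by rewrite /aw -!lock. Qed.

Lemma awP L (a : R) E E' :
  aw L (fun s t => a *: E s t + E' s t) = a *: aw L E + aw L E'.
Proof.
elim: L E E' => [|v L IH] E E'; first by rewrite !aw_nil scaler0 addr0.
by rewrite !aw_cons (IH (fun s => E (v.1 :: s))) scalerDr addrACA.
Qed.

Lemma aw_zero L : aw L (fun _ _ => 0) = 0.
Proof. by elim: L => [|v L IH]; rewrite ?aw_nil // aw_cons add0r. Qed.

Lemma awD L E E' : aw L (fun s t => E s t + E' s t) = aw L E + aw L E'.
Proof.
have := awP L 1 E E'; rewrite scale1r => <-.
by congr aw; apply/funext=> s; apply/funext=> t; rewrite scale1r.
Qed.

Lemma awN L E : aw L (fun s t => - E s t) = - aw L E.
Proof.
have := awP L (-1) E (fun _ _ => 0); rewrite aw_zero addr0 scaleN1r => <-.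
by congr aw; apply/funext=> s; apply/funext=> t; rewrite scaleN1r addr0.
Qed.

Lemma eq_aw L E E' : (forall s t, (0 < size s)%N -> (0 < size t)%N ->
  (size s + size t = (size L).+1)%N -> E s t = E' s t) -> aw L E = aw L E'.
Proof.
elim: L E E' => [|v L IH] E E' EE //; rewrite !aw_cons; congr (_ + _).
  by apply: EE; rewrite //= add1n size_map.
by apply: IH => s t s0 t0 st; apply: EE => //=; rewrite addSn st.
Qed.

(** Unlike for bd, the boundary of a vertex is 0 here: in a tensor product the complexes
are not augmented. *)
Definition bd1 (V : Type) (L : seq V) (e : seq V -> W) : W :=
  if (size L < 2)%N then 0 else bd L e.

Definition bd_tens s t E : W :=
  bd1 s (fun s' => E s' t) + (-1) ^+ (size s).-1 *: bd1 t (E s).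

Lemma aw_bd L E : (1 < size L)%N -> aw L (fun s t => bd_tens s t E) = bd L (fun L' => aw L' E).
Proof.
elim: L E => [|v L IH] E // L2; pose E' s := E (v.1 :: s).
have -> : bd (v :: L) (fun L' => aw L' E) =
    aw L E - (bd (unzip2 L) (fun t => E [:: v.1] (v.2 :: t)) + bd L (fun L' => aw L' E')).
  by rewrite bd_cons bd_map -bdD; congr (_ - bd _ _); apply/funext=> K; rewrite /= aw_cons.
rewrite aw_cons; have -> : bd_tens [:: v.1] (v.2 :: unzip2 L) E =
    E [:: v.1] (unzip2 L) - bd (unzip2 L) (fun t => E [:: v.1] (v.2 :: t)).
  rewrite /bd_tens /bd1 /= add0r expr0 scale1r size_map ltnS.
  by case: L L2 {IH} => // w L _; rewrite bd_cons.
have -> : aw L (fun s t => bd_tens (v.1 :: s) t E) =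
    aw L E - aw L (fun s t => bd_tens s t E') - E [:: v.1] (unzip2 L).
  case: L L2 {IH} => // w L _; rewrite !aw_cons.
  rewrite (@eq_aw L _ (fun s t => E (w.1 :: s) t - bd_tens (w.1 :: s) t E')); last first.
    move=> [|x s] t // _ _ _; rewrite /bd_tens /bd1 /= exprS mulN1r scaleNr.
    by rewrite [bd [:: v.1, w.1, x & s] _]bd_cons opprD addrA.
  rewrite awD awN /bd_tens /bd1 /= !(bd_cons, bd_nil) /= expr0 !scale1r expr1 scaleN1r; abelian.
case: L L2 IH => // w [|w' L] _ IH; last first.
  by rewrite IH //; abelian.
rewrite !aw_cons !(bd_cons, bd_nil) !aw_nil /bd_tens /bd1 /= expr0 scaler0; abelian.
Qed.

Lemma aw_normal s1 x s2 E : (forall t, normalized (E^~ t)) -> (forall s, normalized (E s)) ->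
  aw (s1 ++ x :: x :: s2) E = 0.
Proof.
move=> nl nr; elim: s1 E nl nr => [|v s1 IH] E nl nr; rewrite /= ?cat_cons !aw_cons.
  rewrite /= (normal2 _ _ (nr _)) add0r (nl _ [::]) add0r -[RHS](aw_zero s2).
  by congr aw; apply/funext=> s; apply/funext=> t; rewrite (nl _ [::]).
rewrite IH; [|by move=> t; apply: (normal_cons _ (nl t))|by move=> s; apply: nr].
by rewrite /unzip2 map_cat /= -cat_cons nr addr0.
Qed.

(** Deleting the first coordinates leaves repeated points as soon as the path contains a
step along s. *)
Lemma shuffle_snd (s : seq A) (t : seq B) (e : seq B -> W) : normalized e ->
  shuffle s t (e \o unzip2) = if size s == 1%N then if nilp t then 0 else e t else 0.
Proof.
move: s t e; apply: shuffle_ind => [t|s|a s b t IH1 IH2] e ne; rewrite ?shuffle0s ?shuffles0 ?if_same //.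
rewrite shuffle_cons; have -> : (e \o unzip2) \o cons (a, b) = (e \o cons b) \o @unzip2 A B by [].
rewrite IH1; last exact: normal_cons.
rewrite IH2; last exact: normal_cons.
case: s {IH1 IH2} => [|a' [|]] /=.
- by rewrite expr0 scale1r add0r; case: t => [|b' t]; rewrite ?addr0 ?add0r.
- by rewrite normal2 // scaler0 !addr0.
- by move=> *; rewrite scaler0 !addr0.
Qed.

(** AW EML = 1: the two halves of a path cut at a point have no repetition only if the
path goes along s up to the cut and along t after it; there is one such path, of sign 1. *)
Lemma shuffle_aw (s : seq A) (t : seq B) E :
  (forall t, normalized (E^~ t)) -> (forall s, normalized (E s)) ->
  shuffle s t (fun L => aw L E) = if nilp s || nilp t then 0 else E s t.
Proof.
move: s t E; apply: shuffle_ind => [t|s|a s b t IH1 IH2] E nl nr; rewrite ?shuffle0s ?shuffles0 ?orbT //.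
pose E' s := E (a :: s); rewrite shuffle_cons /=.
have -> : (fun L => aw L E) \o cons (a, b) =
  fun L => ((E [:: a] \o cons b) \o unzip2) L + aw L E'.
  by apply/funext=> L; rewrite /= aw_cons.
have nl' t' : normalized (E'^~ t') by apply: (normal_cons _ (nl t')).
have nr' s' : normalized (E' s') by apply: nr.
rewrite !shuffleD IH1 // IH2 //= !shuffle_snd /=; try exact/normal_cons/nr.
rewrite /E' (normal2 _ _ (nr _)) !if_same orbF add0r aw_cons /=.
case: s {IH1 IH2} => [|a' s] /=; last first.
  by rewrite !add0r (nl t [::] a (a' :: s)) if_same scaler0 addr0.
rewrite (nl t [::] a [::]) if_same addr0 aw_nil add0r expr0 scale1r addr0.
by case: t => [|b' t] /=; rewrite ?addr0 ?add0r.
Qed.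

Lemma normal_shuffle (e : seq (A * B) -> W) : normalized e ->
  (forall t, normalized ((fun s t => shuffle s t e)^~ t)) *
  (forall s, normalized (fun t => shuffle s t e)).
Proof.
move=> ne; split=> [t s1 x s2|s t1 y t2]; first exact: shuffle_stutterl.
rewrite shuffle_swap shuffle_stutterl ?scaler0 // => s1 x s2 /=.
by rewrite map_cat /= ne.
Qed.
End AlexanderWhitney.

Section Shih.
Variables A B : Type.
Implicit Types (L : seq (A * B)) (e : seq (A * B) -> W).

(** The idempotent EML AW. *)
Definition proj L e : W := aw L (fun s t => shuffle s t e).

(** e |-> e(SHI L), by SHI (v L) = v P(v L) - v SHI (L) with P = EML AW. *)
Fixpoint shi_rec L e : W :=
  if L is v :: L' then proj L (e \o cons v) - shi_rec L' (e \o cons v) else 0.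
Definition shi L e : W := locked (shi_rec L e).

Lemma shi_nil e : shi [::] e = 0. Proof. by rewrite /shi -lock. Qed.
Lemma shi_cons v L e : shi (v :: L) e = proj (v :: L) (e \o cons v) - shi L (e \o cons v).
Proof. by rewrite /shi -!lock. Qed.

Lemma projB L e e' : proj L (fun K => e K - e' K) = proj L e - proj L e'.
Proof.
rewrite /proj -awN -awD; congr aw.
by apply/funext=> s; apply/funext=> t; rewrite shuffleB.
Qed.

Lemma projD L e e' : proj L (fun K => e K + e' K) = proj L e + proj L e'.
Proof.
rewrite /proj -awD; congr aw.
by apply/funext=> s; apply/funext=> t; rewrite shuffleD.
Qed.

Lemma proj_zero L : proj L (fun=> 0) = 0.
Proof.
rewrite /proj -[RHS](aw_zero L); congr aw.
by apply/funext=> s; apply/funext=> t; rewrite shuffle_zero.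
Qed.

Lemma shi_zero L : shi L (fun=> 0) = 0.
Proof. by elim: L => [|v L IH]; rewrite ?shi_nil // shi_cons proj_zero IH subr0. Qed.

Lemma shiB L e e' : shi L (fun K => e K - e' K) = shi L e - shi L e'.
Proof.
elim: L e e' => [|v L IH] e e'; first by rewrite !shi_nil subrr.
rewrite !shi_cons (projB _ (e \o cons v)) (IH (e \o cons v)) !opprD; abelian.
Qed.

Lemma shiD L e e' : shi L (fun K => e K + e' K) = shi L e + shi L e'.
Proof.
elim: L e e' => [|v L IH] e e'; first by rewrite !shi_nil addr0.
rewrite !shi_cons (projD _ (e \o cons v)) (IH (e \o cons v)) !opprD; abelian.
Qed.

Lemma proj_bd L e : (1 < size L)%N -> proj L (fun K => bd K e) = bd L (fun L' => proj L' e).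
Proof.
move=> L2; rewrite /proj -aw_bd //; apply: eq_aw => s t s0 t0 st.
rewrite shuffle_bd; last first.
  apply/negP => /andP[/eqP s1 /eqP t1]; move: st L2; rewrite s1 t1.
  by case=> <-.
rewrite /bd_tens /bd1; congr (_ + _ *: _).
  case: s s0 {st} => [|a [|a' s]] // _.
  by rewrite bd_cons bd_nil subr0 shuffle0s.
case: t t0 {st} => [|a [|a' t]] // _.
by rewrite bd_cons bd_nil subr0 shuffles0.
Qed.

(** The homotopy identity follows from the recursion: in d (v c) = c - v d c applied to
c = P(v L) and c = SHI (L), with P = EML AW, the induction hypothesis and d P = P d
cancel everything but P(v L) - v L. *)
Theorem shi_bd v L e :
  shi (v :: L) (fun K => bd K e) + bd (v :: L) (fun K => shi K e) = proj (v :: L) e - e (v :: L).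
Proof.
elim: L v e => [|w L IH] v e; set e_v := e \o cons v.
  rewrite shi_cons bd_cons bd_nil !shi_nil !subr0 addr0 /proj !aw_cons !aw_nil !addr0.
  by rewrite !shuffle_cons /= !bd_cons !bd_nil !shuffle0s !shuffles0 !(scaler0, addr0, subr0, subrr).
have bdE : (fun K => bd K e) \o cons v = fun K => e K - bd K e_v.
  by apply/funext=> K; rewrite /= bd_cons.
have shiE : (fun K => shi K e) \o cons v = fun K => proj (v :: K) e_v - shi K e_v.
  by apply/funext=> K; rewrite /= shi_cons.
have IHE : shi (w :: L) (fun K => bd K e_v) =
    proj (w :: L) e_v - e_v (w :: L) - bd (w :: L) (fun K => shi K e_v).
  by rewrite -IH addrK.
rewrite [shi (v :: _) _]shi_cons [bd (v :: _) _]bd_cons bdE shiE shiB projB bdB proj_bd //.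
rewrite IHE [bd (v :: _) _]bd_cons /comp -[e (v :: _)]/(e_v (w :: L)); abelian.
Qed.

Lemma proj_normal s1 x s2 e : normalized e -> proj (s1 ++ x :: x :: s2) e = 0.
Proof. by move=> ne; apply: aw_normal; case: (normal_shuffle ne). Qed.

Lemma shi_normal s1 x s2 e : normalized e -> shi (s1 ++ x :: x :: s2) e = 0.
Proof.
elim: s1 e => [|v s1 IH] e ne /=; rewrite shi_cons.
  rewrite (proj_normal [::]) ?shi_cons; last exact: normal_cons.
  have -> : (e \o cons x) \o cons x = fun=> 0 by apply/funext=> K /=; apply: normal2.
  by rewrite proj_zero shi_zero !subr0.
rewrite -cat_cons (proj_normal (v :: s1)) ?IH ?subr0 //; exact: normal_cons.
Qed.

(** Every first part of a cut of v L starts with v.1, hence is degenerate once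
prefixed with v.1. *)
Lemma aw_pair_normal v L (E : seq A -> seq B -> W) :
  (forall t, normalized (E^~ t)) -> aw (v :: L) (fun s => E (v.1 :: s)) = 0.
Proof.
move=> nl; rewrite aw_cons (nl _ [::]) add0r -[RHS](aw_zero L); congr aw.
by apply/funext=> s; apply/funext=> t; rewrite (nl t [::]).
Qed.

(** All the paths in proj (v :: L) have second coordinates that either contain a
repetition, or are those of v :: L; the latter become degenerate once prefixed with v.2. *)
Lemma proj_snd v L (e : seq B -> W) : normalized e -> proj (v :: L) ((e \o cons v.2) \o unzip2) = 0.
Proof.
move=> ne; have nev := normal_cons v.2 ne; rewrite /proj aw_cons shuffle_snd //= normal2 // add0r.
rewrite -[RHS](aw_zero L); apply: eq_aw => s t s0 _ _.
by rewrite shuffle_snd //; case: s s0.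
Qed.

Lemma shi_snd L (e : seq B -> W) : normalized e -> shi L (e \o unzip2) = 0.
Proof.
elim: L e => [|v L IH] e ne; rewrite ?shi_nil // shi_cons.
have -> : (e \o unzip2) \o cons v = (e \o cons v.2) \o @unzip2 A B by [].
by rewrite proj_snd // IH ?subr0 //; exact: normal_cons.
Qed.

Section AW.
Variable E : seq A -> seq B -> W.
Hypotheses (nl : forall t, normalized (E^~ t)) (nr : forall s, normalized (E s)).

Lemma proj_aw L : proj L (fun K => aw K E) = aw L E.
Proof.
rewrite /proj; apply: eq_aw => s t s0 t0 _; rewrite shuffle_aw //.
by case: s s0 => // *; case: t t0.
Qed.
End AW.

Lemma aw_cons_fun v (E : seq A -> seq B -> W) : (fun K => aw K E) \o cons v =
  fun K => ((E [:: v.1] \o cons v.2) \o unzip2) K + aw K (fun s => E (v.1 :: s)).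
Proof. by apply/funext=> K; rewrite /= aw_cons. Qed.

(** AW SHI = 0.  The recursion of SHI prefixes v, so AW cuts either at this v, which
leaves second coordinates only, or later, where AW EML = 1 applies. *)
Lemma shi_aw L E : (forall t, normalized (E^~ t)) -> (forall s, normalized (E s)) ->
  shi L (fun K => aw K E) = 0.
Proof.
elim: L E => [|v L IH] E nl nr; first exact: shi_nil.
rewrite shi_cons aw_cons_fun shiD projD proj_snd // proj_aw //; last first.
  by move=> t; apply: (normal_cons _ (nl t)).
rewrite aw_pair_normal // IH //; last by move=> t; apply: (normal_cons _ (nl t)).
by rewrite shi_snd ?addr0 ?subr0 //; exact/normal_cons/nr.
Qed.

(** SHI EML = 0.  By induction only the terms v P(K) survive in the recursion of SHI, for
K a path from the corner v, where P = EML AW; together these are v P(EML (s, t)) =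
v EML (s, t), in which v is repeated. *)
Lemma shuffle_shi s t e : normalized e -> shuffle s t (fun L => shi L e) = 0.
Proof.
move: s t e; apply: shuffle_ind => [t|s|a s b t IH1 IH2] e ne; rewrite ?shuffle0s ?shuffles0 //.
set v := (a, b); pose e_v := e \o cons v; have nev : normalized e_v by apply: normal_cons.
have shiE : (fun K => shi K e) \o cons v = fun K => ((fun K => proj K e_v) \o cons v) K - shi K e_v.
  by apply/funext=> K; rewrite /= shi_cons.
have : shuffle (a :: s) (b :: t) (fun L => proj L e_v) = 0.
  case: (normal_shuffle nev) => nl nr; rewrite shuffle_aw //= shuffle_cons.
  have z : e_v \o cons v = fun=> 0 by apply/funext=> K; apply: normal2 ne.
  have z1 : e_v [:: (a, b)] = 0 by apply: (normal2 v [::] ne).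
  by rewrite z z1 !shuffle_zero scaler0 !addr0 if_same.
rewrite !shuffle_cons -/v shiE !shuffleB IH1 // IH2 // !subr0 shi_cons shi_nil subr0.
by [].
Qed.

(** SHI SHI = 0.  Expanding the inner SHI on a list that starts with the prefix v, and
using SHI EML = 0, only terms v P(v K) remain, for which the argument is as in AW SHI = 0. *)
Lemma shi_shi L e : normalized e -> shi L (fun K => shi K e) = 0.
Proof.
elim: L e => [|v L IH] e ne; first exact: shi_nil.
pose e_v := e \o cons v; have nev : normalized e_v by apply: normal_cons.
have [nl nr] := normal_shuffle nev.
have shiE : (fun K => shi K e) \o cons v = fun K => ((fun K => proj K e_v) \o cons v) K - shi K e_v.
  by apply/funext=> K; rewrite /= shi_cons.
have nl' t : normalized ((fun s => (fun s t => shuffle s t e_v) (v.1 :: s))^~ t).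
  by apply: (normal_cons _ (nl t)).
rewrite shi_cons shiE shiB projB IH // subr0.
rewrite [X in _ - X - _](_ : _ = 0); last first.
  rewrite /proj -[RHS](aw_zero (v :: L)); congr aw.
  by apply/funext=> s; apply/funext=> t; rewrite shuffle_shi.
rewrite /proj aw_cons_fun -/(proj _ _) projD shiD proj_snd // shi_snd; last exact/normal_cons/nr.
by rewrite proj_aw // [aw _ _](aw_pair_normal v L nl) shi_aw // !(addr0, subr0).
Qed.
End Shih.

End ListChains.

(** * The action of monotone maps on simplices *)
Section SimplexOps.
Variable X : sset.
Implicit Types x : simp X.
Local Open Scope nat_scope.

Lemma sdim_sface i x : sdim (sface i x) = (sdim x).-1.
Proof. by case: x => -[|n] y. Qed.
Lemma sdim_sdegen i x : sdim (sdegen i x) = (sdim x).+1.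
Proof. by case: x. Qed.

Lemma sface_sface i j x : i < j <= sdim x -> 2 <= sdim x ->
  sface i (sface j x) = sface j.-1 (sface i x).
Proof. by case: x => -[|[|n]] y //= ij _; rewrite face_face. Qed.
Lemma sdegen_sdegen i j x : i <= j <= sdim x ->
  sdegen i (sdegen j x) = sdegen j.+1 (sdegen i x).
Proof. by case: x => n y /= ij; rewrite degen_degen. Qed.
Lemma sface_sdegen_lt i j x : i < j <= sdim x ->
  sface i (sdegen j x) = sdegen j.-1 (sface i x).
Proof.
case: x => -[|n] y /= ij; first by lia.
by rewrite face_degen_lt.
Qed.
Lemma sface_sdegen_eq i x : i <= sdim x -> sface i (sdegen i x) = x.
Proof. by case: x => n y /= ij; rewrite face_degen_eq. Qed.
Lemma sface_sdegen_succ i x : i <= sdim x -> sface i.+1 (sdegen i x) = x.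
Proof. by case: x => n y /= ij; rewrite face_degen_succ. Qed.
Lemma sface_sdegen_gt i j x : j.+1 < i <= (sdim x).+1 ->
  sface i (sdegen j x) = sdegen j (sface i.-1 x).
Proof.
case: x => -[|n] y /= ij; first by lia.
by rewrite face_degen_gt.
Qed.

(** The first n vertices of x are replaced by those listed in r, in decreasing order, and
the other vertices are kept: this generality makes the recursion on the top vertex
n - 1 possible, since operations on smaller vertices do not change its position.  The
vertex is removed if r does not contain it, and repeated by a degeneracy for each
further occurrence. *)
Fixpoint act_rev n : seq nat -> simp X -> simp X :=
  if n is m.+1 then
    fix act_rev_m r x :=
      if r is c :: r' then
        if c == m then
          if ohead r' == Some m then sdegen (size r').-1 (act_rev_m r' x) else act_rev m r' x
        else act_rev m r (sface m x)
      else act_rev m [::] (sface m x)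
  else fun _ x => x.

Definition del {T} k (s : seq T) := take k s ++ drop k.+1 s.
Definition dup {T} k (s : seq T) := take k.+1 s ++ drop k s.

Definition valid n r x := [&& n <= (sdim x).+1, sorted geq r, all (ltn^~ n) r &
  0 < size r + ((sdim x).+1 - n)].

Lemma act_rev_lt m r x : all (ltn^~ m) r -> act_rev m.+1 r x = act_rev m r (sface m x).
Proof. by case: r => //= c r /andP[cm _]; rewrite ltn_eqF. Qed.

Lemma act_rev_dup m r x : act_rev m.+1 [:: m, m & r] x = sdegen (size r) (act_rev m.+1 (m :: r) x).
Proof. by rewrite /= !eqxx. Qed.

Lemma act_rev_eq m r x : all (ltn^~ m) r -> act_rev m.+1 (m :: r) x = act_rev m r x.
Proof.
by case: r => [|c r] /=; rewrite eqxx // => /andP[cm _]; rewrite ifN // eqE /= ltn_eqF.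
Qed.

(** The three branches of act_rev: the vertex m is absent, occurs several times, or once. *)
Variant act_rev_spec m : seq nat -> Prop :=
| ActRevLt r of all (ltn^~ m) r : act_rev_spec m r
| ActRevDup r : act_rev_spec m [:: m, m & r]
| ActRevEq r of all (ltn^~ m) r : act_rev_spec m (m :: r).

Lemma act_revP m r : sorted geq r -> all (ltn^~ m.+1) r -> act_rev_spec m r.
Proof.
have tr : transitive geq by move=> a b c /= ba ca; apply: leq_trans ba.
have lt c s : path geq c s -> c < m -> all (ltn^~ m) s.
  move=> /(order_path_min tr) /allP le cm; apply/allP => i /le /= ic; exact: leq_ltn_trans ic cm.
case: r => [|c r] //=; first by move=> *; apply: ActRevLt.
move=> pr /andP[cm _]; move: cm; rewrite ltnS leq_eqVlt => /orP[/eqP cm|cm]; last first.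
  by apply: ActRevLt; rewrite /= cm (lt c).
subst c; case: r pr => [|c r] /= pr; first exact: ActRevEq.
case/andP: pr => cm pr; move: cm; rewrite leq_eqVlt => /orP[/eqP->|cm]; first by constructor.
by apply: ActRevEq; rewrite /= cm (lt c).
Qed.

Lemma validS m r x : valid m.+1 r x -> all (ltn^~ m) r -> valid m r (sface m x).
Proof.
rewrite /valid sdim_sface => /and4P[h1 h2 h3 h4] h5; rewrite h2 h5 /=.
by case: r h2 h3 h4 h5 => [|c r] /= *; lia.
Qed.

Lemma valid_behead m r x : valid m.+1 [:: m, m & r] x -> valid m.+1 (m :: r) x.
Proof.
by rewrite /valid /= => /and4P[-> /andP[_ ->] /and3P[_ -> ->] _]; rewrite addSn.
Qed.

Lemma valid_eq m r x : valid m.+1 (m :: r) x -> all (ltn^~ m) r -> valid m r x.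
Proof.
rewrite /valid /= => /and4P[h1 h2 _ _] ->; rewrite (path_sorted h2) /=; lia.
Qed.

Lemma sdim_act_rev n r x : valid n r x ->
  sdim (act_rev n r x) = (size r + ((sdim x).+1 - n)).-1.
Proof.
elim: n r x => [|m IHm] r x; first by case: r => [|c r] /and4P[] //= *; rewrite subn0.
elim: r x {-2}r (erefl (size r)) => [|c r0 IHr] x r sr v; have /and4P[h1 h2 h3 h4] := v.
  case: r sr v h2 h3 h4 => //= _ v _ _ h4; rewrite IHm ?sdim_sface; last exact: (validS v).
  rewrite /=; lia.
case: (act_revP h2 h3) sr v h4 => {h2 h3} [r' lt|r'|r' lt] sr v h4.
- rewrite act_rev_lt // IHm ?sdim_sface; last exact: (validS v).
  case: r' sr lt {v} h4 => //= c' r' _ /andP[cm _] *; lia.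
- rewrite act_rev_dup sdim_sdegen IHr; last exact: (valid_behead v).
    by rewrite /= addSn.
  by case: sr.
- rewrite act_rev_eq // IHm; last exact: (valid_eq v).
  rewrite /=; lia.
Qed.

(** Faces at the vertices that act_rev keeps commute with it. *)
Lemma sface_act_rev_above n r x t : valid n r x -> n + t <= sdim x ->
  1 < size r + ((sdim x).+1 - n) ->
  sface (size r + t) (act_rev n r x) = act_rev n r (sface (n + t) x).
Proof.
elim: n r x t => [|m IHm] r x t; first by case: r => [|c r] /and4P[].
elim: r x t {-2}r (erefl (size r)) => [|c r0 IHr] x t r sr v nt s1; have /and4P[h1 h2 h3 h4] := v.
  case: r sr v h2 h3 h4 s1 => //= _ v _ _ h4 s1; rewrite add0n.
  have -> : sface t (act_rev m [::] (sface m x)) = act_rev m [::] (sface (m + t) (sface m x)).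
    rewrite -IHm ?sdim_sface //=; [exact: (validS v)|lia|lia].
  rewrite [in RHS]sface_sface; [by rewrite addSn|lia|lia].
case: (act_revP h2 h3) sr v h4 s1 => {h2 h3} [r' lt|r'|r' lt] sr v h4 s1.
- have m0 : 0 < m by case: r' sr lt {v s1 h4} => //= ? ? _ /andP[]; lia.
  rewrite !act_rev_lt // IHm ?sdim_sface; [|exact: (validS v)|lia|lia].
  by rewrite [in RHS]sface_sface; [rewrite addSn|lia|lia].
- have vb := valid_behead v; have sd := sdim_act_rev vb.
  rewrite !act_rev_dup sface_sdegen_gt; last by rewrite sd /=; move: s1; rewrite /=; lia.
  by rewrite -(IHr x t (m :: r')) //; [case: sr|move: s1; rewrite /=; lia].
- rewrite !act_rev_eq // addSnnS -[in RHS]addSnnS addSnnS.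
  by rewrite -IHm ?addnS ?addSn //=; [exact: (valid_eq v)|move: s1; rewrite /=; lia].
Qed.

Lemma all_del k m r : all (ltn^~ m) r -> all (ltn^~ m) (del k r).
Proof.
move=> h; rewrite /del all_cat; rewrite -[r in all _ r](cat_take_drop k) all_cat in h.
case/andP: h => -> /=; rewrite -add1n -drop_drop; case: (drop k r) => //= a s /andP[_].
by rewrite drop0.
Qed.
Lemma all_dup k m r : all (ltn^~ m) r -> all (ltn^~ m) (dup k r).
Proof.
move=> /allP h; have tk j : all (ltn^~ m) (take j r) by apply/allP=> i /mem_take /h.
by rewrite /dup all_cat tk; apply/allP=> i /mem_drop /h.
Qed.

Lemma size_del T k (r : seq T) : k < size r -> size (del k r) = (size r).-1.
Proof. by move=> kr; rewrite size_cat size_take size_drop kr; lia. Qed.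
Lemma size_dup T k (r : seq T) : k < size r -> size (dup k r) = (size r).+1.
Proof. move=> kr; rewrite size_cat size_take size_drop; case: ltnP; lia. Qed.

Lemma sface_act_rev n r x k : valid n r x -> k < size r ->
  1 < size r + ((sdim x).+1 - n) ->
  sface (size r - k.+1) (act_rev n r x) = act_rev n (del k r) x.
Proof.
elim: n r x k => [|m IHm] r x k; first by case: r => [|c r] /and4P[].
elim: r x k {-2}r (erefl (size r)) => [|c r0 IHr] x k r sr v kr s1; have /and4P[h1 h2 h3 h4] := v.
  by case: r sr kr {v h2 h3 h4 s1}.
case: (act_revP h2 h3) sr v h4 s1 kr => {h2 h3} [r' lt|r'|r' lt] sr v h4 s1 kr.
- have m0 : 0 < m by case: r' sr lt {v s1 h4 kr} => //= ? ? _ /andP[]; lia.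
  rewrite !act_rev_lt //; last exact: all_del.
  apply: IHm; rewrite ?sdim_sface //; [exact: (validS v)|lia].
- have vb := valid_behead v; have sd := sdim_act_rev vb.
  rewrite act_rev_dup; case: k kr => [|[|k]] kr.
  + by rewrite /= subn1 sface_sdegen_succ // sd /=; lia.
  + by rewrite /= subn2 sface_sdegen_eq /del /= ?drop0 // sd /=; lia.
  rewrite sface_sdegen_lt; last by rewrite sd; move: kr; rewrite /=; lia.
  have -> : del k.+2 [:: m, m & r'] = [:: m, m & del k r'] by [].
  rewrite act_rev_dup size_del //; congr (sdegen _ _).
  have -> : m :: del k r' = del k.+1 (m :: r') by [].
  rewrite -IHr //; [by case: sr|by move: s1 kr; rewrite /=; lia].
- have ve := valid_eq v lt; case: k kr => [|k] kr.
    have -> : del 0 (m :: r') = r' by rewrite /del /= drop0.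
    rewrite act_rev_eq // act_rev_lt // subn1 -[_.-1]/(size r') -(addn0 (size r')).
    by rewrite sface_act_rev_above ?addn0 //; move: s1; rewrite /=; lia.
  have -> : del k.+1 (m :: r') = m :: del k r' by [].
  rewrite !act_rev_eq //; last exact: all_del.
  by rewrite -IHm // ; move: s1; rewrite /=; lia.
Qed.

Lemma sdegen_act_rev n r x k : valid n r x -> k < size r ->
  sdegen (size r - k.+1) (act_rev n r x) = act_rev n (dup k r) x.
Proof.
elim: n r x k => [|m IHm] r x k; first by case: r => [|c r] /and4P[].
elim: r x k {-2}r (erefl (size r)) => [|c r0 IHr] x k r sr v kr; have /and4P[h1 h2 h3 h4] := v.
  by case: r sr kr {v h2 h3 h4}.
case: (act_revP h2 h3) sr v h4 kr => {h2 h3} [r' lt|r'|r' lt] sr v h4 kr.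
- have m0 : 0 < m by case: r' sr lt {v h4 kr} => //= ? ? _ /andP[]; lia.
  rewrite !act_rev_lt //; last exact: all_dup.
  by apply: IHm; rewrite ?sdim_sface //; exact: (validS v).
- have vb := valid_behead v; have sd := sdim_act_rev vb.
  case: k kr => [|k] kr.
    have -> : dup 0 [:: m, m & r'] = [:: m, m, m & r'] by [].
    by rewrite !act_rev_dup subn1.
  have -> : dup k.+1 [:: m, m & r'] = [:: m, m & behead (dup k (m :: r'))] by [].
  rewrite !act_rev_dup sdegen_sdegen; last by rewrite sd; move: kr; rewrite /=; lia.
  have -> : m :: behead (dup k (m :: r')) = dup k (m :: r') by [].
  rewrite size_behead size_dup //; congr (sdegen _ _).
  by rewrite -IHr //; case: sr.
- have ve := valid_eq v lt; case: k kr => [|k] kr.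
    have -> : dup 0 (m :: r') = [:: m, m & r'] by rewrite /dup /= take0.
    by rewrite act_rev_dup subn1.
  have -> : dup k.+1 (m :: r') = m :: dup k r' by [].
  rewrite !act_rev_eq //; last exact: all_dup.
  by rewrite -IHm.
Qed.

Lemma act_rev_id n x : act_rev n (rev (iota 0 n)) x = x.
Proof.
elim: n => [//|n IH]; rewrite -[in iota _ _]addn1 iotaD rev_cat [rev (iota _ 1)]/= act_rev_eq //.
by apply/allP => i; rewrite mem_rev mem_iota.
Qed.

(** The empty list is excluded: it is not the vertex list of a simplex. *)
Definition mono lo hi (s : seq nat) :=
  [&& s != [::], sorted leq s & all (fun i => lo <= i <= hi) s].

(** The simplex with vertices s of x, i.e. the image of x under the monotone map s. *)
Definition act s x := locked (act_rev (sdim x).+1 (rev s) x).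
Lemma actE s x : act s x = act_rev (sdim x).+1 (rev s) x.
Proof. by rewrite /act -lock. Qed.

Lemma valid_mono s x : mono 0 (sdim x) s -> valid (sdim x).+1 (rev s) x.
Proof.
case/and3P=> s0 srt al; rewrite /valid leqnn rev_sorted srt all_rev size_rev subnn addn0 /=.
by rewrite lt0n size_eq0 s0 andbT; apply: sub_all al => i; rewrite ltnS.
Qed.

Lemma rev_del k (s : seq nat) : k < size s -> rev (del k s) = del (size s - k.+1) (rev s).
Proof.
move=> ks; rewrite /del rev_cat take_rev drop_rev; congr (rev (drop _ _) ++ rev (take _ _)); lia.
Qed.
Lemma rev_dup k (s : seq nat) : k < size s -> rev (dup k s) = dup (size s - k.+1) (rev s).
Proof.
move=> ks; rewrite /dup rev_cat take_rev drop_rev; congr (rev (drop _ _) ++ rev (take _ _)); lia.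
Qed.

Lemma sdim_act s x : mono 0 (sdim x) s -> sdim (act s x) = (size s).-1.
Proof. by move=> /valid_mono v; rewrite actE sdim_act_rev // subnn addn0 size_rev. Qed.

Lemma sface_act s x k : mono 0 (sdim x) s -> k < size s -> 1 < size s ->
  sface k (act s x) = act (del k s) x.
Proof.
move=> /valid_mono v ks s1; rewrite !actE rev_del // -sface_act_rev ?size_rev //; last first.
- by rewrite subnn addn0.
- lia.
by congr sface; lia.
Qed.

Lemma sdegen_act s x k : mono 0 (sdim x) s -> k < size s ->
  sdegen k (act s x) = act (dup k s) x.
Proof.
move=> /valid_mono v ks; rewrite !actE rev_dup // -sdegen_act_rev ?size_rev //; last lia.
by congr sdegen; lia.
Qed.

Lemma act_iota x : act (iota 0 (sdim x).+1) x = x.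
Proof. by rewrite actE act_rev_id. Qed.

Lemma mono_cons lo hi a s : mono lo hi (a :: s) = (lo <= a <= hi) && ((s == [::]) || mono a hi s).
Proof.
case: s => [|b s]; first by rewrite /mono /= andbT.
have tr : transitive leq by exact: leq_trans.
rewrite /mono /= !(path_sortedE tr) /=; apply/idP/idP.
  case/and4P=> /and3P[ab bs ss] lah /andP[lb bh] /allP al.
  rewrite lah bs ss ab bh /=; apply/allP => i si.
  by have := allP bs _ si; have := al i si; lia.
case/and4P=> lah /andP[bs ss] /andP[ab bh] /allP al.
rewrite ab bs ss lah bh /= ; apply/andP; split; first by lia.
by apply/allP => i /al; lia.
Qed.

Lemma mono_iota lo hi i n : mono lo hi (iota i n.+1) = (lo <= i) && (i + n <= hi).
Proof.
elim: n i lo => [|n IH] i lo; first by rewrite mono_cons orTb andbT addn0.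
rewrite [iota _ _]/= mono_cons -[i.+1 :: _]/(iota i.+1 n.+1) IH /= ; lia.
Qed.

Lemma mono_sub lo hi s t : mono lo hi s -> subseq t s -> t != [::] -> mono lo hi t.
Proof.
move=> /and3P[_ ss /allP al] st t0; rewrite /mono t0 (subseq_sorted leq_trans st ss) /=.
by apply/allP => i /(mem_subseq st)/al.
Qed.

Lemma subseq_del (T : eqType) k (s : seq T) : subseq (del k s) s.
Proof.
rewrite -[X in subseq _ X](cat_take_drop k); apply: cat_subseq; first exact: subseq_refl.
by rewrite -add1n -drop_drop; apply: drop_subseq.
Qed.

Lemma mono_del lo hi s k : mono lo hi s -> 1 < size s -> k < size s -> mono lo hi (del k s).
Proof.
move=> ms s1 ks; apply: mono_sub ms (subseq_del _ _) _.
by rewrite -size_eq0 size_del // -lt0n -ltnS prednK // ltnW.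
Qed.

Lemma mono_dup lo hi s k : k < size s -> mono lo hi (dup k s) = mono lo hi s.
Proof.
elim: s lo k => // a s IH lo [|k] ks.
  by rewrite /dup /= take0 /= !mono_cons leqnn /=; case: (lo <= a) => //=; case: (a <= hi).
rewrite -[dup _ _]/(a :: dup k s) !mono_cons IH //.
by congr (_ && (_ || _)); rewrite -!size_eq0 size_dup //; case: s ks {IH}.
Qed.

Lemma mono_map lo hi s t n : mono lo hi s -> mono 0 n t -> n < size s ->
  mono lo hi (map (nth 0 s) t).
Proof.
move=> /and3P[s0 ss /allP al] /and3P[t0 st /allP alt] ns.
rewrite /mono -size_eq0 size_map size_eq0 t0 /=.
apply/andP; split; last first.
  apply/allP => _ /mapP[i it ->]; apply/al/mem_nth; have /= := alt _ it; lia.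
have tn i : i \in t -> i < size s by move=> /alt /=; lia.
elim: t st tn {alt t0} => //= a t IH st tn.
move: st; rewrite !(path_sortedE leq_trans) => /andP[/allP at1 st].
rewrite IH // ?andbT; last by move=> i it; apply: tn; rewrite inE it orbT.
apply/allP => _ /mapP[i it ->]; apply: sorted_leq_nth => //=; last exact: at1.
- exact: leq_trans.
- by apply: tn; rewrite inE eqxx.
- by apply: tn; rewrite inE it orbT.
Qed.

Lemma map_nth_drop n (s : seq nat) : map (nth 0 s) (iota n (size s - n)) = drop n s.
Proof. by rewrite map_nth_iota // take_oversize // size_drop. Qed.

Lemma valid_mono_cat n r x : valid n r x ->
  mono 0 (sdim x) (rev r ++ iota n ((sdim x).+1 - n)).
Proof.
case/and4P=> h1 h2 /allP h3 h4; rewrite /mono -size_eq0 size_cat size_rev size_iota -lt0n h4 /=.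
rewrite !(sorted_pairwise leq_trans) pairwise_cat -!(sorted_pairwise leq_trans) rev_sorted h2.
rewrite iota_sorted all_cat !andbT; apply/and3P; split.
- apply/allrelP => i j; rewrite mem_rev mem_iota => /h3 /=; lia.
- apply/allP => i; rewrite mem_rev => /h3 /=; lia.
- apply/allP => i; rewrite mem_iota; lia.
Qed.

(** act_rev is a word in faces and degeneracies, and each of these is known to delete or
repeat an entry of the list s of act s x. *)
Lemma act_rev_act n r s x : mono 0 (sdim x) s -> valid n r (act s x) ->
  act_rev n r (act s x) = act (map (nth 0 s) (rev r) ++ drop n s) x.
Proof.
move=> ms; elim: n r s ms => [|m IHm] r s ms.
  by case: r => [|c r] /and4P[] //; rewrite drop0.
elim: r {-2}r (erefl (size r)) => [|c r0 IHr] r sr v.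
  case: r sr v => // _ v; have /and4P[h1 _ _ h4] := v; rewrite sdim_act // in h1 h4.
  have ss : 1 < size s by move: h4; rewrite /=; lia.
  rewrite act_rev_lt // sface_act //; last lia.
  rewrite IHm; [|by apply: mono_del => //; lia|]; last first.
    by rewrite -sface_act //; [exact: (validS v)|lia].
  rewrite /= /del drop_size_cat // size_take; case: ltnP; lia.
have /and4P[h1 h2 h3 h4] := v; rewrite sdim_act // in h1 h4.
have s0 : 0 < size s by rewrite lt0n size_eq0; case/and3P: ms.
case: (act_revP h2 h3) sr v h4 => {h2 h3} [r' lt|r'|r' lt] sr v h4.
- have m0 : 0 < m by case: r' sr lt {v h4} => //= ? ? _ /andP[]; lia.
  have ss : 1 < size s by lia.
  rewrite act_rev_lt // sface_act //; last lia.
  rewrite IHm; [|by apply: mono_del => //; lia|]; last first.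
    by rewrite -sface_act //; [exact: (validS v)|lia].
  congr act; rewrite /del drop_size_cat; last by rewrite size_take; case: ltnP; lia.
  congr (_ ++ _); apply/eq_in_map => i; rewrite mem_rev => /(allP lt) /= im.
  rewrite nth_cat size_take nth_take //; case: (ltnP m (size s)) => [|?]; first by rewrite im.
  by exfalso; lia.
- have vb := valid_behead v.
  rewrite act_rev_dup IHr //; last by case: sr.
  have ml : mono 0 (sdim x) (map (nth 0 s) (rev (m :: r')) ++ drop m.+1 s).
    rewrite -map_nth_drop -map_cat; apply: (mono_map ms (n := (size s).-1)); last lia.
    by have := valid_mono_cat vb; rewrite sdim_act // prednK.
  rewrite sdegen_act //; last by rewrite size_cat size_map size_rev /=; lia.
  congr act; rewrite !rev_cons -!cats1 !map_cat -!catA /= /dup.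
  have sz : size (map (nth 0 s) (rev r')) = size r' by rewrite size_map size_rev.
  rewrite -{2}sz drop_size_cat // take_cat sz ltnNge leqnSn /= subSnn take_cons take0.
  by rewrite -catA.
- rewrite act_rev_eq // IHm //; last exact: (valid_eq v).
  rewrite rev_cons -cats1 map_cat -catA (drop_nth 0) //; lia.
Qed.

Lemma act_act s t x : mono 0 (sdim x) s -> mono 0 (size s).-1 t ->
  act t (act s x) = act (map (nth 0 s) t) x.
Proof.
move=> ms mt; rewrite {1}actE act_rev_act //; last by apply: valid_mono; rewrite sdim_act.
rewrite revK sdim_act // drop_oversize ?cats0 //; lia.
Qed.
End SimplexOps.

(** * Shuffles as lattice paths *)
Fixpoint masks n : seq (seq bool) :=
  if n is n'.+1 then map (cons true) (masks n') ++ map (cons false) (masks n') else [:: [::]].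

(** The number of pairs (i, j) with i < j, where step i is along the second list (false)
and step j along the first one (true). *)
Fixpoint inversions (mu : seq bool) : nat :=
  if mu is b :: mu' then ((if b then 0 else count id mu') + inversions mu')%N else 0.

Fixpoint lattice_path A B (s : seq A) (t : seq B) (mu : seq bool) : seq (A * B) :=
  match s, t with
  | a :: s', b :: t' =>
    match mu with
    | [::] => [:: (a, b)]
    | true :: mu' => (a, b) :: lattice_path s' t mu'
    | false :: mu' => (a, b) :: lattice_path s t' mu'
    end
  | _, _ => [::]
  end.

Lemma mem_masks n mu : (mu \in masks n) = (size mu == n).
Proof.
elim: n mu => [|n IH] [|b mu] //=; rewrite mem_cat.
  by apply/negbTE; rewrite negb_or; apply/andP; split; apply/mapP => -[].
rewrite eqSS -IH; have ic c : injective (cons c : seq bool -> seq bool) by move=> ? ? [].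
case: b; rewrite mem_map // ?orbT ?orbF; last first.
  by rewrite orbC; case: (mu \in _) => //=; apply/negbTE/mapP => -[].
by case: (mu \in _) => //=; apply/negbTE/mapP => -[].
Qed.

Lemma masks_uniq n : uniq (masks n).
Proof.
have ic c : injective (cons c : seq bool -> seq bool) by move=> ? ? [].
elim: n => //= n IH; rewrite cat_uniq !map_inj_uniq // IH /= andbT.
by apply/hasPn => mu /mapP[nu _ ->]; apply/mapP => -[].
Qed.

Section Masks.
Variables (R : comNzRingType) (W : lmodType R).

Lemma shuffle_masks A B a (s : seq A) b (t : seq B) (e : seq (A * B) -> W) :
  shuffle (a :: s) (b :: t) e =
  \sum_(mu <- masks (size s + size t) | count id mu == size s)
    (-1) ^+ inversions mu *: e (lattice_path (a :: s) (b :: t) mu).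
Proof.
move eN : (size s + size t)%N => N.
elim: N a s b t e eN => [|N IH] a s b t e eN; rewrite shuffle_cons.
  case: s eN => // eN; case: t eN => // _.
  rewrite shuffle0s shuffles0 scaler0 !addr0 /= big_cons big_nil /= addr0.
  by rewrite expr0 scale1r.
rewrite ifN ?add0r; last by apply/negP => /andP[/nilP s0 /nilP t0]; rewrite s0 t0 in eN.
rewrite big_cat !big_map /=; congr (_ + _).
  case: s eN => [|a' s] eN; first by rewrite shuffle0s big_pred0.
  by rewrite IH //; case: eN.
case: t eN => [|b' t] eN.
  rewrite shuffles0 scaler0 big1_seq // => mu /andP[/eqP cmu].
  rewrite mem_masks => /eqP smu; have := count_size id mu; rewrite add0n in cmu.
  by rewrite cmu smu -ltnS -eN addn0 ltnn.
rewrite IH; last by move: eN; rewrite /= addnS => -[].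
rewrite scaler_sumr; apply: eq_bigr => mu /eqP <-.
by rewrite scalerA -exprD.
Qed.

Definition mask_of n (A : {set 'I_n}) : seq bool := [seq i \in A | i <- enum 'I_n].

Lemma card_mask n (A : {set 'I_n}) : #|A| = count id (mask_of A).
Proof. by rewrite cardE /mask_of count_map enumT /enum_mem size_filter. Qed.

Lemma size_mask_of n (A : {set 'I_n}) : size (mask_of A) = n.
Proof. by rewrite size_map size_enum_ord. Qed.

Lemma nth_mask_of n (A : {set 'I_n}) (i : 'I_n) : nth false (mask_of A) i = (i \in A).
Proof. by rewrite (nth_map i) ?size_enum_ord // nth_ord_enum. Qed.

Lemma sum_sets n p (F : seq bool -> W) :
  \sum_(A : {set 'I_n} | #|A| == p) F (mask_of A) =
  \sum_(mu <- masks n | count id mu == p) F mu.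
Proof.
have inj : injective (@mask_of n).
  by move=> A B AB; apply/setP => i; rewrite -!nth_mask_of AB.
have pe : perm_eq [seq mask_of A | A : {set 'I_n}] (masks n).
  apply: uniq_perm; rewrite ?masks_uniq ?map_inj_uniq -?enumT ?enum_uniq // => mu.
  rewrite mem_masks; apply/idP/eqP => [/mapP[A _ ->]|smu]; first exact: size_mask_of.
  apply/mapP; exists [set i : 'I_n | nth false mu i]; first by rewrite mem_enum.
  apply: (@eq_from_nth _ false); rewrite ?size_mask_of smu // => i lt.
  by rewrite -[i]/(val (Ordinal lt)) nth_mask_of inE.
rewrite -(perm_big _ pe) big_map big_enum_cond /=.
by apply: eq_bigl => A; rewrite card_mask.
Qed.

Lemma shuffle_seq_mask n (A : {set 'I_n}) : shuffle_seq A = mask (mask_of A) (iota 0 n).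
Proof.
rewrite /shuffle_seq /mask_of -val_enum_ord -map_mask; congr map.
by rewrite -filter_mask enumT.
Qed.

Lemma shuffle_seq_maskC n (A : {set 'I_n}) :
  shuffle_seq (~: A) = mask (map negb (mask_of A)) (iota 0 n).
Proof.
rewrite shuffle_seq_mask /mask_of -map_comp; congr (mask _ _).
by apply: eq_map => i; rewrite /= inE.
Qed.

(** The summand alpha_i - i counts the elements of the complement below alpha_i; the
recursion on the mask counts the same pairs from the other side. *)
Lemma shuffle_sig_inversions n (A : {set 'I_n}) : shuffle_sig A = inversions (mask_of A).
Proof.
suff gen (mu : seq bool) k : (\sum_(i < count id mu)
    (nth 0 (mask mu (iota k (size mu))) i - i - k) = inversions mu)%N.
  rewrite /shuffle_sig shuffle_seq_mask -(gen _ 0%N) size_mask_of size_mask ?size_iota ?size_mask_of //.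
  by apply: eq_bigr => i _; rewrite subn0.
elim: mu k => [|b mu IH] k; first by rewrite big_ord0.
case: b => /=; rewrite ?add1n ?add0n; last first.
  rewrite -(IH k.+1) [X in (X + _)%N](_ : _ = \sum_(i < count id mu) 1)%N; last first.
    by rewrite sum_nat_const card_ord muln1.
  rewrite -big_split /=; apply: eq_bigr => i _.
  suff : (k + i < nth 0 (mask mu (iota k.+1 (size mu))) i)%N by lia.
  have : (i < size (mask mu (iota k.+1 (size mu))))%N by rewrite size_mask ?size_iota.
  move: (mask_subseq mu (iota k.+1 (size mu))); move: (mask _ _) => s sub si.
  have ss : sorted ltn s by apply: subseq_sorted sub (iota_ltn_sorted _ _); apply: ltn_trans.
  have sk : all (ltn k) s by apply/allP => j /(mem_subseq sub); rewrite mem_iota => /andP[].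
  elim: s (nat_of_ord i) k {sub IH} sk ss si => // a s IHs [|j] k /= /andP[ka _].
    by move=> *; rewrite addn0.
  rewrite (path_sortedE ltn_trans) => /andP[/allP as1 ss] js.
  have sk : all (ltn k.+1) s by apply/allP => x /as1 /=; lia.
  have := IHs j k.+1 sk ss js; lia.
rewrite big_ord_recl /= subn0 subnn ?add0n -(IH k.+1); apply: eq_bigr => i _.
by rewrite /= /bump /= add1n add0n -!subnDA addSnnS.
Qed.

End Masks.

(** * Evaluation of vertex lists in normalized chains *)
Section SimplexChains.
Variables (R : comNzRingType).

Lemma sdegen_cbas (X : sset) i (x : simp X) : cbas R (sdegen i x) = 0.
Proof. by case: x => n y; apply: cbas_degen; exists n, (inord i), y. Qed.

Lemma ndiff_cbas_sface (X : sset) (x : simp X) : diff (cbas R x : CN R X) =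
  if sdim x == 0%N then 0 else \sum_(i < (sdim x).+1) (-1) ^+ i *: cbas R (sface i x).
Proof.
case: x => -[|n] y; first exact: ndiff_cbas0.
rewrite [LHS]ndiff_cbas /=; apply: eq_bigr => i _.
by rewrite inord_val.
Qed.

Lemma ksign_cbas (X : sset) (x : simp X) : ksign (cbas R x : CN R X) = (-1) ^+ sdim x *: cbas R x.
Proof.
have e : hcomp (sdim x) (cbas R x : CN R X) = cbas R x by rewrite [LHS]nhcomp_cbas eqxx.
by rewrite -{1}e ksign_hcomp e.
Qed.

Lemma bd_sum (W : lmodType R) V (L : seq V) (e : seq V -> W) :
  bd L e = \sum_(i < size L) (-1) ^+ i *: e (del i L).
Proof.
elim: L e => [|v L IH] e; first by rewrite bd_nil big_ord0.
rewrite bd_cons IH big_ord_recl /del /= drop0 expr0 scale1r -sumrN; congr (_ + _).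
by apply: eq_bigr => i _; rewrite exprS mulN1r scaleNr.
Qed.

Section OneSimplex.
Variables (X : sset) (x : simp X).

(** The value 0 on lists that are not monotone makes ev normalized on all lists. *)
Definition ev (s : seq nat) : CN R X := if mono 0 (sdim x) s then cbas R (act s x) else 0.

Lemma ev_nil : ev [::] = 0. Proof. by []. Qed.

Lemma dup_cat T (s1 : seq T) y s2 : dup (size s1) (s1 ++ y :: s2) = s1 ++ y :: y :: s2.
Proof.
by rewrite /dup take_cat ltnNge leqnSn /= subSnn take_cons take0 drop_size_cat // -catA.
Qed.

Lemma ev_normal : normalized ev.
Proof.
move=> s1 y s2; rewrite /ev -dup_cat.
have lt : (size s1 < size (s1 ++ y :: s2))%N by rewrite size_cat /= addnS ltnS leq_addr.
rewrite mono_dup //; case: ifP => // ms; rewrite -sdegen_act //; exact: sdegen_cbas.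
Qed.

Lemma diff_ev s : mono 0 (sdim x) s -> diff (ev s) = bd s ev.
Proof.
move=> ms; rewrite {1}/ev ms ndiff_cbas_sface sdim_act // bd_sum.
case: s ms => [|a [|b s]] // ms; first by rewrite [RHS]big_ord1 [ev _]ev_nil scaler0.
rewrite [_ == _]/= [(_.-1).+1]/=; apply: eq_bigr => i _; have lt := ltn_ord i.
by rewrite sface_act // /ev mono_del.
Qed.

Lemma ksign_ev s : ksign (ev s) = (-1) ^+ (size s).-1 *: ev s.
Proof.
by rewrite /ev; case: ifP => ms; [rewrite ksign_cbas sdim_act|rewrite linear0 scaler0].
Qed.

Lemma ev_iota : ev (iota 0 (sdim x).+1) = cbas R x.
Proof. by rewrite /ev mono_iota act_iota leq0n add0n leqnn.
 Qed.
End OneSimplex.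

Section TwoSimplices.
Variables (X Y : sset).

Lemma crossP (a : simp X) (b : simp Y) : sdim a = sdim b ->
  exists c, [/\ simp_fst c = a, simp_snd c = b, sdim c = sdim a & cross R a b = cbas R c].
Proof.
case: a b => m x [n y] /= mn; subst n; exists (Simp (X := sprod X Y) (x, y)); split=> //.
by rewrite /cross; case: eqP => // e; rewrite (eq_irrelevance e (erefl m)).
Qed.

Lemma cross_cbas (c : simp (sprod X Y)) : cross R (simp_fst c) (simp_snd c) = cbas R c.
Proof.
case: c => m [x y]; rewrite /simp_fst /simp_snd /cross /=.
by case: eqP => // e; rewrite (eq_irrelevance e (erefl m)).
Qed.

Lemma simp_fst_sface i (c : simp (sprod X Y)) : simp_fst (sface i c) = sface i (simp_fst c).
Proof. by case: c => -[|n] []. Qed.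
Lemma simp_snd_sface i (c : simp (sprod X Y)) : simp_snd (sface i c) = sface i (simp_snd c).
Proof. by case: c => -[|n] []. Qed.
Lemma simp_fst_sdegen i (c : simp (sprod X Y)) : simp_fst (sdegen i c) = sdegen i (simp_fst c).
Proof. by case: c. Qed.
Lemma simp_snd_sdegen i (c : simp (sprod X Y)) : simp_snd (sdegen i c) = sdegen i (simp_snd c).
Proof. by case: c. Qed.

Variables (a : simp X) (b : simp Y).

Definition mono2 (L : seq (nat * nat)) := mono 0 (sdim a) (unzip1 L) && mono 0 (sdim b) (unzip2 L).

Definition ev2 (L : seq (nat * nat)) : CN R (sprod X Y) :=
  if mono2 L then cross R (act (unzip1 L) a) (act (unzip2 L) b) else 0.

Lemma ev2_nil : ev2 [::] = 0. Proof. by []. Qed.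

Lemma ev2P L : mono2 L -> exists c, [/\ simp_fst c = act (unzip1 L) a,
  simp_snd c = act (unzip2 L) b, sdim c = (size L).-1 & ev2 L = cbas R c].
Proof.
move=> mL; have /andP[m1 m2] := mL.
have [|c [c1 c2 c3 c4]] := @crossP (act (unzip1 L) a) (act (unzip2 L) b).
  by rewrite !sdim_act // !size_map.
by exists c; split=> //; rewrite ?c3 ?sdim_act ?size_map // /ev2 mL.
Qed.

Lemma unzip_del (L : seq (nat * nat)) i :
  (unzip1 (del i L) = del i (unzip1 L)) * (unzip2 (del i L) = del i (unzip2 L)).
Proof. by rewrite /del /unzip1 /unzip2 !map_cat !map_take !map_drop. Qed.
Lemma unzip_dup (L : seq (nat * nat)) i :
  (unzip1 (dup i L) = dup i (unzip1 L)) * (unzip2 (dup i L) = dup i (unzip2 L)).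
Proof. by rewrite /dup /unzip1 /unzip2 !map_cat !map_take !map_drop. Qed.

Lemma unzip_cat (K L : seq (nat * nat)) :
  (unzip1 (K ++ L) = unzip1 K ++ unzip1 L) * (unzip2 (K ++ L) = unzip2 K ++ unzip2 L).
Proof. by rewrite /unzip1 /unzip2 !map_cat. Qed.

Lemma mono2_del L i : mono2 L -> (1 < size L)%N -> (i < size L)%N -> mono2 (del i L).
Proof.
by move=> /andP[m1 m2] s1 s2; rewrite /mono2 !unzip_del !mono_del ?size_map.
Qed.

Lemma ev2_normal : normalized ev2.
Proof.
move=> s1 y s2; rewrite -dup_cat /ev2 /mono2 !unzip_dup.
have lt : (size s1 < size (s1 ++ y :: s2))%N by rewrite size_cat /= addnS ltnS leq_addr.
rewrite !mono_dup ?size_map //; case: ifP => // ms; have [c [c1 c2 c3 c4]] := ev2P ms.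
case/andP: ms => m1 m2; rewrite -!sdegen_act ?size_map // -c1 -c2.
by rewrite -simp_fst_sdegen -simp_snd_sdegen cross_cbas sdegen_cbas.
Qed.

Lemma diff_ev2 L : mono2 L -> diff (ev2 L) = bd L ev2.
Proof.
move=> mL; have [c [c1 c2 c3 ->]] := ev2P mL; rewrite ndiff_cbas_sface c3 bd_sum.
have /andP[m1 m2] := mL.
case: L mL c1 c2 c3 m1 m2 => [|u [|v L]] // mL c1 c2 c3 m1 m2.
  by rewrite [RHS]big_ord1 [ev2 _]ev2_nil scaler0.
rewrite [_ == _]/= [(_.-1).+1]/=; apply: eq_bigr => i _; have lt := ltn_ord i.
rewrite /ev2 mono2_del // !unzip_del -!sface_act ?size_map // -c1 -c2.
by rewrite -simp_fst_sface -simp_snd_sface cross_cbas.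
Qed.
End TwoSimplices.
End SimplexChains.

(** * AW, EML and SHI on vertex lists *)
Lemma aw_sum (R : comNzRingType) (W : lmodType R) A B (L : seq (A * B)) (E : seq A -> seq B -> W) :
  aw L E = \sum_(i < size L) E (unzip1 (take i.+1 L)) (unzip2 (drop i L)).
Proof.
elim: L E => [|v L IH] E; first by rewrite aw_nil big_ord0.
rewrite aw_cons big_ord_recl /= take0 /= IH; congr (_ + _).
Qed.

Lemma faces_act (X : sset) (x : simp X) w j n : mono 0 (sdim x) w -> (j + n <= size w)%N ->
  (n < size w)%N -> faces (iota j n) (act w x) = act (take j w ++ drop (j + n) w) x.
Proof.
move=> mw; elim: n j => [|n IH] j le lt; first by rewrite addn0 cat_take_drop.
rewrite /= -/(faces _ _) IH; [|lia|lia].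
have sz : size (take j.+1 w) = j.+1 by rewrite size_take; case: ltnP; lia.
rewrite sface_act.
- by congr act; rewrite /del drop_size_cat // take_cat sz ltnSn take_takel // addSnnS.
- apply: mono_sub mw _ _.
    rewrite -[X in subseq _ X](cat_take_drop j.+1); apply: cat_subseq; first exact: subseq_refl.
    by rewrite addnC -drop_drop; apply: drop_subseq.
  by rewrite -size_eq0 size_cat sz.
- by rewrite size_cat sz; lia.
- by rewrite size_cat sz size_drop; lia.
Qed.

Section Translation.
Variables (R : comNzRingType) (X Y : sset) (a : simp X) (b : simp Y).

Lemma AW_basis_ev (c : simp (sprod X Y)) L : mono2 a b L ->
  simp_fst c = act (unzip1 L) a -> simp_snd c = act (unzip2 L) b ->
  AW_basis R c = aw L (fun s t => tens (ev R a s : CN R X) (ev R b t : CN R Y)).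
Proof.
move=> /andP[m1 m2] ca cb; rewrite /AW_basis aw_sum ca cb.
have L0 : (0 < size L)%N by rewrite -(size_map fst) lt0n size_eq0; case/and3P: m1.
have sc : (sdim c).+1 = size L.
  by rewrite -[sdim c]/(sdim (simp_fst c)) ca sdim_act // size_map prednK.
rewrite -sc; apply: eq_bigr => i _; have lt := ltn_ord i.
have iL : (i < size L)%N by rewrite -sc.
have im : (i.+1 + (sdim c - i) = size L)%N by clear -lt sc; lia.
have -> : faces (iota i.+1 (sdim c - i)) (act (unzip1 L) a) = act (unzip1 (take i.+1 L)) a.
  rewrite faces_act // ?im ?size_map //; last by clear -L0 sc; lia.
  by rewrite drop_oversize ?size_map // cats0 /unzip1 map_take.
have -> : faces (iota 0 i) (act (unzip2 L) b) = act (unzip2 (drop i L)) b.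
  rewrite faces_act ?size_map // ?add0n 1?ltnW //.
  by rewrite take0 /unzip2 map_drop.
have mt : mono 0 (sdim a) (map fst (take i.+1 L)).
  rewrite map_take; apply: mono_sub m1 (take_subseq _ _) _.
  by rewrite -size_eq0 size_take size_map; case: ltnP => //; lia.
have md : mono 0 (sdim b) (map snd (drop i L)).
  rewrite map_drop; apply: mono_sub m2 (drop_subseq _ _) _.
  by rewrite -size_eq0 size_drop size_map; lia.
by rewrite /ev mt md.
Qed.

Lemma degens_cat (Z : sset) s t (z : simp Z) : degens (s ++ t) z = degens s (degens t z).
Proof. by rewrite /degens foldr_cat. Qed.

(** Reading the mask from the left, each false repeats the current vertex of the first
coordinate.  The prefix pre holds the vertices already passed. *)
Lemma degens_path (Z : sset) (z : simp Z) A pre (s : seq nat) (t : seq A) mu k :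
  size pre = k -> (0 < size s)%N -> (0 < size t)%N ->
  count id mu = (size s).-1 -> count negb mu = (size t).-1 -> mono 0 (sdim z) (pre ++ s) ->
  mono 0 (sdim z) (pre ++ unzip1 (lattice_path s t mu)) /\
  degens (rev (mask (map negb mu) (iota k (size mu)))) (act (pre ++ s) z) =
    act (pre ++ unzip1 (lattice_path s t mu)) z.
Proof.
elim: mu pre s t k => [|c mu IH] pre [|x s] // [|y t] // k pk _ _ cs ct m.
  by case: s cs m.
have sz : size (rcons pre x) = k.+1 by rewrite size_rcons pk.
case: c cs ct => /= cs ct.
  case: s cs m => // x' s [cs] m.
  rewrite -!(cat_rcons x pre); apply: IH; rewrite ?cat_rcons //.
case: t ct => // y' t [ct].
rewrite rev_cons -cats1 degens_cat [degens [:: _] _]/= sdegen_act ?size_cat //=; last by rewrite pk; lia.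
rewrite -pk dup_cat -!(cat_rcons x pre) pk; apply: IH => //.
by rewrite cat_rcons -dup_cat mono_dup // size_cat /=; lia.
Qed.

Lemma path_swap A B (s : seq A) (t : seq B) mu :
  lattice_path t s (map negb mu) = map swap (lattice_path s t mu).
Proof. by elim: mu s t => [|[] mu IH] [|x s] [|y t] //=; rewrite IH. Qed.

Lemma degens_path2 (Z : sset) (z : simp Z) A pre (s : seq A) (t : seq nat) mu k :
  size pre = k -> (0 < size s)%N -> (0 < size t)%N ->
  count id mu = (size s).-1 -> count negb mu = (size t).-1 -> mono 0 (sdim z) (pre ++ t) ->
  mono 0 (sdim z) (pre ++ unzip2 (lattice_path s t mu)) /\
  degens (rev (mask mu (iota k (size mu)))) (act (pre ++ t) z) =
    act (pre ++ unzip2 (lattice_path s t mu)) z.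
Proof.
move=> pk s0 t0 cs ct m.
have -> : unzip2 (lattice_path s t mu) = unzip1 (lattice_path t s (map negb mu)).
  by rewrite path_swap /unzip1 /unzip2 -map_comp; apply: eq_map => -[].
have nn : map negb (map negb mu) = mu.
  by rewrite -map_comp -[RHS]map_id; apply: eq_map => -[].
rewrite -{2}nn -(size_map negb mu); apply: degens_path => //.
  by rewrite count_map -ct; apply: eq_count => -[].
by rewrite count_map -cs; apply: eq_count => -[].
Qed.

(** The common form of EML (k = 0) and SHI: shuffles of degeneracies shifted by k act on
the vertices after the first k ones. *)
Lemma sum_shuffles pre1 s pre2 t p q k : size pre1 = k -> size pre2 = k ->
  size s = p.+1 -> size t = q.+1 ->
  mono 0 (sdim a) (pre1 ++ s) -> mono 0 (sdim b) (pre2 ++ t) ->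
  \sum_(A : {set 'I_(p + q)} | #|A| == p) (-1) ^+ shuffle_sig A *:
    cross R (degens (rev [seq (j + k)%N | j <- shuffle_seq (~: A)]) (act (pre1 ++ s) a))
            (degens (rev [seq (j + k)%N | j <- shuffle_seq A]) (act (pre2 ++ t) b)) =
  shuffle s t (fun L => ev2 R a b (zip pre1 pre2 ++ L)).
Proof.
move=> p1 p2 ss st ms mt.
pose F mu := (-1) ^+ inversions mu *:
  cross R (degens (rev (mask (map negb mu) (iota k (size mu)))) (act (pre1 ++ s) a))
          (degens (rev (mask mu (iota k (size mu)))) (act (pre2 ++ t) b)).
have addk (mu : seq bool) n : [seq (j + k)%N | j <- mask mu (iota 0 n)] = mask mu (iota k n).
  by rewrite map_mask -[in RHS](addn0 k) iotaDl; congr mask; apply: eq_map => j; rewrite addnC.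
rewrite (eq_bigr (fun A => F (mask_of A))) => [|A _]; last first.
  by rewrite shuffle_sig_inversions shuffle_seq_maskC shuffle_seq_mask !addk /F size_mask_of.
rewrite sum_sets; case: s ss ms @F => // x s [ss] ms; case: t st mt => // y t [st] mt F.
rewrite shuffle_masks ss st big_seq_cond [RHS]big_seq_cond; apply: eq_bigr => mu.
rewrite mem_masks => /andP[/eqP smu /eqP cmu].
have cN : count negb mu = q.
  have := count_predC id mu; rewrite smu cmu => /addnI <-; apply: eq_count => -[] //.
have [||m1 d1] := @degens_path X a _ pre1 (x :: s) (y :: t) mu k p1 isT isT _ _ ms.
- by rewrite cmu /= ss.
- by rewrite cN /= st.
have [||m2 d2] := @degens_path2 Y b _ pre2 (x :: s) (y :: t) mu k p2 isT isT _ _ mt.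
- by rewrite cmu /= ss.
- by rewrite cN /= st.
rewrite /F d1 d2 /ev2 /mono2 !unzip_cat.
by rewrite unzip1_zip ?unzip2_zip ?p1 ?p2 // m1 m2.
Qed.

Lemma EML_basis_ev s t : mono 0 (sdim a) s -> mono 0 (sdim b) t ->
  EML_basis R (act s a) (act t b) = shuffle s t (ev2 R a b).
Proof.
move=> ms mt; have [s0 t0] : (0 < size s)%N /\ (0 < size t)%N.
  by rewrite !lt0n !size_eq0; case/and3P: ms => ->; case/and3P: mt => ->.
rewrite /EML_basis !sdim_act //.
have add0 r : [seq (j + 0)%N | j <- r] = r.
  by rewrite -[RHS]map_id; apply: eq_map => j; rewrite addn0.
rewrite -(@sum_shuffles [::] s [::] t (size s).-1 (size t).-1 0) ?prednK //.
by apply: eq_bigr => A _; rewrite !add0.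
Qed.

Lemma proj_sum (W : lmodType R) A B (L : seq (A * B)) (e : seq (A * B) -> W) :
  proj L e = \sum_(i < size L) shuffle (unzip1 (take i.+1 L)) (unzip2 (drop i L)) e.
Proof. by rewrite /proj aw_sum. Qed.

Lemma shi_sum (W : lmodType R) A B (L : seq (A * B)) (e : seq (A * B) -> W) :
  shi L e = \sum_(j < size L) (-1) ^+ j *: proj (drop j L) (fun K => e (take j.+1 L ++ K)).
Proof.
elim: L e => [|v L IH] e; first by rewrite shi_nil big_ord0.
rewrite shi_cons IH big_ord_recl expr0 scale1r /= take0 -sumrN; congr (_ + _).
by apply: eq_bigr => j _; rewrite exprS mulN1r scaleNr.
Qed.

Lemma sum_triangle (W : lmodType R) m (g : nat -> nat -> W) :
  \sum_(q < m) \sum_(p < m - q) g q p = \sum_(p < m) \sum_(q < m - p) g q p.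
Proof.
have widen (F : nat -> W) q : \sum_(p < m - q) F p = \sum_(p < m | (p < m - q)%N) F p.
  exact: big_ord_widen (leq_subr _ _).
under eq_bigr do rewrite widen.
rewrite (exchange_big_dep predT) //=; apply: eq_bigr => p _; rewrite (widen (fun q => g q p)).
by apply: eq_bigl => q; rewrite !ltn_subRL addnC.
Qed.

(** A cut at the last vertex v of the prefix contributes nothing to SHI: v is repeated. *)
Lemma shuffle_repeat K (v : nat * nat) t :
  shuffle [:: v.1] (v.2 :: t) (fun L => ev2 R a b (rcons K v ++ L)) = 0.
Proof.
rewrite shuffle_cons -surjective_pairing shuffle0s /= expr0 scale1r add0r.
rewrite [X in _ + X](_ : _ = 0); last first.
  rewrite -[RHS](shuffle_zero _ [:: v.1] t); congr shuffle; apply/funext => L /=.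
  by rewrite cat_rcons ev2_normal.
by rewrite cat_rcons ev2_normal if_same addr0.
Qed.

(** In the formula for SHI put j = m' - 1, where m' is the bar m of the formula, and
k = p + 1: the summand is v_0 ... v_j followed by the paths from (j, j+k) to
(j+k, m).  The terms of the list operator with k = 0 vanish. *)
Lemma SHI_basis_ev (c : simp (sprod X Y)) L : mono2 a b L ->
  simp_fst c = act (unzip1 L) a -> simp_snd c = act (unzip2 L) b ->
  SHI_basis R c = shi L (ev2 R a b).
Proof.
move=> mL ca cb; have /andP[m1 m2] := mL; rewrite /SHI_basis ca cb.
have L0 : (0 < size L)%N by rewrite -(size_map fst) lt0n size_eq0; case/and3P: m1.
have sc : sdim c = (size L).-1 by rewrite -[sdim c]/(sdim (simp_fst c)) ca sdim_act // size_map.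
move: (sdim c) sc => m sc {c ca cb}; have sL : size L = m.+1 by rewrite sc prednK.
pose f j k := (-1) ^+ j *: shuffle (drop j (unzip1 (take (j + k).+1 L))) (drop (j + k) (unzip2 L))
   (fun K => ev2 R a b (take j.+1 L ++ K)).
have f0 j : (j < size L)%N -> f j 0%N = 0.
  move=> jL; rewrite /f addn0 [drop j (unzip2 L)](drop_nth 0%N) ?size_map //.
  have -> : unzip1 (take j.+1 L) = take j.+1 (unzip1 L) by rewrite /unzip1 map_take.
  rewrite (take_nth 0%N) ?size_map // -cats1 drop_size_cat ?size_take ?size_map ?jL //.
  rewrite (nth_map (0%N, 0%N)) // [nth _ (unzip2 _) _](nth_map (0%N, 0%N)) //.
  by rewrite (take_nth (0%N, 0%N)) // shuffle_repeat scaler0.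
have -> : shi L (ev2 R a b) = \sum_(j < m) \sum_(k < m - j) f j k.+1.
  rewrite shi_sum sL.
  under eq_bigr => j _.
    rewrite proj_sum scaler_sumr size_drop sL.
    under eq_bigr => k _.
      rewrite take_drop drop_drop addSn (addnC k) {1}/unzip1 map_drop {1}/unzip2 map_drop.
      rewrite -!/(unzip1 _) -!/(unzip2 _) -/(f j k).
    over.
  over.
  rewrite big_ord_recr /= subSnn big_ord1 f0 ?sL // addr0; apply: eq_bigr => j _.
  by rewrite subSn ?(ltnW (ltn_ord j)) // big_ord_recl f0 ?add0r // sL ltnS ltnW.
transitivity (\sum_(q < m) \sum_(p < m - q) f (m - p - q).-1 p.+1); last first.
  rewrite (sum_triangle _ (fun q p => f (m - p - q).-1 p.+1)).
  rewrite (sum_triangle _ (fun j k => f j k.+1)); apply: eq_bigr => p _.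
  by rewrite [RHS](reindex_inj rev_ord_inj); apply: eq_bigr => q _; rewrite /= subnS.
apply: eq_bigr => q _; apply: eq_bigr => p _.
case: p => p /= lp; case: q lp => q /= lq lp.
have {lp lq} [j mE] : exists j, m = (j + p + q).+1 by exists (m - p - q).-1; lia.
have -> : (m - p - q = j.+1)%N by lia.
have -> : (m - q = (j + p).+1)%N by lia.
have -> : ((j + p).+1 - j.+1 = p)%N by lia.
have su : size (unzip1 L) = (j + p + q).+2 by rewrite size_map sL mE.
have sw : size (unzip2 L) = (j + p + q).+2 by rewrite size_map sL mE.
rewrite faces_act // ?su; [|lia|lia].
rewrite faces_act // ?sw; [|lia|lia].
rewrite drop_oversize ?su ?cats0; last lia.
set v := take (j + p).+2 (unzip1 L).
have sv : size v = (j + p).+2 by rewrite size_takel // su; lia.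
have mv : mono 0 (sdim a) v.
  by apply: mono_sub m1 (take_subseq _ _) _; rewrite -size_eq0 sv.
rewrite sdegen_act ?sv //; last by rewrite /=; lia.
have mw : mono 0 (sdim b) (take j.+1 (unzip2 L) ++ drop (j.+1 + p) (unzip2 L)).
  apply: mono_sub m2 _ _; last by rewrite -size_eq0 size_cat size_takel ?sw //; lia.
  rewrite -[X in subseq _ X](cat_take_drop j.+1); apply: cat_subseq; first exact: subseq_refl.
  by rewrite addnC -drop_drop; apply: drop_subseq.
have md : mono 0 (sdim a) (take j.+1 v ++ drop j v).
  by rewrite -/(dup j v) mono_dup // sv; lia.
rewrite /dup; under eq_bigr => A _.
  rewrite (_ : (-1) ^+ (j.+1 + shuffle_sig A + 1) = (-1) ^+ j * (-1) ^+ shuffle_sig A); last first.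
    by sign_parity.
  rewrite -scalerA.
over.
rewrite -scaler_sumr (@sum_shuffles _ _ _ _ p.+1 q j.+1) //.
- rewrite /f /=; congr (_ *: _); rewrite addSn addnS /unzip1 map_take -/(unzip1 _) -/v.
  congr shuffle; apply/funext => K; congr (ev2 _ _ _ (_ ++ _)).
  rewrite /v take_takel; last lia.
  by rewrite /unzip1 /unzip2 -!map_take zip_unzip.
- by rewrite size_takel // sv; lia.
- by rewrite size_takel // sw; lia.
- by rewrite size_drop sv; lia.
- by rewrite size_drop sw; lia.
Qed.
End Translation.

(** * Linear maps and congruences *)
Section LinearProp.
Variables (R : comNzRingType) (U W : lmodType R) (F : U -> W).
Hypothesis Fl : linear F.

Lemma lin0 : F 0 = 0.
Proof. by have := Fl (-1) 0 0; rewrite scaler0 addr0 scaleN1r addNr. Qed.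
Lemma linD u v : F (u + v) = F u + F v.
Proof. by rewrite -[u]scale1r Fl !scale1r. Qed.
Lemma linZ a u : F (a *: u) = a *: F u.
Proof. by rewrite -[a *: u]addr0 Fl lin0 addr0. Qed.
Lemma linN u : F (- u) = - F u.
Proof. by rewrite -scaleN1r linZ scaleN1r. Qed.
Lemma linB u v : F (u - v) = F u - F v.
Proof. by rewrite linD linN. Qed.
Lemma lin_sum (I : Type) (r : seq I) (P : pred I) (G : I -> U) :
  F (\sum_(i <- r | P i) G i) = \sum_(i <- r | P i) F (G i).
Proof. by apply: (big_morph F linD lin0). Qed.

Lemma lin_bd V (L : seq V) e : F (bd L e) = bd L (F \o e).
Proof. by elim: L e => [|v L IH] e; rewrite ?bd_nil ?lin0 // !bd_cons linB IH. Qed.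

Lemma lin_shuffle A B (s : seq A) (t : seq B) e : F (shuffle s t e) = shuffle s t (F \o e).
Proof.
move: s t e; apply: shuffle_ind => [t|s|a s b t IH1 IH2] e; rewrite ?shuffle0s ?shuffles0 ?lin0 //.
rewrite !shuffle_cons !linD linZ IH1 IH2; congr (_ + _).
by case: ifP; rewrite ?lin0.
Qed.

Lemma lin_aw A B (L : seq (A * B)) E : F (aw L E) = aw L (fun s t => F (E s t)).
Proof. by elim: L E => [|v L IH] E; rewrite ?aw_nil ?lin0 // !aw_cons linD IH. Qed.

Lemma lin_proj A B (L : seq (A * B)) e : F (proj L e) = proj L (F \o e).
Proof.
rewrite /proj lin_aw; congr aw.
by apply/funext => s; apply/funext => t; rewrite lin_shuffle.
Qed.

Lemma lin_shi A B (L : seq (A * B)) e : F (shi L e) = shi L (F \o e).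
Proof. by elim: L e => [|v L IH] e; rewrite ?shi_nil ?lin0 // !shi_cons linB lin_proj IH. Qed.
End LinearProp.

Lemma linear_comp (R : comNzRingType) (U V W : lmodType R) (F : V -> W) (G : U -> V) :
  linear F -> linear G -> linear (F \o G).
Proof. by move=> Fl Gl a u v; rewrite /= Gl Fl. Qed.

Lemma linear_add (R : comNzRingType) (U W : lmodType R) (F G : U -> W) :
  linear F -> linear G -> linear (fun x => F x + G x).
Proof. by move=> Fl Gl a u v; rewrite Gl Fl scalerDr addrACA. Qed.

Lemma linear_scale (R : comNzRingType) (U W : lmodType R) (F : U -> W) r :
  linear F -> linear (fun x => r *: F x).
Proof. by move=> Fl a u v; rewrite Fl scalerDr !scalerA mulrC. Qed.

Lemma linear_sub (R : comNzRingType) (U W : lmodType R) (F G : U -> W) :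
  linear F -> linear G -> linear (fun x => F x - G x).
Proof. by move=> Fl Gl a u v; rewrite Gl Fl scalerBr opprD addrACA. Qed.

Lemma linear_id (R : comNzRingType) (U : lmodType R) : linear (fun x : U => x).
Proof. by []. Qed.

Lemma linear_zero (R : comNzRingType) (U W : lmodType R) : linear (fun _ : U => 0 : W).
Proof. by move=> a u v; rewrite scaler0 addr0. Qed.

(** Operators applied to a monotone list only involve monotone lists with the same bounds,
so two functions that agree on these may be exchanged.  The lower bound varies in the
inductions: after the prefix v, only lists above v occur. *)
Section Congruence.
Variables (R : comNzRingType) (W : lmodType R).
Implicit Types (lo hi : nat * nat) (e : seq (nat * nat) -> W).

Definition mono_pairs lo hi (L : seq (nat * nat)) :=
  mono lo.1 hi.1 (unzip1 L) && mono lo.2 hi.2 (unzip2 L).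

Lemma mono_pairs_cons lo hi v L : mono_pairs lo hi (v :: L) =
  [&& lo.1 <= v.1 <= hi.1, lo.2 <= v.2 <= hi.2 & (L == [::]) || mono_pairs v hi L]%N.
Proof.
rewrite /mono_pairs /= !mono_cons; case: L => [|w L] /=; rewrite ?andbT //.
by rewrite andbACA -!andbA.
Qed.

Lemma eq_shuffle_mono lo hi s t e e' :
  mono lo.1 hi.1 s -> mono lo.2 hi.2 t -> (forall L, mono_pairs lo hi L -> e L = e' L) ->
  shuffle s t e = shuffle s t e'.
Proof.
move: s t lo e e'; apply: shuffle_ind => [t|s|a s b t IH1 IH2] lo e e'; rewrite ?shuffles0 //.
rewrite !mono_cons => /andP[la ms] /andP[lb mt] ee; rewrite !shuffle_cons.
have ee' L : mono_pairs (a, b) hi L -> (e \o cons (a, b)) L = (e' \o cons (a, b)) L.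
  by move=> mL; apply: ee; rewrite mono_pairs_cons la lb mL orbT.
congr (_ + (_ + _ *: _)).
- by case: ifP => // _; apply: ee; rewrite mono_pairs_cons /= la lb.
- case: s ms {IH2} IH1 => [|x s] ms IH1; first by rewrite !shuffle0s.
  by apply: (IH1 (a, b)) => //=; rewrite mono_cons leqnn mt; case/andP: lb => _ ->.
- case: t mt {IH1} IH2 => [|y t] mt IH2; first by rewrite !shuffles0.
  by apply: (IH2 (a, b)) => //=; rewrite mono_cons leqnn ms; case/andP: la => _ ->.
Qed.

Lemma eq_aw_mono lo hi L (E E' : seq nat -> seq nat -> W) : mono_pairs lo hi L ->
  (forall s t, mono lo.1 hi.1 s -> mono lo.2 hi.2 t -> E s t = E' s t) -> aw L E = aw L E'.
Proof.
elim: L lo E E' => [|v L IH] lo E E' mL EE; first by rewrite !aw_nil.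
have /andP[m1 m2] := mL; move: mL; rewrite mono_pairs_cons => /and3P[l1 l2 mL].
rewrite !aw_cons EE //; last by rewrite mono_cons l1.
congr (_ + _); case: L mL IH {m1 m2} => [|w L] /= mL IH; first by rewrite !aw_nil.
apply: (IH v) => // s t ms mt; apply: EE; first by rewrite mono_cons l1 ms orbT.
case/and3P: mt => t0 st al; rewrite /mono t0 st; apply: sub_all al => i; lia.
Qed.

Lemma eq_proj_mono lo hi L e e' : mono_pairs lo hi L ->
  (forall K, mono_pairs lo hi K -> e K = e' K) -> proj L e = proj L e'.
Proof.
by move=> mL ee; apply: eq_aw_mono mL _ => s t ms mt; apply: eq_shuffle_mono ms mt ee.
Qed.

Lemma eq_shi_mono lo hi L e e' : mono_pairs lo hi L ->
  (forall K, mono_pairs lo hi K -> e K = e' K) -> shi L e = shi L e'.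
Proof.
elim: L lo e e' => [|v L IH] lo e e' mL ee; first by rewrite !shi_nil.
have := mL; rewrite mono_pairs_cons => /and3P[l1 l2 mL'].
have ee' K : mono_pairs v hi K -> (e \o cons v) K = (e' \o cons v) K.
  by move=> mK; apply: ee; rewrite mono_pairs_cons l1 l2 mK orbT.
have mvL : mono_pairs v hi (v :: L).
  by rewrite mono_pairs_cons !leqnn mL' andbT; case/andP: l1 => _ ->; case/andP: l2 => _ ->.
rewrite !shi_cons (eq_proj_mono mvL ee'); congr (_ - _).
case: L mL' {mL mvL} IH => [|w L] mL' IH; first by rewrite !shi_nil.
exact: IH mL' ee'.
Qed.

Lemma mono_pairs_del lo hi L i : mono_pairs lo hi L -> (1 < size L)%N -> (i < size L)%N ->
  mono_pairs lo hi (del i L).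
Proof.
by move=> /andP[m1 m2] s1 s2; rewrite /mono_pairs !unzip_del !mono_del ?size_map.
Qed.

Lemma eq_bd_mono lo hi L e e' : mono_pairs lo hi L -> (1 < size L)%N ->
  (forall K, mono_pairs lo hi K -> e K = e' K) -> bd L e = bd L e'.
Proof.
move=> mL L1 ee; rewrite !bd_sum; apply: eq_bigr => i _; congr (_ *: _).
by apply: ee; apply: mono_pairs_del.
Qed.
End Congruence.

(** * The Eilenberg-Zilber contraction *)
Record is_contraction (R : comNzRingType) (N M : chain_complex R) (c : contraction_data N M) : Prop :=
  IsContraction {
  ctr_f_linear : linear (ctr_f c);
  ctr_g_linear : linear (ctr_g c);
  ctr_phi_linear : linear (ctr_phi c);
  ctr_f_diff : forall x, ctr_f c (diff x) = diff (ctr_f c x);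
  ctr_fg : forall y, ctr_f c (ctr_g c y) = y;
  ctr_homotopy : forall x, ctr_phi c (diff x) + diff (ctr_phi c x) = ctr_g c (ctr_f c x) - x;
  ctr_phi_g : forall y, ctr_phi c (ctr_g c y) = 0;
  ctr_f_phi : forall x, ctr_f c (ctr_phi c x) = 0;
  ctr_phi_phi : forall x, ctr_phi c (ctr_phi c x) = 0
}.

Section TensorLemmas.
Variables (R : comNzRingType) (M N : lmodType R).

Lemma tens_linearl (y : N) : linear (fun x : M => tens x y).
Proof. exact: (tens_bilin M N).1. Qed.
Lemma tens_linearr (x : M) : linear (tens x : N -> tensor M N).
Proof. exact: (tens_bilin M N).2. Qed.
End TensorLemmas.

Section EilenbergZilberTheorem.
Variables (R : comNzRingType) (X Y : sset).

Lemma normal_dup (W : lmodType R) V (e : seq V -> W) i L :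
  normalized e -> (i < size L)%N -> e (dup i L) = 0.
Proof.
case: L => // v0 L ne; set K := v0 :: L => iK.
rewrite -(cat_take_drop i K) (drop_nth v0) //.
have {1}-> : i = size (take i K) by rewrite size_takel // ltnW.
by rewrite dup_cat ne.
Qed.

Section Pair.
Variable c : simp (sprod X Y).
Let a := simp_fst c.
Let b := simp_snd c.
Definition diagonal n : seq (nat * nat) := zip (iota 0 n.+1) (iota 0 n.+1).
Let L := diagonal (sdim c).

Lemma unzip_diagonal n :
  (unzip1 (diagonal n) = iota 0 n.+1) * (unzip2 (diagonal n) = iota 0 n.+1).
Proof. by rewrite /diagonal unzip1_zip ?unzip2_zip. Qed.

Lemma size_diagonal n : size (diagonal n) = n.+1.
Proof. by rewrite size_zip size_iota minnn. Qed.

Lemma mono_diagonal : mono2 a b L.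
Proof. by rewrite /mono2 !unzip_diagonal !mono_iota !leqnn. Qed.

Lemma act_diagonal : (act (unzip1 L) a = a) * (act (unzip2 L) b = b).
Proof. by rewrite !unzip_diagonal /L; split; [exact: (act_iota a)|exact: (act_iota b)]. Qed.

Lemma ev2_diagonal : ev2 R a b L = cbas R c.
Proof. by rewrite /ev2 mono_diagonal !act_diagonal cross_cbas. Qed.
End Pair.

Lemma degenerateP (Z : sset) (z : simp Z) : degenerate z ->
  exists (z' : simp Z) i, (i <= sdim z')%N /\ z = sdegen i z'.
Proof.
move=> [n [i [y ->]]]; exists (Simp y), i; split; first by rewrite -ltnS.
by rewrite /sdegen /= inord_val.
Qed.

Section Degenerate.
Variables (c : simp (sprod X Y)) (i : nat).
Hypothesis ic : (i <= sdim c)%N.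
Let L := diagonal (sdim c).

Let iL : (i < size L)%N. Proof. by rewrite size_diagonal. Qed.
Let mL : mono2 (simp_fst c) (simp_snd c) (dup i L).
Proof.
have /andP[m1 m2] := mono_diagonal c.
by rewrite /mono2 !unzip_dup !mono_dup ?size_map // m1 m2.
Qed.
Let c1 : simp_fst (sdegen i c) = act (unzip1 (dup i L)) (simp_fst c).
Proof.
have /andP[m1 m2] := mono_diagonal c.
by rewrite unzip_dup -sdegen_act ?size_map // act_diagonal simp_fst_sdegen.
Qed.
Let c2 : simp_snd (sdegen i c) = act (unzip2 (dup i L)) (simp_snd c).
Proof.
have /andP[m1 m2] := mono_diagonal c.
by rewrite unzip_dup -sdegen_act ?size_map // act_diagonal simp_snd_sdegen.
Qed.

Lemma AW_basis_sdegen : AW_basis R (sdegen i c) = 0.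
Proof.
rewrite (AW_basis_ev R mL c1 c2).
apply: (normal_dup (e := fun K => aw K _)) => // s1 x s2; apply: aw_normal.
  move=> t s1' x' s2'; rewrite ev_normal; exact: (lin0 (tens_linearl _)).
move=> s t1 y t2; rewrite ev_normal; exact: (lin0 (tens_linearr _)).
Qed.

Lemma SHI_basis_sdegen : SHI_basis R (sdegen i c) = 0.
Proof.
rewrite (SHI_basis_ev R mL c1 c2).
apply: (normal_dup (e := fun K => shi K _)) => // s1 x s2; apply: shi_normal.
exact: ev2_normal.
Qed.
End Degenerate.

Lemma AW_basis_degenerate c : degenerate c -> AW_basis R c = 0 :> tensor (CN R X) (CN R Y).
Proof. by move=> /degenerateP[z [i [iz ->]]]; apply: AW_basis_sdegen. Qed.
Lemma SHI_basis_degenerate (c : simp (sprod X Y)) : degenerate c -> SHI_basis R c = 0.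
Proof. by move=> /degenerateP[z [i [iz ->]]]; apply: SHI_basis_sdegen. Qed.

Lemma EML_basis_degeneratel (a : simp X) (b : simp Y) : degenerate a -> EML_basis R a b = 0.
Proof.
move=> /degenerateP[a' [i [ia ->]]].
have iL : (i < size (iota 0 (sdim a').+1))%N by rewrite size_iota.
rewrite -[a' in sdegen _ a']act_iota -(act_iota b) sdegen_act ?mono_iota ?leqnn //.
rewrite EML_basis_ev ?mono_dup ?mono_iota ?leqnn //.
exact: (normal_dup ((normal_shuffle (@ev2_normal R X Y a' b)).1 _)).
Qed.

Lemma EML_basis_degenerater (a : simp X) (b : simp Y) : degenerate b -> EML_basis R a b = 0.
Proof.
move=> /degenerateP[b' [i [ib ->]]].
have iL : (i < size (iota 0 (sdim b').+1))%N by rewrite size_iota.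
rewrite -[b' in sdegen _ b']act_iota -(act_iota a) sdegen_act ?mono_iota ?leqnn //.
rewrite EML_basis_ev ?mono_dup ?mono_iota ?leqnn //.
exact: (normal_dup ((normal_shuffle (@ev2_normal R X Y a b')).2 _)).
Qed.

Definition EML (x : CN R X) (y : CN R Y) : CN R (sprod X Y) :=
  clift (fun a => clift (EML_basis R a) y) x.

Lemma EML_cbasl a (y : CN R Y) : EML (cbas R a) y = clift (EML_basis R a) y.
Proof.
apply: (clift_cbas (F := fun a => clift (EML_basis R a) y)) => {}a da.
apply: (nchains_linext (F := clift (EML_basis R a)) (G := fun=> 0)).
- by apply: clift_linear => b; apply: EML_basis_degenerater.
- exact: linear_zero.
- by move=> b; rewrite clift_cbas ?EML_basis_degeneratel // => b'; apply: EML_basis_degenerater.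
Qed.

Lemma EML_cbas a b : EML (cbas R a) (cbas R b) = EML_basis R a b.
Proof. by rewrite EML_cbasl clift_cbas // => b'; apply: EML_basis_degenerater. Qed.

Lemma EML_linearl y : linear (EML^~ y).
Proof.
apply: clift_linear => a da.
apply: (nchains_linext (F := clift (EML_basis R a)) (G := fun=> 0)).
- by apply: clift_linear => b; apply: EML_basis_degenerater.
- exact: linear_zero.
- by move=> b; rewrite clift_cbas ?EML_basis_degeneratel // => b'; apply: EML_basis_degenerater.
Qed.

Lemma EML_linearr x : linear (EML x).
Proof.
move=> r y y'.
apply: (nchains_linext (F := EML^~ (r *: y + y')) (G := fun x => r *: EML x y + EML x y')).
- exact: EML_linearl.
- exact: linear_add (linear_scale r (EML_linearl y)) (EML_linearl y').
- move=> a; rewrite !EML_cbasl; apply: clift_linear => b; exact: EML_basis_degenerater.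
Qed.

Lemma EML_bilin : bilin EML.
Proof. by split; [exact: EML_linearl|exact: EML_linearr]. Qed.

Let f := ctr_f (EZ R X Y).
Let g := ctr_g (EZ R X Y).
Let phi := ctr_phi (EZ R X Y).

Lemma EZ_f_linear : linear f. Proof. exact: clift_linear AW_basis_degenerate. Qed.
Lemma EZ_phi_linear : linear phi. Proof. exact: clift_linear SHI_basis_degenerate. Qed.
Lemma EZ_g_linear : linear g. Proof. exact: (tlift_linear EML_bilin). Qed.
Lemma EZ_g_tens x y : g (tens x y) = EML x y. Proof. exact: (tlift_tens EML_bilin). Qed.

Section Evaluation.
Variables (a : simp X) (b : simp Y).
Let e := ev2 R a b.
Let E s t : tensor (CN R X) (CN R Y) := tens (ev R a s : CN R X) (ev R b t : CN R Y).

Lemma f_ev L : mono2 a b L -> f (e L) = aw L E.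
Proof.
move=> mL; have [c [c1 c2 _ c4]] := ev2P R mL.
by rewrite /e c4 [LHS](clift_cbas AW_basis_degenerate) (AW_basis_ev R mL).
Qed.

Lemma phi_ev L : mono2 a b L -> phi (e L) = shi L e.
Proof.
move=> mL; have [c [c1 c2 _ c4]] := ev2P R mL.
by rewrite /e c4 [LHS](clift_cbas SHI_basis_degenerate) (SHI_basis_ev R mL).
Qed.

Lemma g_ev s t : mono 0 (sdim a) s -> mono 0 (sdim b) t -> g (E s t) = shuffle s t e.
Proof.
by move=> ms mt; rewrite /E EZ_g_tens /ev ms mt EML_cbas EML_basis_ev.
Qed.

Lemma E_normall t : normalized (E^~ t).
Proof. by move=> s1 x s2; rewrite /E ev_normal; apply: (lin0 (tens_linearl _)). Qed.
Lemma E_normalr s : normalized (E s).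
Proof. by move=> s1 x s2; rewrite /E ev_normal; apply: (lin0 (tens_linearr _)). Qed.

Lemma diff_E s t : mono 0 (sdim a) s -> mono 0 (sdim b) t ->
  diff (E s t : tensor_complex (CN R X) (CN R Y)) = bd_tens s t E.
Proof.
move=> ms mt; rewrite [LHS]tdiff_tens !diff_ev // ksign_ev.
have bd1E (W : lmodType R) r (h : seq nat -> W) : h [::] = 0 -> bd1 r h = bd r h.
  rewrite /bd1; case: ltnP => // r1 h0; case: r r1 => [|x []] // _; first by rewrite bd_nil.
  by rewrite bd_cons bd_nil h0 subr0.
rewrite (linZ (tens_linearl _)) (lin_bd (tens_linearl _)) (lin_bd (tens_linearr _)).
rewrite /bd_tens !bd1E //.
- by rewrite /E ev_nil (lin0 (tens_linearr _)).
- by rewrite /E ev_nil (lin0 (tens_linearl _)).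
Qed.
End Evaluation.

Lemma CN_bilin_ext (W : lmodType R) (B B' : CN R X -> CN R Y -> W) : bilin B -> bilin B' ->
  (forall a b, B (cbas R a) (cbas R b) = B' (cbas R a) (cbas R b)) ->
  forall x y, B x y = B' x y.
Proof.
move=> [Bl Br] [Bl' Br'] BB x y.
apply: (nchains_linext (F := B^~ y) (G := B'^~ y)) => // a.
exact: (nchains_linext (F := B (cbas R a)) (G := B' (cbas R a))).
Qed.

Lemma CN_tensor_ext (W : lmodType R) (F G : tensor (CN R X) (CN R Y) -> W) :
  linear F -> linear G ->
  (forall a b, F (tens (cbas R a : CN R X) (cbas R b : CN R Y)) =
    G (tens (cbas R a : CN R X) (cbas R b : CN R Y))) ->
  F =1 G.
Proof.
move=> Fl Gl FG; apply: tensor_linext => //; apply: CN_bilin_ext => //.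
- by split=> [y|x]; [exact: linear_comp Fl (tens_linearl y)|exact: linear_comp Fl (tens_linearr x)].
- by split=> [y|x]; [exact: linear_comp Gl (tens_linearl y)|exact: linear_comp Gl (tens_linearr x)].
Qed.

Section OnDiagonal.
Variable c : simp (sprod X Y).
Let a := simp_fst c.
Let b := simp_snd c.
Let L := diagonal (sdim c).
Let e := ev2 R a b.
Let E s t : tensor (CN R X) (CN R Y) := tens (ev R a s : CN R X) (ev R b t : CN R Y).
Let mL : mono_pairs (0, 0)%N (sdim a, sdim b) L := mono_diagonal c.

(** The empty list is the boundary of a one-vertex list, hence the condition on k. *)
Let bd_ev (W : lmodType R) (h : CN R (sprod X Y) -> W) (k : seq (nat * nat) -> W) : linear h ->
  k [::] = 0 -> (forall K, mono2 a b K -> h (e K) = k K) ->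
  h (diff (cbas R c : CN R (sprod X Y))) = bd L k.
Proof.
move=> hl k0 hk; rewrite -(ev2_diagonal c) -/L diff_ev2 // (lin_bd hl).
have sL : size L = (sdim c).+1 := size_diagonal _.
have [L1|] := ltnP 1 (size L); first exact: (eq_bd_mono mL L1 hk).
case: (L) sL => [|v [|w L']] // _ _; rewrite !bd_cons !bd_nil k0 [(h \o e) _]/comp.
by rewrite (_ : e [::] = 0) ?(lin0 hl).
Qed.

Lemma EZ_f_diff : f (diff (cbas R c : CN R (sprod X Y))) =
  diff (f (cbas R c) : tensor_complex (CN R X) (CN R Y)).
Proof.
rewrite (bd_ev EZ_f_linear (k := fun K => aw K E)); [|exact: aw_nil|by move=> K; apply: f_ev].
rewrite -(ev2_diagonal c) -/L f_ev // (lin_aw (@diff_linear R _)).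
rewrite (eq_aw_mono (E' := fun s t => bd_tens s t E) mL) => [|s t ms mt]; last exact: diff_E.
have [L1|] := ltnP 1 (size L); first by rewrite aw_bd.
case: (L) (size_diagonal (sdim c) : size L = _) => [|v [|w L']] //= _ _.
by rewrite !aw_cons !aw_nil bd_cons bd_nil aw_nil /bd_tens /bd1 /= scaler0 !addr0 subr0.
Qed.

Lemma EZ_homotopy : phi (diff (cbas R c : CN R (sprod X Y))) + diff (phi (cbas R c)) =
  g (f (cbas R c)) - cbas R c.
Proof.
rewrite (bd_ev EZ_phi_linear (k := fun K => shi K e)); [|exact: shi_nil|by move=> K; apply: phi_ev].
rewrite -(ev2_diagonal c) -/L phi_ev // f_ev // (lin_shi (@diff_linear R _)) (lin_aw EZ_g_linear).
rewrite (eq_shi_mono (e' := fun K => bd K e) mL) => [|K mK]; last exact: diff_ev2.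
rewrite (eq_aw_mono (E' := fun s t => shuffle s t e) mL) => [|s t ms mt]; last exact: g_ev.
have := size_diagonal (sdim c); rewrite -/L; case: (L) => // v L' _.
by rewrite [in LHS]addrC -shi_bd addrC.
Qed.

Lemma EZ_f_phi : f (phi (cbas R c)) = 0.
Proof.
rewrite -(ev2_diagonal c) -/L phi_ev // (lin_shi EZ_f_linear).
rewrite (eq_shi_mono (e' := fun K => aw K E) mL) => [|K mK]; last exact: f_ev.
by apply: shi_aw => s; [exact: E_normall|exact: E_normalr].
Qed.

Lemma EZ_phi_phi : phi (phi (cbas R c)) = 0.
Proof.
rewrite -(ev2_diagonal c) -/L phi_ev // (lin_shi EZ_phi_linear).
rewrite (eq_shi_mono (e' := fun K => shi K e) mL) => [|K mK]; last exact: phi_ev.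
by apply: shi_shi; apply: ev2_normal.
Qed.
End OnDiagonal.

Lemma EML_cbas_shuffle (a : simp X) (b : simp Y) : EML (cbas R a) (cbas R b) =
  shuffle (iota 0 (sdim a).+1) (iota 0 (sdim b).+1) (ev2 R a b).
Proof. by rewrite EML_cbas -{1}(act_iota a) -{1}(act_iota b) EML_basis_ev ?mono_iota ?leqnn. Qed.

Lemma EZ_fg a b (x := tens (cbas R a : CN R X) (cbas R b : CN R Y)) : f (g x) = x.
Proof.
pose lo : nat * nat := (0, 0)%N; pose hi := (sdim a, sdim b).
have ma : mono lo.1 hi.1 (iota 0 (sdim a).+1) by rewrite mono_iota !leqnn.
have mb : mono lo.2 hi.2 (iota 0 (sdim b).+1) by rewrite mono_iota !leqnn.
rewrite EZ_g_tens EML_cbas_shuffle (lin_shuffle EZ_f_linear).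
rewrite (eq_shuffle_mono ma mb (fun K => @f_ev a b K)) shuffle_aw /=.
- by rewrite !ev_iota.
- exact: E_normall.
- exact: E_normalr.
Qed.

Lemma EZ_phi_g a b : phi (g (tens (cbas R a : CN R X) (cbas R b : CN R Y))) = 0.
Proof.
pose lo : nat * nat := (0, 0)%N; pose hi := (sdim a, sdim b).
have ma : mono lo.1 hi.1 (iota 0 (sdim a).+1) by rewrite mono_iota !leqnn.
have mb : mono lo.2 hi.2 (iota 0 (sdim b).+1) by rewrite mono_iota !leqnn.
rewrite EZ_g_tens EML_cbas_shuffle (lin_shuffle EZ_phi_linear).
rewrite (eq_shuffle_mono ma mb (fun K => @phi_ev a b K)) shuffle_shi //.
exact: ev2_normal.
Qed.

Theorem EZ_contraction : is_contraction (EZ R X Y).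
Proof.
have fl := EZ_f_linear; have gl := EZ_g_linear; have pl := EZ_phi_linear.
have dl (C : chain_complex R) : linear (@diff R C) by exact: diff_linear.
split=> //.
- apply: nchains_linext; [exact: linear_comp fl (dl _)|exact: linear_comp (dl _) fl|].
  exact: EZ_f_diff.
- by apply: CN_tensor_ext; [exact: linear_comp fl gl|by []|exact: EZ_fg].
- apply: nchains_linext.
  + exact: linear_add (linear_comp pl (dl _)) (linear_comp (dl _) pl).
  + exact: linear_sub (linear_comp gl fl) (@linear_id _ _).
  + exact: EZ_homotopy.
- by apply: CN_tensor_ext; [exact: linear_comp pl gl|exact: linear_zero|exact: EZ_phi_g].
- by apply: nchains_linext; [exact: linear_comp fl pl|exact: linear_zero|exact: EZ_f_phi].
- by apply: nchains_linext; [exact: (linear_comp pl pl)|exact: linear_zero|exact: EZ_phi_phi].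
Qed.
End EilenbergZilberTheorem.

(** * Contractions of iterated tensor products *)
Section ContractionTheory.
Variable R : comNzRingType.

(** By the homotopy identity g f commutes with d; then d g = d g f g = g f d g = g d f g = g d. *)
Lemma ctr_g_diff (N M : chain_complex R) (c : contraction_data N M) : is_contraction c ->
  forall y, ctr_g c (diff y) = diff (ctr_g c y).
Proof.
case=> fl gl pl fd fg hom pg fp pp y.
have dgf x : diff (ctr_g c (ctr_f c x)) = ctr_g c (ctr_f c (diff x)).
  have e1 := hom x; have e2 := hom (diff x).
  have {e1} -> : ctr_g c (ctr_f c x) = ctr_phi c (diff x) + diff (ctr_phi c x) + x.
    by rewrite e1 subrK.
  have {e2} -> : ctr_g c (ctr_f c (diff x)) = ctr_phi c (diff (diff x)) + diff (ctr_phi c (diff x)) + diff x.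
    by rewrite e2 subrK.
  by rewrite !linearD /= !diffK (lin0 pl) add0r addr0.
by rewrite -{2}[y]fg dgf fd fg.
Qed.

Lemma id_is_contraction (N : chain_complex R) : is_contraction (id_contraction N).
Proof.
split=> //=; first by move=> a u v; rewrite scaler0 addr0.
by move=> x; rewrite linear0 addr0 subrr.
Qed.

Lemma comp_is_contraction (N1 N2 M2 : chain_complex R)
    (c1 : contraction_data N1 N2) (c2 : contraction_data N2 M2) :
  is_contraction c1 -> is_contraction c2 -> is_contraction (comp_contraction c1 c2).
Proof.
move=> ct1 ct2; have gd1 := ctr_g_diff ct1.
case: ct1 ct2 => fl1 gl1 pl1 fd1 fg1 hom1 pg1 fp1 pp1 [fl2 gl2 pl2 fd2 fg2 hom2 pg2 fp2 pp2].
split=> /=.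
- exact: linear_comp fl2 fl1.
- exact: linear_comp gl1 gl2.
- exact: linear_add pl1 (linear_comp gl1 (linear_comp pl2 fl1)).
- by move=> x; rewrite fd1 fd2.
- by move=> y; rewrite fg1 fg2.
- move=> x; rewrite linearD /= addrACA hom1 -gd1 -(linD gl1) fd1 hom2 (linB gl1); abelian.
- by move=> y; rewrite pg1 fg1 pg2 (lin0 gl1) addr0.
- by move=> x; rewrite (linD fl1) fp1 fg1 add0r fp2.
- by move=> x; rewrite !(linD pl1, linD fl1) pp1 pg1 fp1 fg1 !add0r pp2 (lin0 gl1).
Qed.

Section TensorId.
Variables (C N M : chain_complex R) (c : contraction_data N M).
Hypothesis ct : is_contraction c.
Let f := ctr_f c.
Let g := ctr_g c.
Let phi := ctr_phi c.
Let ct1 := tensor_contraction (id_contraction C) c.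

Lemma tens_map_bilin (U : chain_complex R) (V : chain_complex R) (h : U -> V) : linear h ->
  bilin (fun (x : C) (y : U) => tens x (h y)).
Proof.
by move=> hl; split=> [y|x]; [exact: tens_linearl|exact: (linear_comp (tens_linearr x) hl)].
Qed.

Let fB : bilin (fun (x : C) (y : N) => tens x (f y)).
Proof. exact/tens_map_bilin/(ctr_f_linear ct). Qed.
Let gB : bilin (fun (x : C) (y : M) => tens x (g y)).
Proof. exact/tens_map_bilin/(ctr_g_linear ct). Qed.
Let phiB : bilin (fun (x : C) (y : N) => tens (0 : C) (g (f y)) + tens (ksign x) (phi y)).
Proof.
have z y : tens (0 : C) (g (f y)) = 0 by apply: (lin0 (tens_linearl _)).
split=> [y a x x'|x a y y'] /=; rewrite !z !add0r.
  by rewrite ksign_linear (tens_bilin C N).1.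
by rewrite /phi (ctr_phi_linear ct) (tens_bilin C N).2.
Qed.

Lemma tensor_f x y : ctr_f ct1 (tens x y) = tens x (f y).
Proof. exact: (tlift_tens fB). Qed.
Lemma tensor_g x y : ctr_g ct1 (tens x y) = tens x (g y).
Proof. exact: (tlift_tens gB). Qed.
Lemma tensor_phi x y : ctr_phi ct1 (tens x y) = tens (ksign x) (phi y).
Proof.
rewrite -[RHS]add0r -[X in X + _](lin0 (tens_linearl (g (f y)))).
exact: (tlift_tens phiB).
Qed.

Lemma tensor_id_contraction : is_contraction ct1.
Proof.
have fl : linear (ctr_f ct1) := tlift_linear fB.
have gl : linear (ctr_g ct1) := tlift_linear gB.
have pl : linear (ctr_phi ct1) := tlift_linear phiB.
have dl (D : chain_complex R) : linear (@diff R D) by exact: diff_linear.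
have tdE (D D' : chain_complex R) (x : D) (y : D') :
  diff (tens x y : tensor_complex D D') = tens (diff x) y + tens (ksign x) (diff y).
  exact: tdiff_tens.
case: ct => fl' gl' pl' fd fg hom pg fp pp.
rewrite -/f -/g -/phi in fl' gl' pl' fd fg hom pg fp pp.
split=> //.
- apply: tensor_linext; [exact: (linear_comp fl (dl _))|exact: (linear_comp (dl _) fl)|move=> x y].
  by rewrite /comp tdE (linD fl) !tensor_f tdE fd.
- apply: tensor_linext; [exact: (linear_comp fl gl)|exact: linear_id|move=> x y].
  by rewrite /comp tensor_g tensor_f fg.
- apply: tensor_linext.
  + exact: linear_add (linear_comp pl (dl _)) (linear_comp (dl _) pl).
  + exact: linear_sub (linear_comp gl fl) (@linear_id _ _).
  move=> x y; rewrite /comp tdE (linD pl) !tensor_phi tdE tensor_f tensor_g !ksignK.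
  rewrite diff_ksign (linN (tens_linearl _)) addrACA subrr add0r.
  rewrite -(linD (tens_linearr _)) hom; exact: (linB (tens_linearr _)).
- apply: tensor_linext; [exact: (linear_comp pl gl)|exact: linear_zero|move=> x y].
  by rewrite /comp tensor_g tensor_phi pg (lin0 (tens_linearr _)).
- apply: tensor_linext; [exact: (linear_comp fl pl)|exact: linear_zero|move=> x y].
  by rewrite /comp tensor_phi tensor_f fp (lin0 (tens_linearr _)).
- apply: tensor_linext; [exact: (linear_comp pl pl)|exact: linear_zero|move=> x y].
  by rewrite /comp !tensor_phi pp (lin0 (tens_linearr _)).
Qed.
End TensorId.

Lemma EZpow_contraction (X : sset) k : is_contraction (EZpow R X k).
Proof.
elim: k => [|[|k] IH]; first exact: id_is_contraction.
  exact: EZ_contraction.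
exact: comp_is_contraction (EZ_contraction _ _ _) (tensor_id_contraction _ IH).
Qed.

Lemma EZpow_g_tens (X : sset) k (x : CN R X) w :
  ctr_g (EZpow R X k.+1) (tens x w) = EML x (ctr_g (EZpow R X k) w).
Proof.
case: k w => [|k] w; first exact: EZ_g_tens.
transitivity (ctr_g (EZ R X (spow X k.+1))
  (ctr_g (tensor_contraction (id_contraction (CN R X)) (EZpow R X k.+1)) (tens x w))) => //.
rewrite (tensor_g (EZpow_contraction X k.+1)).
exact: EZ_g_tens.
Qed.
End ContractionTheory.

(** * The higher diagonals of a contraction with cyclic symmetry *)
Section HigherDiagonals.
Variables (R : comNzRingType) (A N M : chain_complex R) (c : contraction_data N M).
Variables (k : nat) (t : N -> N) (T : M -> M) (Delta : A -> N).
Hypothesis ct : is_contraction c.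
Hypothesis t_lin : linear t.
Hypothesis t_diff : forall z, t (diff z) = diff (t z).
Hypothesis D_diff : forall x, Delta (diff x) = diff (Delta x).
Hypothesis t_iter : forall z, iter k.+1 t z = z.
Hypothesis t_g : forall y, t (ctr_g c y) = ctr_g c (T y).
Hypothesis t_D : forall x, t (Delta x) = Delta x.

Let f := ctr_f c.
Let g := ctr_g c.
Let phi := ctr_phi c.
Definition cyc_gamma (i : nat) z := if odd i then t z else \sum_(1 <= j < k.+1) iter j t z.
Definition cyc_alpha (i : nat) w := if odd i then T w - w else \sum_(0 <= j < k.+1) iter j T w.
Fixpoint cyc_E (i : nat) (x : A) : N :=
  if i is i'.+1 then cyc_gamma i (phi (cyc_E i' x)) else Delta x.

Let Nm z := \sum_(0 <= j < k.+1) iter j t z.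

Let iter_lin j : linear (iter j t).
Proof. by elim: j => // j IH; apply: (linear_comp t_lin IH). Qed.

Let linear_sumf (U V : lmodType R) (r : seq nat) (F : nat -> U -> V) :
  (forall j, linear (F j)) -> linear (fun z => \sum_(j <- r) F j z).
Proof.
move=> Fl a u v; rewrite scaler_sumr -big_split; apply: eq_bigr => j _; exact: Fl.
Qed.

Let gamma_lin i : linear (cyc_gamma i).
Proof. by rewrite /cyc_gamma; case: odd => //; apply: linear_sumf => j. Qed.

Let Nm_lin : linear Nm. Proof. by apply: linear_sumf => j. Qed.

Let gamma_diff i z : cyc_gamma i (diff z) = diff (cyc_gamma i z).
Proof.
have itd j : iter j t (diff z) = diff (iter j t z) by elim: j => //= j ->.
rewrite /cyc_gamma; case: odd => //; rewrite linear_sum; apply: eq_bigr => j _; exact: itd.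
Qed.

Let NmE i z : ~~ odd i -> cyc_gamma i z = Nm z - z.
Proof.
by move=> /negbTE e; rewrite /cyc_gamma e /Nm [in RHS]big_ltn //= [in RHS]addrC addKr.
Qed.

Let t_Nm z : t (Nm z) = Nm z.
Proof.
rewrite /Nm (lin_sum t_lin) big_nat_recr // [RHS]big_ltn //= -[t (iter k t z)]/(iter k.+1 t z).
by rewrite t_iter addrC; congr (_ + _); rewrite big_add1.
Qed.

Let Nm_t z : Nm (t z) = Nm z.
Proof.
by rewrite -[RHS]t_Nm /Nm (lin_sum t_lin); apply: eq_bigr => j _; rewrite -iterSr.
Qed.

Let iter_g j y : iter j t (g y) = g (iter j T y).
Proof. by elim: j => //= j ->; apply: t_g. Qed.

Let phi_gamma_g i y : phi (cyc_gamma i (g y)) = 0.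
Proof.
have pl : linear phi := ctr_phi_linear ct.
rewrite /cyc_gamma; case: odd; first by rewrite t_g; apply: (ctr_phi_g ct).
by rewrite (lin_sum pl) big1 // => j _; rewrite iter_g; apply: (ctr_phi_g ct).
Qed.

(* What d E_i contains besides gamma_i g f E_(i-1) and the term in d. *)
Let B i x := if i is i'.+1 then
    if odd i then (if i' is j.+1 then - Nm (phi (cyc_E j x)) else - Delta x)
    else if i' is j.+1 then t (phi (cyc_E j x)) - phi (cyc_E j x) else 0
  else 0.

Let phi_B i x : phi (B i.+1 x) = if odd i then phi (cyc_E i x) else - phi (cyc_E i x).
Proof.
have pl : linear phi := ctr_phi_linear ct; have pp : forall z, phi (phi z) = 0 := ctr_phi_phi ct.
case: i => [|i]; first exact: (linN pl).
rewrite [B _ _]/= negbK; case: ifP => /= oi.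
  have e z : Nm z = cyc_gamma i.+1 z + z by rewrite NmE /= ?oi // subrK.
  by rewrite (linN pl) e (linD pl) pp addr0 oi.
by rewrite (linB pl) pp subr0 oi /cyc_gamma /= oi.
Qed.

(* In the induction step the first term of the induction hypothesis disappears, as
phi gamma_i g = phi g gamma_i(T) = 0; what remains is the recursion
B_(i+1) = - gamma_(i+1) (E_i + phi B_i), which phi_B and the norm identities solve. *)
Let E_diff i x : diff (cyc_E i.+1 x) =
  cyc_gamma i.+1 (g (f (cyc_E i x))) + (-1) ^+ i.+1 *: cyc_E i.+1 (diff x) + B i.+1 x.
Proof.
have pl : linear phi := ctr_phi_linear ct.
have dphi z : diff (phi z) = g (f z) - z - phi (diff z) by rewrite -(ctr_homotopy ct) addrAC subrr add0r.
have gB i' z : odd i' = false -> cyc_gamma i' (t z - z) = z - t z.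
  by move=> oi; rewrite NmE ?oi // (linB Nm_lin) Nm_t; abelian.
elim: i => [|i IH].
  rewrite /= -gamma_diff dphi !(linB (gamma_lin 1)) -D_diff expr1 scaleN1r.
  by rewrite -[cyc_gamma 1 (Delta x)]/(t (Delta x)) t_D; abelian.
rewrite [cyc_E i.+2 x]/= -gamma_diff dphi IH !(linD pl, linZ pl) phi_gamma_g add0r phi_B.
have gl := gamma_lin i.+2; set z := phi (cyc_E i x).
rewrite opprD !(linD gl, linN gl, linZ gl) -/z.
rewrite -[cyc_gamma i.+2 (phi (cyc_E i.+1 _))]/(cyc_E i.+2 (diff x)).
have -> : B i.+2 x = - cyc_gamma i.+2 (cyc_gamma i.+1 z) - cyc_gamma i.+2 (if odd i then z else - z).
  rewrite [B _ _]/= negbK -/z; case: ifP => oi.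
    by rewrite [cyc_gamma i.+1 z]NmE /= ?oi // /cyc_gamma /= oi /= (linB t_lin) t_Nm; abelian.
  rewrite [cyc_gamma i.+1 z]/cyc_gamma /= oi /= !NmE /= ?negbK ?oi // (linN Nm_lin) Nm_t; abelian.
rewrite [in RHS]exprS mulN1r scaleNr; abelian.
Qed.

(** The identities f phi = 0 and f t^j g = T^j turn the formula for d E_i into one for D_i. *)
Theorem cyc_D_diff i x : diff (f (cyc_E i x)) + (-1) ^+ i.+1 *: f (cyc_E i (diff x)) =
  if i is i'.+1 then cyc_alpha i (f (cyc_E i' x)) else 0.
Proof.
have fl : linear f := ctr_f_linear ct; have fd z : f (diff z) = diff (f z) := ctr_f_diff ct z.
have fp z : f (phi z) = 0 := ctr_f_phi ct z; have fg y : f (g y) = y := ctr_fg ct y.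
case: i => [|i]; first by rewrite /= -fd -D_diff expr1 scaleN1r subrr.
rewrite -fd E_diff !(linD fl, linZ fl) [(-1) ^+ i.+2]exprS mulN1r scaleNr addrAC addrK.
rewrite /cyc_alpha [odd _]/= [B _ _]/=; set w := f (cyc_E i x).
case: ifP => oi.
  rewrite /cyc_gamma /= oi t_g fg; congr (_ + _).
  case: i oi @w => [|i] oi w; first exact: (linN fl).
  rewrite /= negbK in oi; have e z : Nm z = cyc_gamma i.+1 z + z by rewrite NmE /= ?oi // subrK.
  by rewrite (linN fl) e (linD fl) fp addr0.
have -> : f (cyc_gamma i.+1 (g w)) = \sum_(1 <= j < k.+1) iter j T w.
  rewrite /cyc_gamma /= oi (lin_sum fl); apply: eq_bigr => j _; by rewrite iter_g fg.
rewrite [RHS]big_ltn //= addrC; congr (_ + _).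
case: i oi @w => [|i] // oi w; rewrite /= negbK in oi.
by rewrite (linB fl) fp subr0 /w /= /cyc_gamma /= oi.
Qed.
End HigherDiagonals.

(** * Naturality, symmetry and associativity of the shuffle map *)
Section SimplicialMaps.
Variable R : comNzRingType.

Definition simplicial (X Y : sset) (F : forall n, X n -> Y n) :=
  (forall n i (x : X n.+1), F n (face i x) = face i (F n.+1 x)) /\
  (forall n i (x : X n), F n.+1 (degen i x) = degen i (F n x)).

Definition simp_map (X Y : sset) (F : forall n, X n -> Y n) (x : simp X) : simp Y :=
  Simp (F _ (projT2 x)).

Definition chain_map (X Y : sset) (F : forall n, X n -> Y n) : CN R X -> CN R Y :=
  clift (fun x => cbas R (simp_map F x)).

Section InducedMap.
Variables (X Y : sset) (F : forall n, X n -> Y n).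
Hypothesis Fs : simplicial F.

Lemma simp_map_sface i x : simp_map F (sface i x) = sface i (simp_map F x).
Proof. by case: x => -[|n] y //; rewrite /simp_map /= Fs.1. Qed.
Lemma simp_map_sdegen i x : simp_map F (sdegen i x) = sdegen i (simp_map F x).
Proof. by case: x => n y; rewrite /simp_map /= Fs.2. Qed.

Lemma simp_map_act s x : simp_map F (act s x) = act s (simp_map F x).
Proof.
rewrite !actE -[sdim (simp_map F x)]/(sdim x).
move: (sdim x).+1 (rev s) => n r; elim: n r x => // m IHm.
elim=> [|c r IHr] x /=; first by rewrite IHm simp_map_sface.
case: ifP => _; last by rewrite IHm simp_map_sface.
by case: ifP => _; rewrite ?IHm // simp_map_sdegen IHr.
Qed.

Lemma chain_map_degenerate x : degenerate x -> cbas R (simp_map F x) = 0.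
Proof. by move=> /degenerateP[z [i [_ ->]]]; rewrite simp_map_sdegen sdegen_cbas. Qed.

Lemma chain_map_linear : linear (chain_map F).
Proof. exact: clift_linear chain_map_degenerate. Qed.

Lemma chain_map_cbas x : chain_map F (cbas R x) = cbas R (simp_map F x).
Proof. exact: (clift_cbas chain_map_degenerate). Qed.

Lemma chain_map_diff z : chain_map F (diff z) = diff (chain_map F z).
Proof.
have dl (C : chain_complex R) : linear (@diff R C) by exact: diff_linear.
move: z; apply: nchains_linext.
- exact: (linear_comp chain_map_linear (dl _)).
- exact: (linear_comp (dl _) chain_map_linear).
move=> x; rewrite /comp chain_map_cbas !ndiff_cbas_sface -[sdim (simp_map F x)]/(sdim x).
case: ifP => _; first exact: (lin0 chain_map_linear).
rewrite (lin_sum chain_map_linear); apply: eq_bigr => i _.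
by rewrite (linZ chain_map_linear) chain_map_cbas simp_map_sface.
Qed.
End InducedMap.

Lemma chain_map_comp (X Y Z : sset) (F : forall n, Y n -> Z n) (G : forall n, X n -> Y n) z :
  simplicial F -> simplicial G ->
  chain_map F (chain_map G z) = chain_map (fun n x => F n (G n x)) z.
Proof.
move=> Fs Gs; have FGs : simplicial (fun n x => F n (G n x)).
  by split=> n i x; rewrite ?Gs.1 ?Gs.2 ?Fs.1 ?Fs.2.
move: z; apply: nchains_linext; last by move=> x; rewrite !chain_map_cbas.
- exact: (linear_comp (chain_map_linear Fs) (chain_map_linear Gs)).
- exact: chain_map_linear.
Qed.

Lemma chain_map_id (X : sset) (F : forall n, X n -> X n) : (forall n x, F n x = x) ->
  forall z, chain_map F z = z.
Proof.
move=> Fid; have Fs : simplicial F by split=> n i x; rewrite !Fid.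
apply: nchains_linext; [exact: chain_map_linear|exact: linear_id|move=> -[n x]].
by rewrite chain_map_cbas // /simp_map /= Fid.
Qed.

Lemma eq_chain_map (X Y : sset) (F G : forall n, X n -> Y n) : simplicial F ->
  (forall n x, F n x = G n x) -> chain_map F =1 chain_map G.
Proof.
move=> Fs FG; have Gs : simplicial G by split=> n i x; rewrite -!FG ?Fs.1 ?Fs.2.
apply: nchains_linext; [exact: chain_map_linear|exact: chain_map_linear|move=> -[n x]].
by rewrite !chain_map_cbas // /simp_map /= FG.
Qed.

Definition prod_map (X Y X' Y' : sset) (F : forall n, X n -> X' n) (G : forall n, Y n -> Y' n)
  n (w : sprod X Y n) : sprod X' Y' n := (F n w.1, G n w.2).
Definition swap_map (X Y : sset) n (w : sprod X Y n) : sprod Y X n := (w.2, w.1).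
Definition assoc_map (X Y Z : sset) n (w : sprod (sprod X Y) Z n) : sprod X (sprod Y Z) n :=
  (w.1.1, (w.1.2, w.2)).

Lemma prod_map_simplicial (X Y X' Y' : sset) (F : forall n, X n -> X' n) (G : forall n, Y n -> Y' n) :
  simplicial F -> simplicial G -> simplicial (prod_map F G).
Proof.
by move=> Fs Gs; split=> n i [x y]; rewrite /prod_map /= ?Fs.1 ?Fs.2 ?Gs.1 ?Gs.2.
Qed.
Lemma swap_map_simplicial X Y : simplicial (@swap_map X Y).
Proof. by split=> n i []. Qed.
Lemma assoc_map_simplicial X Y Z : simplicial (@assoc_map X Y Z).
Proof. by split=> n i [[]]. Qed.

Lemma fst_simplicial (X Y : sset) : simplicial (fun n (w : sprod X Y n) => w.1).
Proof. by split. Qed.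
Lemma snd_simplicial (X Y : sset) : simplicial (fun n (w : sprod X Y n) => w.2).
Proof. by split. Qed.
Lemma simp_fst_act (X Y : sset) s (c : simp (sprod X Y)) : simp_fst (act s c) = act s (simp_fst c).
Proof. exact: (simp_map_act (@fst_simplicial X Y)). Qed.
Lemma simp_snd_act (X Y : sset) s (c : simp (sprod X Y)) : simp_snd (act s c) = act s (simp_snd c).
Proof. exact: (simp_map_act (@snd_simplicial X Y)). Qed.

Lemma EML_natural (X Y X' Y' : sset) (F : forall n, X n -> X' n) (G : forall n, Y n -> Y' n) x y :
  simplicial F -> simplicial G ->
  chain_map (prod_map F G) (EML x y) = EML (chain_map F x) (chain_map G y).
Proof.
move=> Fs Gs; have Fl := chain_map_linear Fs; have Gl := chain_map_linear Gs.
have FGs := prod_map_simplicial Fs Gs; have FGl := chain_map_linear FGs.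
apply: (CN_bilin_ext (B := fun x y => chain_map (prod_map F G) (EML x y))
  (B' := fun x y => EML (chain_map F x) (chain_map G y))).
- by split=> [{}y|{}x]; [exact: (linear_comp FGl (EML_linearl y))|exact: (linear_comp FGl (EML_linearr x))].
- split=> [{}y|{}x]; first exact: (linear_comp (EML_linearl _) Fl).
  exact: (linear_comp (EML_linearr _) Gl).
move=> a b; rewrite !chain_map_cbas // !EML_cbas_shuffle (lin_shuffle FGl).
congr shuffle; apply/funext => L; rewrite /comp.
have mE : mono2 (simp_map F a) (simp_map G b) L = mono2 a b L by [].
have [mL|mL] := boolP (mono2 a b L); last first.
  by rewrite /ev2 mE (negbTE mL) (lin0 FGl).
have [c [c1 c2 _ c4]] := ev2P R mL; rewrite c4 chain_map_cbas //.
rewrite {1}/ev2 mE mL -!simp_map_act // -c1 -c2 -cross_cbas.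
by case: (c) => n [].
Qed.

(** Reflecting a path exchanges the steps along the two lists, hence all pairs of steps
are inverted: the sign is that of m n. *)
Lemma EML_swap (X Y : sset) m n (x : CN R X) (y : CN R Y) :
  chain_map (@swap_map X Y) (EML (hcomp m x) (hcomp n y)) =
  (-1) ^+ (m * n) *: EML (hcomp n y) (hcomp m x).
Proof.
have sl := chain_map_linear (swap_map_simplicial X Y).
have hl (C : chain_complex R) i : linear (@hcomp R C i) by exact: hcomp_linear.
apply: (CN_bilin_ext (B := fun x y => chain_map (@swap_map X Y) (EML (hcomp m x) (hcomp n y)))
  (B' := fun x y => (-1) ^+ (m * n) *: EML (hcomp n y) (hcomp m x))).
- split=> [{}y|{}x]; first exact: (linear_comp sl (linear_comp (EML_linearl _) (hl _ _))).
  exact: (linear_comp sl (linear_comp (EML_linearr _) (hl _ _))).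
- split=> [{}y|{}x]; apply: linear_scale.
    exact: (linear_comp (EML_linearr _) (hl _ _)).
  exact: (linear_comp (EML_linearl _) (hl _ _)).
move=> a b; have hE (Z : sset) i (z : simp Z) :
    hcomp i (cbas R z : CN R Z) = if sdim z == i then cbas R z else 0 := nhcomp_cbas _ _ _.
rewrite !hE; case: eqP => [am|_]; last first.
  by rewrite (lin0 (EML_linearl _)) (lin0 (EML_linearr _)) scaler0 (lin0 sl).
case: eqP => [bn|_]; last first.
  by rewrite (lin0 (EML_linearl _)) (lin0 (EML_linearr _)) scaler0 (lin0 sl).
rewrite !EML_cbas_shuffle (lin_shuffle sl) shuffle_swap !size_iota /= am bn.
congr (_ *: shuffle _ _ _); apply/funext => L; rewrite /comp.
have zs : (unzip1 (map swap L) = unzip2 L) * (unzip2 (map swap L) = unzip1 L).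
  by rewrite /unzip1 /unzip2 -!map_comp.
have [mL|mL] := boolP (mono2 a b (map swap L)); last first.
  rewrite {1}/ev2 (negbTE mL) (lin0 sl) /ev2 /mono2 andbC -[X in X && _]/(mono 0 _ _).
  by move: mL; rewrite /mono2 !zs => /negbTE->.
have [c [c1 c2 _ c4]] := ev2P R mL; rewrite c4 chain_map_cbas; last exact: swap_map_simplicial.
rewrite /ev2 /mono2 andbC; move: mL c1 c2; rewrite /mono2 !zs => -> <- <-.
by rewrite -cross_cbas; case: (c) => k [].
Qed.

(** The simplex d of a product whose vertices are the pairs in L is shuffled with c in
the same way as the list L itself, by naturality of the lattice paths; associativity
then reduces to that of lattice paths. *)
Section Associativity.
Variables (X Y Z : sset).

(** As for cross, but with values in simplices: there is none when the dimensions
differ. *)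
Definition pair_simp (U V : sset) (a : simp U) (b : simp V) : option (simp (sprod U V)) :=
  let: existT m x := a in let: existT n y := b in
  match @eqP _ m n with
  | ReflectT e => Some (Simp (X := sprod U V) (eq_rect m U x n e, y))
  | ReflectF _ => None
  end.

Lemma pair_simpE (U V : sset) (c : simp (sprod U V)) : pair_simp (simp_fst c) (simp_snd c) = Some c.
Proof.
case: c => m [x y]; rewrite /simp_fst /simp_snd /pair_simp /=.
by case: eqP => // e; rewrite (eq_irrelevance e (erefl m)).
Qed.

Variables (a : simp X) (b : simp Y) (c : simp Z).

Definition ev3 (M : seq (nat * (nat * nat))) : CN R (sprod X (sprod Y Z)) :=
  let s := map fst M in let t := map (fst \o snd) M in let u := map (snd \o snd) M in
  if [&& mono 0 (sdim a) s, mono 0 (sdim b) t & mono 0 (sdim c) u] then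
    oapp (fun q => cbas R q) 0 (obind (pair_simp (act s a)) (pair_simp (act t b) (act u c)))
  else 0.

Lemma ev3_cbas q M : let s := map fst M in let t := map (fst \o snd) M in let u := map (snd \o snd) M in
  mono 0 (sdim a) s -> mono 0 (sdim b) t -> mono 0 (sdim c) u ->
  simp_fst q = act s a -> simp_fst (simp_snd q) = act t b -> simp_snd (simp_snd q) = act u c ->
  ev3 M = cbas R q.
Proof.
move=> s t u ms mt mu qa qb qc; rewrite /ev3 -/s -/t -/u ms mt mu.
by rewrite -qa -qb -qc pair_simpE [obind _ _]pair_simpE.
Qed.

Lemma nth_unzip (L : seq (nat * nat)) i : (i < size L)%N ->
  ((nth (0, 0)%N L i).1 = nth 0%N (unzip1 L) i) * ((nth (0, 0)%N L i).2 = nth 0%N (unzip2 L) i).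
Proof. by move=> iL; rewrite !(nth_map (0, 0)%N). Qed.

Lemma map_nth_unzip (L : seq (nat * nat)) n s : mono 0 n s -> (n < size L)%N ->
  (map (fst \o nth (0, 0)%N L) s = map (nth 0%N (unzip1 L)) s) *
  (map (snd \o nth (0, 0)%N L) s = map (nth 0%N (unzip2 L)) s).
Proof.
move=> /and3P[_ _ /allP al] nL; split; apply/eq_in_map => i /al /= iL; rewrite nth_unzip //;
exact: leq_ltn_trans iL nL.
Qed.

Let ml : mono 0 (sdim a) (iota 0 (sdim a).+1). Proof. by rewrite mono_iota !leqnn. Qed.
Let mr : mono 0 (sdim b) (iota 0 (sdim b).+1). Proof. by rewrite mono_iota !leqnn. Qed.
Let mc : mono 0 (sdim c) (iota 0 (sdim c).+1). Proof. by rewrite mono_iota !leqnn. Qed.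

Lemma shuffle_ev2_left (d : simp (sprod X Y)) L : mono2 a b L ->
  simp_fst d = act (unzip1 L) a -> simp_snd d = act (unzip2 L) b ->
  chain_map (@assoc_map X Y Z) (EML (cbas R d) (cbas R c)) =
  shuffle L (iota 0 (sdim c).+1) (ev3 \o map reassoc).
Proof.
move=> mL d1 d2; have /andP[m1 m2] := mL.
have al := chain_map_linear (@assoc_map_simplicial X Y Z).
have L0 : (0 < size L)%N by rewrite -(size_map fst) lt0n size_eq0; case/and3P: m1.
have sd : (sdim d).+1 = size L.
  by rewrite -[sdim d]/(sdim (simp_fst d)) d1 sdim_act // size_map prednK.
rewrite EML_cbas_shuffle (lin_shuffle al) sd.
have -> : shuffle L (iota 0 (sdim c).+1) (ev3 \o map reassoc) =
  shuffle (map (nth (0, 0)%N L) (iota 0 (size L))) (map id (iota 0 (sdim c).+1)) (ev3 \o map reassoc).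
  by rewrite map_id map_nth_iota0 // take_size.
rewrite shuffle_map -sd.
pose lo : nat * nat := (0, 0)%N; pose hi := (sdim d, sdim c).
apply: (@eq_shuffle_mono _ _ lo hi) => // [|K mK]; first by rewrite mono_iota !leqnn.
have /andP[k1 k2] := mK; rewrite /comp.
have [q [q1 q2 _ q4]] := ev2P R (mK : mono2 d c K); rewrite q4.
rewrite chain_map_cbas; last exact: assoc_map_simplicial.
have dL : (sdim d < size L)%N by rewrite sd.
have dL1 : (sdim d < size (unzip1 L))%N by rewrite size_map.
have dL2 : (sdim d < size (unzip2 L))%N by rewrite size_map.
pose M := map reassoc (map (fun v => (nth (0, 0)%N L v.1, id v.2)) K).
have M1 : map fst M = map (nth 0%N (unzip1 L)) (unzip1 K).
  by rewrite -(map_nth_unzip k1 dL).1 /M /unzip1 -!map_comp; apply: eq_map.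
have M2 : map (fst \o snd) M = map (nth 0%N (unzip2 L)) (unzip1 K).
  by rewrite -(map_nth_unzip k1 dL).2 /M /unzip1 -!map_comp; apply: eq_map.
have M3 : map (snd \o snd) M = unzip2 K.
  by rewrite /M /unzip2 -!map_comp; apply: eq_map.
have k1' : mono 0 (size (unzip1 L)).-1 (unzip1 K) by rewrite size_map -sd.
have k2' : mono 0 (size (unzip2 L)).-1 (unzip1 K) by rewrite size_map -sd.
rewrite -/M; apply/esym; apply: ev3_cbas; rewrite ?M1 ?M2 ?M3 //.
- exact: mono_map m1 k1 dL1.
- exact: mono_map m2 k1 dL2.
- by rewrite -act_act // -d1 -[simp_fst (simp_map _ _)]/(simp_fst (simp_fst q)) q1 -simp_fst_act.
- by rewrite -act_act // -d2 -[simp_fst (simp_snd _)]/(simp_snd (simp_fst q)) q1 -simp_snd_act.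
Qed.

Lemma shuffle_ev2_right (d : simp (sprod Y Z)) L : mono2 b c L ->
  simp_fst d = act (unzip1 L) b -> simp_snd d = act (unzip2 L) c ->
  EML (cbas R a) (cbas R d) = shuffle (iota 0 (sdim a).+1) L ev3.
Proof.
move=> mL d1 d2; have /andP[m1 m2] := mL.
have L0 : (0 < size L)%N by rewrite -(size_map fst) lt0n size_eq0; case/and3P: m1.
have sd : (sdim d).+1 = size L.
  by rewrite -[sdim d]/(sdim (simp_fst d)) d1 sdim_act // size_map prednK.
rewrite EML_cbas_shuffle sd.
have -> : shuffle (iota 0 (sdim a).+1) L ev3 =
  shuffle (map id (iota 0 (sdim a).+1)) (map (nth (0, 0)%N L) (iota 0 (size L))) ev3.
  by rewrite map_id map_nth_iota0 // take_size.
rewrite shuffle_map -sd.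
pose lo : nat * nat := (0, 0)%N; pose hi := (sdim a, sdim d).
apply: (@eq_shuffle_mono _ _ lo hi) => // [|K mK]; first by rewrite mono_iota !leqnn.
have /andP[k1 k2] := mK; rewrite /comp.
have [q [q1 q2 _ ->]] := ev2P R (mK : mono2 a d K).
have dL : (sdim d < size L)%N by rewrite sd.
have dL1 : (sdim d < size (unzip1 L))%N by rewrite size_map.
have dL2 : (sdim d < size (unzip2 L))%N by rewrite size_map.
pose M := map (fun v => (id v.1, nth (0, 0)%N L v.2)) K.
have M1 : map fst M = unzip1 K.
  by rewrite /M /unzip1 -!map_comp; apply: eq_map.
have M2 : map (fst \o snd) M = map (nth 0%N (unzip1 L)) (unzip2 K).
  by rewrite -(map_nth_unzip k2 dL).1 /M /unzip2 -!map_comp; apply: eq_map.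
have M3 : map (snd \o snd) M = map (nth 0%N (unzip2 L)) (unzip2 K).
  by rewrite -(map_nth_unzip k2 dL).2 /M /unzip2 -!map_comp; apply: eq_map.
have k1' : mono 0 (size (unzip1 L)).-1 (unzip2 K) by rewrite size_map -sd.
have k2' : mono 0 (size (unzip2 L)).-1 (unzip2 K) by rewrite size_map -sd.
rewrite -/M; apply/esym; apply: ev3_cbas; rewrite ?M1 ?M2 ?M3 //.
- exact: mono_map m1 k2 dL1.
- exact: mono_map m2 k2 dL2.
- by rewrite -act_act // -d1 q2 -simp_fst_act.
- by rewrite -act_act // -d2 q2 -simp_snd_act.
Qed.

Lemma EML_assoc_cbas :
  chain_map (@assoc_map X Y Z) (EML (EML (cbas R a) (cbas R b)) (cbas R c)) =
  EML (cbas R a) (EML (cbas R b) (cbas R c)).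
Proof.
have al := chain_map_linear (@assoc_map_simplicial X Y Z).
rewrite (EML_cbas_shuffle R a b) (EML_cbas_shuffle R b c).
have -> : EML (shuffle (iota 0 (sdim a).+1) (iota 0 (sdim b).+1) (ev2 R a b)) (cbas R c) =
    shuffle (iota 0 (sdim a).+1) (iota 0 (sdim b).+1) (fun L => EML (ev2 R a b L) (cbas R c)).
  exact: (lin_shuffle (EML_linearl (cbas R c))).
rewrite (lin_shuffle al) (lin_shuffle (EML_linearr _)).
pose lo : nat * nat := (0, 0)%N.
rewrite (@eq_shuffle_mono _ _ lo (sdim a, sdim b) _ _ _
  (fun L => shuffle L (iota 0 (sdim c).+1) (ev3 \o map reassoc))) //; last first.
  move=> L mL; have [d [d1 d2 _ d4]] := ev2P R (mL : mono2 a b L).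
  by rewrite /comp d4 (shuffle_ev2_left mL).
rewrite (@eq_shuffle_mono _ _ lo (sdim b, sdim c) _ _ (_ \o _)
  (fun L => shuffle (iota 0 (sdim a).+1) L ev3)) //; last first.
  move=> L mL; have [d [d1 d2 _ d4]] := ev2P R (mL : mono2 b c L).
  by rewrite /comp d4 (shuffle_ev2_right mL).
exact: shuffle_assoc.
Qed.
End Associativity.

Lemma EML_assoc (X Y Z : sset) x y z :
  chain_map (@assoc_map X Y Z) (EML (EML x y) z) = EML x (EML y z).
Proof.
have al := chain_map_linear (@assoc_map_simplicial X Y Z).
move: x; apply: nchains_linext.
- exact: (linear_comp al (linear_comp (EML_linearl _) (EML_linearl _))).
- exact: EML_linearl.
move=> a; apply: (CN_bilin_ext (B := fun y z => chain_map (@assoc_map X Y Z) (EML (EML (cbas R a) y) z))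
  (B' := fun y z => EML (cbas R a) (EML y z))).
- split=> [{}z|{}y].
    exact: (linear_comp al (linear_comp (EML_linearl _) (EML_linearr _))).
  exact: (linear_comp al (EML_linearr _)).
- split=> [{}z|{}y].
    exact: (linear_comp (EML_linearr _) (EML_linearl _)).
  exact: (linear_comp (EML_linearr _) (EML_linearr _)).
by move=> b c; apply: EML_assoc_cbas.
Qed.

(** A path through a rectangle with m and n steps has m + n steps. *)
Lemma hcomp_EML (X Y : sset) n (x : CN R X) (y : CN R Y) :
  hcomp n (EML x y) = \sum_(i < n.+1) EML (hcomp i x) (hcomp (n - i) y).
Proof.
have hl (C : chain_complex R) i : linear (@hcomp R C i) by exact: hcomp_linear.
have sl (U V : lmodType R) m (F : 'I_m -> U -> V) : (forall j, linear (F j)) ->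
    linear (fun z => \sum_(j < m) F j z).
  by move=> Fl r u v; rewrite scaler_sumr -big_split; apply: eq_bigr => j _; apply: Fl.
apply: (CN_bilin_ext (B := fun x y => hcomp n (EML x y))
  (B' := fun x y => \sum_(i < n.+1) EML (hcomp i x) (hcomp (n - i) y))).
- split=> [{}y|{}x]; first exact: (linear_comp (hl _ _) (EML_linearl _)).
  exact: (linear_comp (hl _ _) (EML_linearr _)).
- split=> [{}y|{}x]; apply: sl => i.
    exact: (linear_comp (EML_linearl _) (hl _ _)).
  exact: (linear_comp (EML_linearr _) (hl _ _)).
move=> a b; have hE (Z : sset) i (z : simp Z) :
    hcomp i (cbas R z : CN R Z) = if sdim z == i then cbas R z else 0 := nhcomp_cbas _ _ _.
transitivity (if (sdim a + sdim b == n)%N then EML (cbas R a) (cbas R b) else 0).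
  rewrite EML_cbas_shuffle (lin_shuffle (hl _ n)).
  rewrite (@eq_shuffle _ _ _ _ _ _ _ (fun L => if (sdim a + sdim b == n)%N then ev2 R a b L else 0)).
    by case: ifP => // _; rewrite shuffle_zero.
  move=> L; rewrite !size_iota addnS addSn /= => sL _; rewrite /comp.
  have [mL|mL] := boolP (mono2 a b L); last first.
    by rewrite /ev2 (negbTE mL) if_same; apply: (lin0 (hl (CN R (sprod X Y)) n)).
  by have [d [_ _ sd ->]] := ev2P R mL; rewrite [LHS]hE sd sL.
case: eqP => [<-|ne].
  have lt : (sdim a < (sdim a + sdim b).+1)%N by rewrite ltnS leq_addr.
  rewrite (bigD1 (Ordinal lt)) // big1 => [|i /eqP ne].
    by rewrite -[nat_of_ord (Ordinal lt)]/(sdim a) !hE addKn !eqxx [RHS]addr0.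
  by rewrite hE; case: eqP => [ai|_]; [case: ne; apply/val_inj|rewrite (lin0 (EML_linearl _))].
rewrite big1 // => i _; rewrite !hE.
case: eqP => [ai|_]; last by rewrite (lin0 (EML_linearl _)).
case: eqP => [bi|_]; last by rewrite (lin0 (EML_linearr _)).
by case: ne; rewrite ai bi subnKC // -ltnS.
Qed.
End SimplicialMaps.

(** * The cyclic rotation *)
Section Rotation.
Variables (R : comNzRingType) (X : sset).

Definition rcons_map k n (w : sprod (spow X k) X n) : spow X k.+1 n := rcons_simp w.1 w.2.

Lemma rcons_map_simplicial k : simplicial (@rcons_map k).
Proof.
split=> n i [y x]; rewrite /rcons_map /=.
  by elim: k y => [|k IH] y //=; rewrite IH.
by elim: k y => [|k IH] y //=; rewrite IH.
Qed.

Lemma rot_simplicial k : simplicial (fun n => @rot_simp X k n).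
Proof.
case: k => [|k]; first by split.
split=> n i [x w].
  by have := (rcons_map_simplicial k).1 n i (w, x); exact.
by have := (rcons_map_simplicial k).2 n i (w, x); exact.
Qed.

Lemma diag_simplicial k : simplicial (fun n => @diag_simp X k n).
Proof. by split=> n i x; elim: k => //= k ->. Qed.

(** As lists of coordinates, rot_simp is the rotation of a sequence. *)
Fixpoint coords k n : spow X k n -> seq (X n) :=
  match k return spow X k n -> seq (X n) with
  | 0 => fun x => [:: x]
  | k'.+1 => fun x => x.1 :: coords x.2
  end.

Lemma size_coords k n (w : spow X k n) : size (coords w) = k.+1.
Proof. by elim: k w => //= k IH w; rewrite IH. Qed.

Lemma coords_inj k n : injective (@coords k n).
Proof.
elim: k => [|k IH] v w /=; first by case.
by case: v w => [v1 v2] [w1 w2] /= [-> /IH ->].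
Qed.

Lemma coords_rcons k n (w : spow X k n) x : coords (rcons_simp w x) = rcons (coords w) x.
Proof. by elim: k w => //= k IH w; rewrite IH. Qed.

Lemma coords_rot k n (w : spow X k n) : coords (rot_simp w) = rot 1 (coords w).
Proof. by case: k w => [|k] w //; rewrite [LHS]coords_rcons rot1_cons. Qed.

Lemma iter_rot_simp k n (w : spow X k n) : iter k.+1 (@rot_simp X k n) w = w.
Proof.
have e j : (j <= k.+1)%N -> coords (iter j (@rot_simp X k n) w) = rot j (coords w).
  elim: j => [|j IH] jk; first by rewrite rot0.
  by rewrite rotS ?size_coords //= coords_rot IH // ltnW.
by apply: coords_inj; rewrite e // -(size_coords w) rot_size.
Qed.

Lemma rot_diag k n (x : X n) : rot_simp (diag_simp k x) = diag_simp k x.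
Proof.
have e j : coords (diag_simp j x) = nseq j.+1 x by elim: j => //= j ->.
apply: coords_inj; rewrite coords_rot e rot1_cons.
by rewrite -[x in rcons _ x]/(id x) -cats1 -[[:: x]]/(nseq 1 x) -nseqD addn1.
Qed.

Lemma rot_chainE k : @rot_chain R X k = @chain_map R _ _ (fun n => @rot_simp X k n).
Proof. by []. Qed.

Lemma rot_chain_linear k : linear (@rot_chain R X k).
Proof. exact: (chain_map_linear (rot_simplicial k)). Qed.

Lemma rot_chain_diff k z : rot_chain (diff z) = diff (@rot_chain R X k z).
Proof. exact: (chain_map_diff (rot_simplicial k)). Qed.

Lemma iter_simplicial (Y : sset) (F : forall n, Y n -> Y n) j : simplicial F ->
  simplicial (fun n => iter j (F n)).
Proof. by move=> Fs; split=> n i x; elim: j => //= j ->; rewrite ?Fs.1 ?Fs.2. Qed.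

Lemma iter_chain_map (Y : sset) (F : forall n, Y n -> Y n) j z : simplicial F ->
  iter j (@chain_map R Y Y F) z = chain_map (fun n => iter j (F n)) z.
Proof.
move=> Fs; elim: j => [|j IH] /=; first by rewrite chain_map_id.
by rewrite IH (chain_map_comp z Fs (iter_simplicial j Fs)).
Qed.

Lemma iter_rot_chain k z : iter k.+1 (@rot_chain R X k) z = z.
Proof.
rewrite rot_chainE (iter_chain_map k.+1 z (rot_simplicial k)).
by apply: chain_map_id => n w; apply: iter_rot_simp.
Qed.

Lemma Delta_diff k x : Delta k (diff x) = diff (@Delta R X k x).
Proof. exact: (chain_map_diff (diag_simplicial k)). Qed.
Lemma rot_Delta k x : rot_chain (@Delta R X k x) = Delta k x.
Proof.
rewrite [LHS](chain_map_comp x (rot_simplicial k) (diag_simplicial k)).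
apply: eq_chain_map; last by move=> n y; apply: rot_diag.
by split=> n i y; rewrite !rot_diag; [rewrite (diag_simplicial k).1|rewrite (diag_simplicial k).2].
Qed.

Section TensRcons.
Variable C : chain_complex R.

Lemma tens_rcons_bilin k : bilin (fun (w : tpow C k) (x : C) => tens_rcons w x).
Proof.
elim: k => [|k [IHl IHr]]; first by split; [exact: tens_linearl|exact: tens_linearr].
have B x : bilin (fun (y : C) (w : tpow C k) => tens y (tens_rcons w x)).
  split=> [w|y]; first exact: tens_linearl.
  exact: (linear_comp (tens_linearr y) (IHl x)).
have L x : linear (fun w : tpow C k.+1 => tens_rcons w x) := tlift_linear (B x).
split=> // w r x x'.
move: w; apply: tensor_linext.
- exact: L.
- exact: linear_add (linear_scale r (L x)) (L x').
have T z y w : tens_rcons (tens y w : tpow C k.+1) z = tens y (tens_rcons w z) := tlift_tens (B z) y w.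
move=> y w; transitivity (tens y (tens_rcons w (r *: x + x'))); first exact: T.
have -> : tens_rcons w (r *: x + x') = r *: tens_rcons w x + tens_rcons w x' := IHr w r x x'.
transitivity (r *: tens y (tens_rcons w x) + tens y (tens_rcons w x')); first exact: tens_linearr.
exact: (esym (f_equal2 (fun u v => r *: u + v) (T x y w) (T x' y w))).
Qed.

Lemma tens_rcons_tens k (y : C) (w : tpow C k) x :
  tens_rcons (tens y w : tpow C k.+1) x = tens y (tens_rcons w x).
Proof.
apply: (tlift_tens (B := fun (y : C) (w : tpow C k) => tens y (tens_rcons w x))).
split=> [v|z]; first exact: tens_linearl.
exact: (linear_comp (tens_linearr z) ((tens_rcons_bilin k).1 x)).
Qed.

(** The double sum over all degrees in rot_tens is finite, with bounds that depend on the
arguments; bilinearity is checked with bounds common to all the arguments involved. *)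
Section RotTens.
Import classical_sets fsbigop.
Variable k : nat.
Let G m n (x : C) (w : tpow C k) : tpow C k.+1 :=
  (-1) ^+ (m * n) *: tens_rcons (hcomp n w) (hcomp m x).
Let S x w := \sum_(m \in [set: nat]) \sum_(n \in [set: nat]) G m n x w.

Let G_bilin m n : bilin (G m n).
Proof.
have [bl br] := tens_rcons_bilin k; split=> [w|x]; apply: linear_scale.
  exact: (linear_comp (br _) (@hcomp_linear R C m)).
exact: (linear_comp (bl _) (@hcomp_linear R (tpow C k) n)).
Qed.

Let S_bound x w M N : (forall m, (M <= m)%N -> hcomp m x = 0) ->
  (forall n, (N <= n)%N -> hcomp n w = 0) -> S x w = \sum_(m < M) \sum_(n < N) G m n x w.
Proof.
have [bl br] := tens_rcons_bilin k.
move=> xM wN; have G0 m n : (M <= m)%N || (N <= n)%N -> G m n x w = 0.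
  rewrite /G; case/orP => [/xM->|/wN->].
    by have /= -> := lin0 (br (hcomp n w)); rewrite scaler0.
  by have /= -> := lin0 (bl (hcomp m x)); rewrite scaler0.
rewrite /S (@fsum_bound _ _ M) => [|m Mm].
  by apply: eq_bigr => m _; apply: fsum_bound => n Nn; rewrite G0 // Nn orbT.
by rewrite (@fsum_bound _ _ 0) ?big_ord0 // => n _; rewrite G0 // Mm.
Qed.

Let S_bilin : bilin S.
Proof.
have bound (D : chain_complex R) (u v : D) r : exists N, [/\ forall n, (N <= n)%N -> hcomp n u = 0,
   forall n, (N <= n)%N -> hcomp n v = 0 & forall n, (N <= n)%N -> hcomp n (r *: u + v) = 0].
  have [N [uN _]] := hcomp_bound u; have [N' [vN _]] := hcomp_bound v.
  exists (maxn N N'); split=> n; rewrite geq_max => /andP[n1 n2]; [exact: uN|exact: vN|].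
  by rewrite hcomp_linear uN // vN // scaler0 addr0.
split=> [w r x x'|x r w w'].
  have [M [b1 b2 b3]] := bound _ x x' r; have [N [c1 _ _]] := bound _ w w 0.
  rewrite /= (S_bound b1 c1) (S_bound b2 c1) (S_bound b3 c1).
  rewrite scaler_sumr -big_split; apply: eq_bigr => m _; rewrite scaler_sumr -big_split.
  by apply: eq_bigr => n _; apply: (G_bilin m n).1.
have [M [b1 _ _]] := bound _ x x 0; have [N [c1 c2 c3]] := bound _ w w' r.
rewrite /= (S_bound b1 c1) (S_bound b1 c2) (S_bound b1 c3).
rewrite scaler_sumr -big_split; apply: eq_bigr => m _; rewrite scaler_sumr -big_split.
by apply: eq_bigr => n _; apply: (G_bilin m n).2.
Qed.

Lemma rot_tens_linearS : linear (@rot_tens R C k.+1).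
Proof. exact: (tlift_linear S_bilin). Qed.

Lemma rot_tens_hcomp m n (x : C) (w : tpow C k) :
  rot_tens (tens (hcomp m x) (hcomp n w) : tpow C k.+1) =
  (-1) ^+ (m * n) *: tens_rcons (hcomp n w) (hcomp m x).
Proof.
have [bl br] := tens_rcons_bilin k.
rewrite [LHS](tlift_tens S_bilin).
have hb (D : chain_complex R) j (v : D) i : (j.+1 <= i)%N -> hcomp i (hcomp j v) = 0.
  by move=> ji; rewrite hcompK gtn_eqF.
rewrite (S_bound (hb _ m x) (hb _ n w)) big_ord_recr big1 => [|i _]; last first.
  apply: big1 => j _; rewrite /G [hcomp i _]hcompK ltn_eqF //.
  by have /= -> := lin0 (br (hcomp j (hcomp n w))); rewrite scaler0.
rewrite [LHS]add0r big_ord_recr big1 => [|j _]; last first.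
  rewrite /G [hcomp j _]hcompK ltn_eqF //.
  by have /= -> := lin0 (bl (hcomp m (hcomp m x))); rewrite scaler0.
by rewrite [LHS]add0r /G !hcompK !eqxx.
Qed.
End RotTens.

Lemma rot_tens_linear k : linear (@rot_tens R C k).
Proof. by case: k => [|k]; [move=> a u v|apply: rot_tens_linearS]. Qed.
End TensRcons.

Lemma tensor_homog_ext (C D : chain_complex R) (W : lmodType R) (F G : tensor C D -> W) :
  linear F -> linear G ->
  (forall m n x y, F (tens (hcomp m x) (hcomp n y)) = G (tens (hcomp m x) (hcomp n y))) -> F =1 G.
Proof.
move=> Fl Gl FG; apply: tensor_linext => // x y.
have [N ->] := hcomp_sum x; have [N' ->] := hcomp_sum y.
have -> : tens (\sum_(i < N) hcomp i x) (\sum_(j < N') hcomp j y) =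
    \sum_(i < N) \sum_(j < N') tens (hcomp i x) (hcomp j y).
  rewrite (lin_sum (tens_linearl _)); apply: eq_bigr => i _.
  by rewrite (lin_sum (tens_linearr _)).
rewrite (lin_sum Fl) (lin_sum Gl); apply: eq_bigr => i _.
by rewrite (lin_sum Fl) (lin_sum Gl); apply: eq_bigr => j _.
Qed.

Let gk k := ctr_g (EZpow R X k).
Let gl k : linear (@gk k). Proof. exact: ctr_g_linear (EZpow_contraction R X k). Qed.

Lemma EZpow_g_hcomp k n w : gk (hcomp n w) = hcomp n (@gk k w).
Proof.
elim: k n w => // k IH n.
have hl (C : chain_complex R) i : linear (@hcomp R C i) by exact: hcomp_linear.
have l1 : linear (fun w => gk (hcomp n (w : tpow (CN R X) k.+1))).
  exact: (linear_comp (@gl k.+1) (hl (tpow (CN R X) k.+1) n)).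
have l2 : linear (fun w : tpow (CN R X) k.+1 => hcomp n (gk w)).
  exact: (linear_comp (hl _ n) (@gl k.+1)).
apply: (tensor_linext l1 l2).
move=> x w; have hx : @hcomp R (tpow (CN R X) k.+1) n (tens x w) =
    \sum_(i < n.+1) tens (hcomp i x) (hcomp (n - i) w) := thcomp_tens n x w.
apply: (eq_trans (f_equal (@gk k.+1) hx)).
apply: (eq_trans (lin_sum (@gl k.+1) _ _ _)).
transitivity (hcomp n (EML x (gk w))); last exact: (f_equal (hcomp n) (esym (EZpow_g_tens x w))).
by rewrite hcomp_EML; apply: eq_bigr => i _; rewrite -IH; apply: EZpow_g_tens.
Qed.

(** Naturality and associativity of EML; appending a factor commutes with the product by
a factor on the other side. *)
Lemma EML_rcons k (y x : CN R X) (z : CN R (spow X k)) :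
  chain_map (@rcons_map k.+1) (EML (EML y z) x) = EML y (chain_map (@rcons_map k) (EML z x)).
Proof.
have ids : simplicial (fun n => @id (X n)) by split.
have ps := prod_map_simplicial ids (@rcons_map_simplicial k).
transitivity (EML (chain_map (fun n => @id (X n)) y) (chain_map (@rcons_map k) (EML z x))); last first.
  by congr (EML _ _); apply: chain_map_id.
rewrite -(EML_natural _ _ ids (@rcons_map_simplicial k)) -EML_assoc.
by rewrite (chain_map_comp _ ps (@assoc_map_simplicial _ _ _)).
Qed.

Lemma EZpow_g_rcons k w x : chain_map (@rcons_map k) (EML (@gk k w) x) = gk (tens_rcons w x).
Proof.
elim: k w x => [|k IH] w x.
  refine (eq_trans (y := EML (w : CN R X) x) _ (esym (@EZpow_g_tens R X 0 w x))).
  by apply: chain_map_id => n [? ?].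
have l1 : linear (fun w => chain_map (@rcons_map k.+1) (EML (@gk k.+1 w) x)).
  exact: (linear_comp (chain_map_linear (@rcons_map_simplicial k.+1))
    (linear_comp (EML_linearl x) (@gl k.+1))).
have l2 : linear (fun w => gk (@tens_rcons R (CN R X) k.+1 w x)).
  exact: (linear_comp (@gl k.+2) ((@tens_rcons_bilin (CN R X) k.+1).1 x)).
move: w; apply: (tensor_linext l1 l2) => y w.
transitivity (chain_map (@rcons_map k.+1) (EML (EML y (@gk k w)) x)).
  exact: (f_equal (fun z => chain_map (@rcons_map k.+1) (EML z x)) (EZpow_g_tens y w)).
rewrite EML_rcons IH; symmetry.
apply: (eq_trans (f_equal (@gk k.+2) (tens_rcons_tens y w x))).
exact: EZpow_g_tens.
Qed.

Lemma rot_chain_swap k (x : CN R X) (z : CN R (spow X k)) :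
  @rot_chain R X k.+1 (EML x z) = chain_map (@rcons_map k) (chain_map (@swap_map _ _) (EML x z)).
Proof.
by rewrite (chain_map_comp _ (@rcons_map_simplicial k) (@swap_map_simplicial _ _)).
Qed.

(** The rotation of X x X^k exchanges the two factors and then appends the former first
one, so the symmetry of EML applies. *)
Lemma rot_EZpow_g k w : rot_chain (@gk k w) = gk (rot_tens w).
Proof.
case: k w => [|k]; first by move=> w; apply: chain_map_id.
have l1 : linear (fun w => @rot_chain R X k.+1 (gk w)).
  exact: (linear_comp (@rot_chain_linear k.+1) (@gl k.+1)).
have l2 : linear (fun w : tpow (CN R X) k.+1 => gk (rot_tens w)).
  exact: (linear_comp (@gl k.+1) (@rot_tens_linear (CN R X) k.+1)).
apply: (tensor_homog_ext l1 l2) => m n x w.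
apply: (eq_trans (f_equal (@rot_chain R X k.+1) (EZpow_g_tens (hcomp m x) (hcomp n w)))).
rewrite rot_chain_swap -/(gk _) EZpow_g_hcomp EML_swap.
rewrite (linZ (chain_map_linear (@rcons_map_simplicial k))) -EZpow_g_hcomp EZpow_g_rcons.
apply: (eq_trans (esym (linZ (@gl k.+1) _ _))).
exact: (f_equal (@gk k.+1) (esym (rot_tens_hcomp m n x w))).
Qed.
End Rotation.

Theorem theorem4p3 (R : comNzRingType) (X : sset) (p : nat) (p_prime : prime p)
    (i : nat) (x : CN R X) :
  diff (Dmap p.-1 i x) + (-1) ^+ i.+1 *: Dmap p.-1 i (diff x) =
    alpha i (Dmap_pred p.-1 i x).
Proof.
move: p.-1 => k {p p_prime}.
have E j y : gamma_phi_Delta k j y =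
    cyc_E (EZpow R X k) k (@rot_chain R X k) (@Delta R X k) j y.
  by elim: j => //= j ->.
have := cyc_D_diff (EZpow_contraction R X k) (@rot_chain_linear R X k)
  (@rot_chain_diff R X k) (@Delta_diff R X k) (@iter_rot_chain R X k)
  (@rot_EZpow_g R X k) (@rot_Delta R X k) i x.
rewrite -!E => ->; case: i => [|i]; last by rewrite -E.
rewrite /alpha /= big1 // => j _; elim: j => //= j ->.
exact: (lin0 (@rot_tens_linear R (CN R X) k)).
Qed.
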